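(* Let $d\ge2$, $r\ge1$ and $0\le k\le d$, and let $\mathcal T_h$ be a conforming simplicial partition of a bounded Lipschitz polyhedral domain $\Omega\subset\mathbb R^d$. For each subsimplex in $\mathcal T_h$, fix an orientation and an oriented orthonormal tangential frame independent of the containing element. Define the index set $$\mathcal I_r^k(\mathcal T_h):=\{(\alpha,e,\sigma,f)\mid f\in\Delta_\ell(\mathcal T_h),\ e\in\Delta_s(f),\ \boldsymbol x_\alpha\in\mathcal X_{\mathring e},\ \sigma\in\Sigma(s+k-\ell,s),\ k\le\ell\le d,\ \ell-k\le s\le\ell\},$$ and for $(\alpha,e,\sigma,f)\in\mathcal I_r^k(\mathcal T_h)$ define $$N_{\alpha,e}^{\sigma,f}(\omega):=\left\langle\omega(\boldsymbol x_\alpha),\ \mathrm dt_\sigma^e\wedge\mathrm d_f\widehat\lambda_{[f\setminus e]}\right\rangle$$ (with $\omega(\boldsymbol x_\alpha)$ computed from $\omega|_T$ for an element $T$ containing $f$). Then these degrees of freedom are single-valued across $f$ and uniquely determine $\omega\in\mathbb P_r\Lambda^k(\mathcal T_h)$. A scaled dual basis of $\mathbb P_r\Lambda^k(\mathcal T_h)$ is $\{\boldsymbol\phi_{\alpha,e}^{\sigma,f}\}_{(\alpha,e,\sigma,f)\in\mathcal I_r^k(\mathcal T_h)}$, defined elementwise, for every $T\in\mathcal T_h$, by $$\boldsymbol\phi_{\alpha,e}^{\sigma,f}\big|_T(\boldsymbol x)=\begin{cases}\phi_\alpha|_T(\boldsymbol x)\ \mathrm dt_\sigma^e\wedge\mathrm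 d\lambda^T_{[f\setminus e]},& f\subseteq T,\\ 0,& f\not\subseteq T,\end{cases}$$ where $\lambda_i^T$ are the barycentric coordinates on $T$.
   Context: Geometry. Conforming means that the intersection of any two simplices of $\mathcal T_h$ is empty or a common lower-dimensional subsimplex. $\Delta_\ell(\mathcal T_h)$ is the set of all $\ell$-dimensional subsimplices of $\mathcal T_h$, $\Delta_s(f)$ that of $f$; subsimplices are identified with their sets of (globally numbered) vertices. $\mathscr T^f\subseteq\mathbb R^d$ is the tangent space of $f$ (span of differences of vertices). Forms. $\operatorname{Alt}^k$ denotes alternating $k$-linear forms, with the induced inner product $\langle\cdot,\cdot\rangle$. $\Sigma(m,n)$ is the set of increasing maps $\{1,\dots,m\}\to\{1,\dots,n\}$ (one empty map if $m=0$). The frame of $e\in\Delta_s(\mathcal T_h)$ is $\{\boldsymbol t_1^e,\dots,\boldsymbol t_s^e\}$, an orthonormal basis of $\mathscr T^e$; for $\boldsymbol u\in\mathbb R^d$, $\mathrm du:=\boldsymbol u^\flat$ is the 1-form $\boldsymbol v\mapsto\boldsymbol u\cdot\boldsymbol v$; $\mathrm dt_\sigma^e:=\mathrm dt^e_{\sigma(1)}\wedge\cdots\wedge\mathrm dt^e_{\sigma(m)}$. For a subsimplex $g$ and a vertex $i$ of $g$, $\nabla_g\lambda_i\in\mathscr T^g$ is the surface gradient on $g$ of the barycentric coordinate of vertex $i$, and $\mathrm d_g\lambda_i=(\nabla_g\lambda_i)^\flat$. For $e\subseteq f\subseteq T$, with factors in increasing order of $j$, $\mathrm d_f\widehat\lambda_{[f\setminus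 e]}:=\bigwedge_{j\in f\setminus e}\mathrm d_{e\cup\{j\}}\lambda_j$ and $\mathrm d\lambda^T_{[f\setminus e]}:=\bigwedge_{j\in f\setminus e}\mathrm d\lambda_j^T$; empty products equal $1$. Finite element space. $\mathbb P_r\Lambda^k(T)$ is the space of $k$-forms on $T$ with polynomial coefficients of degree $\le r$; $\operatorname{tr}_f$ is pullback to $f$. $\mathbb P_r\Lambda^k(\mathcal T_h)$ is the space of $\omega\in L^2\Lambda^k(\Omega)$ with $\omega|_T\in\mathbb P_r\Lambda^k(T)$ for all $T\in\mathcal T_h$ such that, for every $f\in\Delta_\ell(\mathcal T_h)$ with $k\le\ell\le d-1$, each moment $\int_e\langle\operatorname{tr}_f(\omega|_T),\mathrm dt_\sigma^e\wedge\mathrm d_f\widehat\lambda_{[f\setminus e]}\rangle\,q\,\mathrm ds$, with $e\in\Delta_s(f)$, $\ell-k\le s\le\ell$, $q\in\mathbb P_{r-(s+1)}(e)$ (zero space if $r<s+1$; $\int_{\mathtt v}u\,\mathrm ds=u(\mathtt v)$ at a vertex), $\sigma\in\Sigma(s+k-\ell,s)$, has the same value for all elements $T$ containing $f$. Lattice. Fix a global numbering $\iota(g)$ of all subsimplices $g$ of $\mathcal T_h$. The global index set consists of $\alpha=(\alpha_0,\dots,\alpha_d,\alpha_{d+1})\in\mathbb N^{d+2}$ such that for some $g=f_\alpha\in\Delta_m(\mathcal T_h)$, $0\le m\le d$: $\alpha_0,\dots,\alpha_m>0$, $\alpha_0+\dots+\alpha_m=r$, $\alpha_i=0$ for $m<i\le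 d$, and $\alpha_{d+1}=\iota(g)$. For $T\supseteq f_\alpha$, $\alpha^T=(\alpha_0^T,\dots,\alpha_d^T)$ is the multi-index obtained by assigning $\alpha_0,\dots,\alpha_m$ to the corresponding vertices of $f_\alpha\subseteq T$ and zero to the other vertices of $T$; the interpolation point is $\boldsymbol x_\alpha=\frac1r\sum_{i=0}^d\alpha_i^T\mathtt v_i^T$ (independent of $T$), where $\mathtt v_i^T$ are the vertices of $T$. $\mathcal X_{\mathring e}$ is the set of interpolation points in the relative interior of $e$ (equal to $\{\mathtt v\}$ if $e=\mathtt v$ is a vertex). The scalar Lagrange basis function is $\phi_\alpha|_T=\frac1{\alpha^T!}\prod_{i=0}^d\prod_{j=0}^{\alpha_i^T-1}(r\lambda_i^T-j)$ if $f_\alpha\subseteq T$ and $\phi_\alpha|_T=0$ otherwise, with $\alpha^T!=\prod_i\alpha_i^T!$. Terminology. ''Single-valued across $f$'' means that for $\omega\in\mathbb P_r\Lambda^k(\mathcal T_h)$ the value $N_{\alpha,e}^{\sigma,f}(\omega)$ is the same for all elements $T$ containing $f$. ''Uniquely determine'' means that elements of $\mathbb P_r\Lambda^k(\mathcal T_h)$ with the same values of all these functionals are equal. A basis $\{\boldsymbol\phi_i\}$ is scaled dual to functionals $\{N_i\}$ if $N_i(\boldsymbol\phi_j)=c_i\delta_{ij}$ with all $c_i\ne0$. *)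

(* Defs.v *)
From HB Require Import structures.
From mathcomp Require Import all_boot all_order perm all_algebra.
From mathcomp Require Import all_classical all_reals all_analysis.

Set Implicit Arguments.
Unset Strict Implicit.
Unset Printing Implicit Defensive.

Import Order.TTheory GRing.Theory Num.Theory.
Import numFieldNormedType.Exports.
Local Open Scope classical_set_scope.
Local Open Scope ring_scope.

(* Alternating forms.                                                         *)
(* A k-form on R^n is a function of k vectors, passed as the rows of a k x n  *)
(* matrix, in the same way as for the determinant. It is evaluated at the     *)
(* basis vectors e_(s 0), ..., e_(s k.-1) as a (rowsub s 1%:M).               *)

Notation form R n k := ('M[R]_(k, n) -> R) (only parsing).

Section Forms.
Variables (R : realType) (n : nat).

Definition alternating k (a : form R n k) : Prop :=
  (forall (A B C : 'M[R]_(k, n)) (i : 'I_k) (b c : R),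
      row i A = b *: row i B + c *: row i C ->
      row' i B = row' i A -> row' i C = row' i A ->
      a A = b * a B + c * a C) /\
  (forall (A : 'M[R]_(k, n)) (i j : 'I_k),
      i != j -> row i A = row j A -> a A = 0).

(* Sigma(m, p), with indices starting from 0 *)
Definition increasing m p : pred {ffun 'I_m -> 'I_p} :=
  [pred s : {ffun 'I_m -> 'I_p} |
    [forall i : 'I_m, forall j : 'I_m, (i < j)%N ==> (s i < s j)%N]].

(* The inner product on Alt^k(R^n) induced by the Euclidean one on R^n: the   *)
(* forms dx_s, s in Sigma(k, n), are orthonormal.                             *)
Definition ip k (a b : form R n k) : R :=
  \sum_(s : {ffun 'I_k -> 'I_n} | increasing s)
    a (rowsub s 1%:M) * b (rowsub s 1%:M).

Definition flat (u : 'rV[R]_n) : form R n 1 := fun A => (A *m u^T) 0 0.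

(* normalized so that wedge products of 1-forms are determinants *)
Definition wedge p q (a : form R n p) (b : form R n q) : form R n (p + q) :=
  fun A => ((p`! * q`!)%:R)^-1 *
    \sum_(s : 'S_(p + q))
      (-1) ^+ s * a (usubmx (row_perm s A)) * b (dsubmx (row_perm s A)).

(* (u_0)^flat /\ ... /\ (u_(m-1))^flat *)
Fixpoint wedges m : ('I_m -> 'rV[R]_n) -> form R n m :=
  match m with
  | 0 => fun _ _ => 1
  | m'.+1 => fun u => wedge (flat (u ord0)) (wedges (fun i => u (lift ord0 i)))
  end.

(* Transport along a provable equality m = k; conform_mx is the identity when *)
(* the dimensions agree, which is the only case used.                         *)
Definition as_degree k m (a : form R n m) : form R n k :=
  fun A => a (conform_mx 0 A).

(* Polynomial functions of total degree at most m; only 0 if m < 0.           *)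
Definition poly_le (m : int) (p : 'rV[R]_n -> R) : Prop :=
  exists c : {ffun 'I_n -> 'I_(`|m|%N).+1} -> R,
  forall x, p x =
    \sum_(a : {ffun 'I_n -> 'I_(`|m|%N).+1} | Posz (\sum_i a i)%N <= m)
      c a * \prod_i x 0 i ^+ a i.

Definition poly_form (r k : nat) (w : 'rV[R]_n -> form R n k) : Prop :=
  (forall x, alternating (w x)) /\
  (forall s : {ffun 'I_k -> 'I_n}, increasing s ->
    poly_le r%:Z (fun x => w x (rowsub s 1%:M))).

(* gradient of g at x along the space spanned by the orthonormal rows of B *)
Definition grad m (B : 'M[R]_(m, n)) (g : 'rV[R]_n -> R) (x : 'rV[R]_n) :
    'rV[R]_n :=
  \sum_(i < m) 'D_(row i B) g x *: row i B.

End Forms.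

Section Domains.
Variables (R : realType) (d : nat).
Implicit Type Omega : set 'rV[R]_d.

Definition dot (x y : 'rV[R]_d) : R := (x *m y^T) 0 0.

(* Near each boundary point, Omega is the strict epigraph, in some direction  *)
(* u, of a Lipschitz function of the component orthogonal to u.               *)
Definition lipschitz_domain Omega : Prop :=
  forall x, (closure Omega `\` Omega) x ->
  exists (u : 'rV[R]_d) (g : 'rV[R]_d -> R) (L e : R),
  [/\ dot u u = 1, L.-lipschitz g, 0 < e &
      forall y, ball x e y ->
        (Omega y <-> g (y - dot y u *: u) < dot y u)].

Definition polyhedral Omega : Prop :=
  exists s : seq ('rV[R]_d * R), (forall h, h \in s -> h.1 != 0) /\
  forall x, (closure Omega `\` Omega) x ->
    exists2 h, h \in s & dot h.1 x = h.2.

Definition bounded_Lipschitz_polyhedral_domain Omega : Prop :=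
  [/\ open Omega, connected Omega & Omega !=set0] /\
  [/\ bounded_set Omega, lipschitz_domain Omega & polyhedral Omega].

End Domains.

(* Simplices are identified with their sets of globally numbered vertices.    *)
Record mesh (R : realType) (d : nat) := Mesh {
  nvert : nat;
  vert : 'I_nvert -> 'rV[R]_d;
  elems : {set {set 'I_nvert}}
}.

Section Simplices.
Variables (R : realType) (d : nat) (M : mesh R d).
Local Notation simplex := {set 'I_(nvert M)}.
Implicit Types (e f g T : simplex) (i : 'I_(nvert M)).

Definition sdim f : nat := #|f|.-1.

(* Delta_l(T_h) and Delta_s(f) *)
Definition Delta (l : nat) : {set simplex} :=
  [set f : simplex | (#|f| == l.+1) && [exists T in elems M, f \subset T]].
Definition Delta_of (s : nat) f : {set simplex} :=
  [set e : simplex | (#|e| == s.+1) && (e \subset f)].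
Definition subsimplices : {set simplex} :=
  [set f : simplex | (f != finset.set0) && [exists T in elems M, f \subset T]].

Definition hull f : set 'rV[R]_d :=
  [set x | exists c : 'I_(nvert M) -> R,
    [/\ forall i, 0 <= c i, \sum_(i in f) c i = 1
      & x = \sum_(i in f) c i *: vert i]].
Definition relint f : set 'rV[R]_d :=
  [set x | exists c : 'I_(nvert M) -> R,
    [/\ forall i, 0 < c i, \sum_(i in f) c i = 1
      & x = \sum_(i in f) c i *: vert i]].

(* The rows are the vertices of f in homogeneous coordinates.                 *)
Definition vmx f : 'M[R]_(#|f|, d + 1) :=
  \matrix_(j < #|f|) row_mx (vert (enum_val j)) 1%:M.

(* The barycentric coordinate of vertex i of f at a point x of the affine     *)
(* hull of f (0 if i is not in f).                                            *)
Definition bary f i (x : 'rV[R]_d) : R :=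
  \sum_(j < #|f| | enum_val j == i)
    (row_mx x (1%:M : 'M[R]_1) *m pinvmx (vmx f)) 0 j.

(* the space T^f, as a row space *)
Definition tangent f : 'M[R]_d :=
  (\sum_(i in f) \sum_(j in f) genmx (vert j - vert i)%R)%MS.

Definition vpoint f (j : nat) : 'rV[R]_d := nth 0 [seq vert i | i <- enum f] j.
Definition edges f : 'M[R]_(sdim f, d) :=
  \matrix_(j < sdim f) (vpoint f j.+1 - vpoint f 0).

Definition simplicial_partition (Omega : set 'rV[R]_d) : Prop :=
  [/\ forall T, T \in elems M -> #|T| = d.+1 /\ row_free (vmx T),
      forall T T', T \in elems M -> T' \in elems M -> T != T' ->
        hull T `&` hull T' = set0 \/
        exists f, [/\ f != finset.set0, f \proper T, f \proper T'
                    & hull T `&` hull T' = hull f]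
    & closure Omega = \bigcup_(T in [set` elems M]) hull T].

(* An orientation of e is recorded by its sign relative to the one given by   *)
(* the increasing order of the vertices. A vertex (sdim e = 0) has an empty   *)
(* frame, which agrees with both of its orientations.                         *)
Definition oriented_orthonormal_frames (orient : simplex -> bool)
    (t : forall e : simplex, 'M[R]_(sdim e, d)) : Prop :=
  forall e, e \in subsimplices ->
  [/\ t e *m (t e)^T = 1%:M, (t e :=: tangent e)%MS
    & (0 < sdim e)%N -> 0 < (-1) ^+ orient e * \det (edges e *m (t e)^T)].

End Simplices.

(* Integral over the simplex {y : 0 <= y_i, y_0 + ... + y_(s-1) <= a} of R^s  *)
Fixpoint corner_int (R : realType) (s : nat) : R -> ('rV[R]_s -> R) -> R :=
  match s with
  | 0 => fun _ u => u 0
  | s'.+1 => fun a u =>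
      \int[lebesgue_measure]_(x in `[0, a])
        corner_int (a - x) (fun y : 'rV[R]_s' => u (row_mx (x%:M : 'M[R]_1) y))
  end.

(* int_e u ds, by pulling back to the reference simplex *)
Definition simplex_int (R : realType) (d : nat) (M : mesh R d)
    (e : {set 'I_(nvert M)}) (u : 'rV[R]_d -> R) : R :=
  Num.sqrt (\det (edges e *m (edges e)^T)) *
  corner_int 1 (fun y : 'rV[R]_(sdim e) => u (vpoint e 0 + y *m edges e)).

Section Space.
Variables (R : realType) (d : nat) (M : mesh R d) (r k : nat).
Local Notation simplex := {set 'I_(nvert M)}.
Variable t : forall e : simplex, 'M[R]_(sdim e, d).
Implicit Types (e f T : simplex).

(* pullback to f, with T^f identified with R^(sdim f) through the frame of f *)
Definition tr f (a : form R d k) : form R (sdim f) k :=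
  fun A => a (A *m t f).
Arguments tr : clear implicits.

Definition dt e m (s : {ffun 'I_m -> 'I_(sdim e)}) : form R d m :=
  wedges (fun i => row (s i) (t e)).

(* Barycentric coordinates are affine, so their gradients are constant: they  *)
(* are evaluated at the vertex j. The elements of f :\: e are enumerated in   *)
(* increasing order.                                                          *)
Definition surface_grad f (j : 'I_(nvert M)) : 'rV[R]_d :=
  grad (t f) (bary f j) (vert j).
Definition dlambda_hat f e : form R d #|f :\: e| :=
  wedges (fun i => surface_grad (enum_val i |: e)%SET (enum_val i)).
Arguments dlambda_hat : clear implicits.
Definition dlambda T f e : form R d #|f :\: e| :=
  wedges (fun i => grad 1%:M (bary T (enum_val i)) (vert (enum_val i))).

(* the degree of s in dt_s^e /\ dlambda_[f \ e] *)
Definition sdeg e f : nat := sdim e + k - sdim f.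

Definition test_form e f (s : {ffun 'I_(sdeg e f) -> 'I_(sdim e)}) :
    form R d k :=
  as_degree (wedge (dt s) (dlambda_hat f e)).

(* Piecewise k-forms. An element w of L^2 which is polynomial on each element *)
(* is given by its restrictions w T, each extended to R^d as a polynomial.    *)
Definition element := {T : simplex | T \in elems M}.
Notation pwform := (element -> 'rV[R]_d -> form R d k).

Definition PLambda : set pwform :=
  [set w : pwform |
    (forall T : element, poly_form r (w T)) /\
    forall (l s : nat) f e (sg : {ffun 'I_(sdeg e f) -> 'I_(sdim e)})
           (q : 'rV[R]_d -> R),
      (k <= l <= d.-1)%N -> f \in Delta M l ->
      (l - k <= s <= l)%N -> e \in Delta_of s f ->
      poly_le (r%:Z - s.+1%:Z) q -> increasing sg ->
    forall T T' : element, f \subset val T -> f \subset val T' ->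
      simplex_int e (fun x => ip (tr f (w T x)) (tr f (test_form sg)) * q x) =
      simplex_int e (fun x => ip (tr f (w T' x)) (tr f (test_form sg)) * q x)].

End Space.
Arguments dlambda {R d M} T f e _.

Section Lattice.
Variables (R : realType) (d : nat) (M : mesh R d) (r : nat).
Local Notation simplex := {set 'I_(nvert M)}.
Variable iota : simplex -> nat.
Implicit Types (g e T : simplex) (a : d.+2.-tuple nat) (i : 'I_(nvert M)).

Definition lattice a : Prop :=
  exists m g,
  [/\ (m <= d)%N, g \in Delta M m & nth 0%N a d.+1 = iota g] /\
  [/\ forall j, (j <= m)%N -> (0 < nth 0%N a j)%N,
      (\sum_(0 <= j < m.+1) nth 0%N a j)%N = r
    & forall j, (m < j <= d)%N -> nth 0%N a j = 0%N].

(* the simplex f_alpha; iota is injective on subsimplices *)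
Definition fsimp a : simplex :=
  odflt finset.set0 [pick g in subsimplices M | iota g == nth 0%N a d.+1].

(* The multi-index alpha^T, indexed by all the vertices of the mesh. It is    *)
(* supported in fsimp a, hence does not depend on T.                          *)
Definition multi a i : nat :=
  if i \in fsimp a then nth 0%N a (index i (enum (fsimp a))) else 0%N.

Definition xpoint a : 'rV[R]_d :=
  (r%:R)^-1 *: \sum_i (multi a i)%:R *: vert i.

Definition interior_points e : set 'rV[R]_d :=
  [set x | relint e x /\ exists2 a, lattice a & x = xpoint a].

Definition lagrange_basis a T (x : 'rV[R]_d) : R :=
  if fsimp a \subset T then
    ((\prod_(i in T) (multi a i)`!)%N%:R)^-1 *
    \prod_(i in T) \prod_(0 <= j < multi a i) (r%:R * bary T i x - j%:R)
  else 0.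

End Lattice.

Record dof_index (R : realType) (d : nat) (M : mesh R d) (k : nat) := DofIndex {
  ialpha : d.+2.-tuple nat;
  ie : {set 'I_(nvert M)};
  iface : {set 'I_(nvert M)};
  isigma : {ffun 'I_(sdeg k ie iface) -> 'I_(sdim ie)}
}.

Section DofIndexChoice.
Variables (R : realType) (d : nat) (M : mesh R d) (k : nat).
Local Notation simplex := {set 'I_(nvert M)}.
Local Notation sigma_type p :=
  {ffun 'I_(sdeg k p.1.2 p.2) -> 'I_(sdim p.1.2)}.
Local Notation code :=
  {p : d.+2.-tuple nat * simplex * simplex & sigma_type p}.
Definition dof_index_encode (i : dof_index M k) : code :=
  existT (fun p : d.+2.-tuple nat * simplex * simplex => sigma_type p)
    (ialpha i, ie i, iface i) (isigma i).
Definition dof_index_decode (c : code) : dof_index M k :=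
  @DofIndex R d M k (projT1 c).1.1 (projT1 c).1.2 (projT1 c).2 (projT2 c).
Lemma dof_index_encodeK : cancel dof_index_encode dof_index_decode.
Proof. by case. Qed.
HB.instance Definition _ :=
  Choice.copy (dof_index M k) (can_type dof_index_encodeK).
End DofIndexChoice.

Section Dofs.
Variables (R : realType) (d : nat) (M : mesh R d) (r k : nat).
Local Notation simplex := {set 'I_(nvert M)}.
Variables (t : forall e : simplex, 'M[R]_(sdim e, d)) (iota : simplex -> nat).
Notation pwform := (element M -> 'rV[R]_d -> form R d k).
Implicit Types (i : dof_index M k) (w : pwform).

(* the index set I_r^k(T_h) *)
Definition dof_indices : set (dof_index M k) :=
  [set i | exists l s : nat,
    [/\ (k <= l <= d)%N, iface i \in Delta M l,
        (l - k <= s <= l)%N & ie i \in Delta_of s (iface i)] /\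
    [/\ lattice r iota (ialpha i),
        interior_points r iota (ie i) (xpoint r iota (ialpha i))
      & increasing (isigma i)]].

Definition dof_on i (u : 'rV[R]_d -> form R d k) : R :=
  ip (u (xpoint r iota (ialpha i))) (test_form t (isigma i)).

Definition dof i w : R :=
  if [pick T : element M | iface i \subset val T] is Some T
  then dof_on i (w T) else 0.

Definition single_valued : Prop :=
  forall w i, PLambda r t w -> dof_indices i ->
  forall T T' : element M, iface i \subset val T -> iface i \subset val T' ->
    dof_on i (w T) = dof_on i (w T').

Definition unisolvent : Prop :=
  forall w w' : pwform, PLambda r t w -> PLambda r t w' ->
  (forall i, dof_indices i -> dof i w = dof i w') -> w = w'.

Definition dual_form i : pwform := fun T x =>
  if iface i \subset val T then
    lagrange_basis r iota (ialpha i) (val T) x *: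
      as_degree (wedge (dt t (isigma i)) (dlambda (val T) (iface i) (ie i)))
  else 0.

End Dofs.

Section Bases.
Variables (R : realType) (U : lmodType R) (J : choiceType).
Implicit Types (V : set U) (I : set J) (phi : J -> U) (N : J -> U -> R).

Definition is_basis V I phi : Prop :=
  [/\ forall i, I i -> V (phi i),
      forall (s : seq J) (c : J -> R), uniq s -> {in s, forall i, I i} ->
        \sum_(i <- s) c i *: phi i = 0 -> {in s, forall i, c i = 0}
    & forall w, V w -> exists (s : seq J) (c : J -> R),
        [/\ uniq s, {in s, forall i, I i} & w = \sum_(i <- s) c i *: phi i]].

Definition scaled_dual_basis V I phi N : Prop :=
  is_basis V I phi /\
  exists c : J -> R,
    (forall i, I i -> c i != 0) /\
    (forall i j, I i -> I j -> N i (phi j) = c i * (i == j)%:R).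

End Bases.

(* Main.v *)
(* Continuity across a face f of the moments on e, for all e in f, amounts to
   continuity of the whole pullback to f. Indeed the test forms of (e, f'),
   with e in f' in f, evaluate a k-form on the k-subsets of the basis of T^f
   formed by the frame of e and the normals of e in e + j, j in f \ e. By
   induction on dim e, the jump of such a component vanishes on the boundary of
   e; so it is the bubble of e times a polynomial of degree r - dim e - 1, and
   testing with this polynomial gives zero. The degrees of freedom at a lattice
   point therefore are the components of the form in such a basis: they are
   single-valued, and unisolvence is Lagrange interpolation of each component.
   Duality holds because the bases (t^e, normals of e) and (t^e, gradients of
   the barycentric coordinates of T) are orthogonal up to scaling. *)

Require Import Defs.
From mathcomp Require Import all_boot all_order all_algebra perm.
From mathcomp Require Import all_classical all_reals all_analysis.
From mathcomp Require Import ring zify.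
Import numFieldNormedType.Exports.
(* [alternating] is also a constant of the libraries imported above *)
Import Defs.

Set Implicit Arguments.
Unset Strict Implicit.
Unset Printing Implicit Defensive.

Import Order.TTheory GRing.Theory Num.Theory.
Local Open Scope ring_scope.

(** * Alternating forms *)

(** A wedge product of 1-forms is handled only as a constant times a determinant. The constant is
    nonzero and independent of the vectors, which suffices since duality is claimed up to scaling.
    The inner product with such a determinant is evaluation at its rows ([ip_det]), so each degree
    of freedom is, up to a constant, the value of the form at a tuple of vectors, named by the type
    [label]. The induction over subfaces has to carry equality of the whole pullback to f at the
    points of e: the basis adapted to a proper face of e differs from the one adapted to e, so
    single components could not be compared on the boundary. The converse, from traces back to
    moments, is immediate. The resulting equivalence [PLambda_traceP] removes the integrals, and the
    dual forms are shown to lie in the space by comparing values at points. Polynomials are treated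
    as homogeneous functions of one weight per mesh vertex, so that restriction to a face just sets
    weights to zero. *)

Lemma tuple_perm (L : Type) k (tau tau0 : 'I_k -> L) :
    injective tau -> (forall i, exists j, tau i = tau0 j) ->
  exists p : 'S_k, tau =1 tau0 \o p.
Proof.
move=> tau_inj /fin_all_exists[p tau_p].
have p_inj : injective p by move=> i j e; apply: tau_inj; rewrite !tau_p e.
by exists (perm p_inj) => i /=; rewrite permE.
Qed.

Section AlternatingForms.
Variables (R : realType) (n : nat).

(** Turns the relational multilinearity in [alternating] into equations that can be used for
    rewriting. *)
Definition set_row k (A : 'M[R]_(k, n)) (i : 'I_k) (u : 'rV[R]_n) :
    'M[R]_(k, n) :=
  \matrix_(x < k) (if x == i then u else row x A).

Lemma row_set_row k (A : 'M[R]_(k, n)) i u x :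
  row x (set_row A i u) = if x == i then u else row x A.
Proof. by rewrite rowK. Qed.

Lemma set_row_id k (A : 'M[R]_(k, n)) i : set_row A i (row i A) = A.
Proof.
by apply/row_matrixP => x; rewrite row_set_row; case: eqP => // ->.
Qed.

Lemma row'_set_row k (A : 'M[R]_(k, n)) i u : row' i (set_row A i u) = row' i A.
Proof.
by apply/matrixP => x y; rewrite !mxE eq_sym (negbTE (neq_lift i x)) mxE.
Qed.

Lemma set_rowC k (A : 'M[R]_(k, n)) i j u v : i != j ->
  set_row (set_row A i u) j v = set_row (set_row A j v) i u.
Proof.
move=> ij; apply/row_matrixP => x; rewrite !row_set_row.
by case: (eqVneq x j) => // ->; rewrite eq_sym (negbTE ij).
Qed.

Section OneForm.
Variables (k : nat) (a : 'M[R]_(k, n) -> R).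
Hypothesis a_alt : alternating a.

Lemma alt_set_row A i b c u v :
  a (set_row A i (b *: u + c *: v)) =
  b * a (set_row A i u) + c * a (set_row A i v).
Proof.
by apply: (a_alt.1 _ _ _ i); rewrite ?row_set_row ?eqxx // !row'_set_row.
Qed.

Lemma alt_set_row_sum (I : Type) (s : seq I) A i (c : I -> R) (u : I -> 'rV_n) :
  a (set_row A i (\sum_(l <- s) c l *: u l)) =
  \sum_(l <- s) c l * a (set_row A i (u l)).
Proof.
elim: s => [|l s IHs].
  (* The empty sum is rewritten as [0 *: 0 + 0 *: 0], where multilinearity gives 0. *)
  by rewrite !big_nil -(scaler0 _ (0 : R)) -[_ *: _]addr0 -(scaler0 _ (0 : R))
    alt_set_row !mul0r addr0.
by rewrite !big_cons -[X in _ + X]scale1r alt_set_row mul1r IHs.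
Qed.

Lemma alt_swap A i j : i != j -> a (row_perm (tperm i j) A) = - a A.
Proof.
move=> ij; pose W u v := set_row (set_row A i u) j v.
have W0 u : a (W u u) = 0.
  apply: (a_alt.2 _ i j ij).
  by rewrite !row_set_row !eqxx (negbTE ij).
pose u := row i A; pose v := row j A.
have Wuv : W u v = A by rewrite /W set_row_id set_row_id.
have Wvu : W v u = row_perm (tperm i j) A.
  apply/row_matrixP => x; rewrite !row_set_row.
  have -> : row x (row_perm (tperm i j) A) = row (tperm i j x) A.
    by apply/rowP => y; rewrite !mxE.
  by case: tpermP => [->|->|/eqP/negbTE-> /eqP/negbTE->] //;
    rewrite ?eqxx ?(negbTE ij).
(* Polarization: [a (W (u + v) (u + v)) = 0] is expanded in both slots. *)
have := W0 (1 *: u + 1 *: v); rewrite {1}/W alt_set_row.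
rewrite !(@set_rowC _ A i j) // !alt_set_row -!(@set_rowC _ A i j) //.
rewrite -!/(W _ _) !W0 Wuv Wvu => E; apply/eqP; rewrite -addr_eq0; apply/eqP.
by rewrite -[RHS]E; ring.
Qed.

Lemma alt_row_perm A (s : 'S_k) : a (row_perm s A) = (-1) ^+ s * a A.
Proof.
have [ts -> {s}] := prod_tpermP s.
elim: ts => [|[i j] ts IHts] /=.
  by rewrite big_nil odd_perm1 mul1r row_perm1.
case/andP => ij /IHts E; rewrite big_cons row_permM alt_swap // E.
by rewrite odd_permM odd_tperm (eqP (_ : (i != j) == true)) ?ij //= signrN mulNr.
Qed.

(** Multilinear expansion, one row at a time; [m] bounds the rows still to be expanded. The family
    [b] may be dependent, so [alt_vanish_tangent] can pad a basis with zero vectors. *)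
Lemma alt_set_vanish (L : finType) (b : L -> 'rV[R]_n) :
    (forall tau : 'I_k -> L, a (\matrix_(x < k) b (tau x)) = 0) ->
  forall A, (forall i, exists c : L -> R, row i A = \sum_l c l *: b l) ->
  a A = 0.
Proof.
move=> a0 A span.
suff main m : (m <= k)%N -> forall B,
    (forall i, exists c : L -> R, row i B = \sum_l c l *: b l) ->
    (forall i : 'I_k, (m <= i)%N -> exists l, row i B = b l) -> a B = 0.
  by apply: (main k) => // i; rewrite leqNgt ltn_ord.
elim: m => [_|m IHm mk] B spanB baseB.
  have /fin_all_exists[tau Btau] (i : 'I_k) : exists l, row i B = b l.
    exact: baseB.
  by rewrite -[RHS](a0 tau); congr a; apply/row_matrixP => i; rewrite rowK Btau.
pose i0 := Ordinal mk; have [c Bc] := spanB i0.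
rewrite -[B](set_row_id _ i0) Bc alt_set_row_sum big1 // => l _.
rewrite IHm ?mulr0 // => [|i|i mi]; first exact: ltnW.
- rewrite row_set_row; case: eqP => _; last exact: spanB.
  exists (fun l' => (l' == l)%:R); rewrite (bigD1 l) //= eqxx scale1r.
  by rewrite big1 ?addr0 // => l' /negbTE->; rewrite scale0r.
- rewrite row_set_row; case: eqP => [_|/eqP neq_i]; first by exists l.
  by apply: baseB; rewrite ltn_neqAle mi andbT eq_sym.
Qed.

Lemma alt_tuple_perm (L : Type) (b : L -> 'rV[R]_n) (tau tau0 : 'I_k -> L)
    (p : 'S_k) : tau =1 tau0 \o p ->
  a (\matrix_(x < k) b (tau x)) = (-1) ^+ p * a (\matrix_(x < k) b (tau0 x)).
Proof.
move=> tau_p; rewrite -alt_row_perm; congr a; apply/matrixP => x y.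
by rewrite !mxE tau_p.
Qed.

Lemma alt_tuple_notinj (L : finType) (b : L -> 'rV[R]_n) (tau : 'I_k -> L) :
  ~ injective tau -> a (\matrix_(x < k) b (tau x)) = 0.
Proof.
move=> /injectiveP/injectivePn[i [j ij e]].
by apply: (a_alt.2 _ i j ij); rewrite !rowK e.
Qed.

End OneForm.

Lemma alternating_sub k (a b : 'M[R]_(k, n) -> R) :
  alternating a -> alternating b -> alternating (fun A => a A - b A).
Proof.
move=> [am a0] [bm b0]; split=> [A B C i x y e1 e2 e3|A i j ij e].
  by rewrite (am A B C i x y) // (bm A B C i x y) //; ring.
by rewrite (a0 A i j) // (b0 A i j) // subrr.
Qed.

Lemma alternating_scale k (a : 'M[R]_(k, n) -> R) z :
  alternating a -> alternating (fun A => z * a A).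
Proof.
move=> [am a0]; split=> [A B C i x y e1 e2 e3|A i j ij e].
  by rewrite (am A B C i x y) //; ring.
by rewrite (a0 A i j) // mulr0.
Qed.

Lemma alternating_det k (N : 'M[R]_(n, k)) :
  alternating (fun A : 'M[R]_(k, n) => \det (A *m N)).
Proof.
split=> [A B C i x y e1 e2 e3|A i j ij e].
  apply: (@determinant_multilinear _ _ _ _ _ i).
  - by rewrite !row_mul e1 mulmxDl !scalemxAl.
  - by rewrite !row'Esub !mxsub_mul /= -!row'Esub e2.
  - by rewrite !row'Esub !mxsub_mul /= -!row'Esub e3.
apply: (@determinant_alternate _ _ _ i j ij) => z.
by have /rowP/(_ z) : row i (A *m N) = row j (A *m N);
  [rewrite !row_mul e | rewrite !mxE].
Qed.

End AlternatingForms.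

Lemma alternating_mulmx (R : realType) n m k (a : 'M[R]_(k, n) -> R)
    (N : 'M[R]_(m, n)) :
  alternating a -> alternating (fun A : 'M[R]_(k, m) => a (A *m N)).
Proof.
move=> [am a0]; split=> [A B C i x y e1 e2 e3|A i j ij e].
  apply: (am _ _ _ i).
  - by rewrite !row_mul e1 mulmxDl !scalemxAl.
  - by rewrite !row'Esub !mxsub_mul /= -!row'Esub e2.
  - by rewrite !row'Esub !mxsub_mul /= -!row'Esub e3.
by apply: (a0 _ i j ij); rewrite !row_mul e.
Qed.

(** * Increasing maps as canonical enumerations of subsets *)

Section IncreasingMaps.
Variable p : nat.

Lemma increasingP m (s : {ffun 'I_m -> 'I_p}) :
  reflect (forall i j : 'I_m, (i < j)%N -> (s i < s j)%N) (increasing s).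
Proof.
apply: (iffP forallP) => [H i j ij|H i]; last first.
  by apply/forallP => j; apply/implyP => /H.
by have /forallP/(_ j)/implyP/(_ ij) := H i.
Qed.

Lemma increasing_inj m (s : {ffun 'I_m -> 'I_p}) : increasing s -> injective s.
Proof.
move=> /increasingP inc i j e; apply/val_inj/eqP.
by case: ltngtP => // /inc; rewrite e ltnn.
Qed.

Lemma increasing_eq m (s s' : {ffun 'I_m -> 'I_p}) :
    increasing s -> increasing s' -> (forall i, exists j, s i = s' j) ->
  s = s'.
Proof.
move=> inc inc' im.
have srt (u : {ffun 'I_m -> 'I_p}) : increasing u ->
    sorted ltn [seq val (u i) | i <- enum 'I_m].
  move=> /increasingP incu; rewrite sorted_map.
  apply: (homo_sorted (e := fun i j : 'I_m => (i < j)%N)) => //.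
  by have := iota_ltn_sorted 0 m; rewrite -val_enum_ord sorted_map -enumT.
have mem_eq : [seq val (s i) | i <- enum 'I_m] =i [seq val (s' i) | i <- enum 'I_m].
  apply: (uniq_min_size _ _ _).2.
  - by apply: (sorted_uniq ltn_trans ltnn); apply: srt.
  - move=> x /mapP[i _ ->]; have [j ->] := im i.
    by apply/mapP; exists j; rewrite ?mem_enum.
  - by rewrite !size_map.
have E : [seq val (s i) | i <- enum 'I_m] = [seq val (s' i) | i <- enum 'I_m].
  by apply: (irr_sorted_eq ltn_trans ltnn); rewrite ?srt.
apply/ffunP => i; apply/val_inj.
have im_ : (i < size (enum 'I_m))%N by rewrite size_enum_ord.
have /= := congr1 (nth 0%N ^~ i) E.
by rewrite (nth_map i 0%N _ im_) (nth_map i 0%N _ im_) nth_ord_enum.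
Qed.

Lemma increasing_exists m (S : {set 'I_p}) : #|S| = m ->
  exists2 s : {ffun 'I_m -> 'I_p}, increasing s &
    (forall i, s i \in S) /\ (forall x, x \in S -> exists i, s i = x).
Proof.
move=> Sm; exists [ffun i => enum_val (cast_ord (esym Sm) i)]; last first.
  split=> [i|x xS]; first by rewrite ffunE enum_valP.
  exists (cast_ord Sm (enum_rank_in xS x)).
  by rewrite ffunE cast_ordK enum_rankK_in.
apply/increasingP => i j ij; rewrite !ffunE.
have srt : sorted ltn [seq val x | x <- enum S].
  rewrite {1}/enum_mem sorted_map; apply: sorted_filter.
    by move=> ? ? ?; apply: ltn_trans.
  by have := iota_ltn_sorted 0 p; rewrite -val_enum_ord sorted_map enumT.
pose x0 := enum_val (cast_ord (esym Sm) i).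
have sz (l : 'I_m) : (l < size (enum S))%N by rewrite -cardE Sm.
rewrite !(enum_val_nth x0) /= -!(nth_map x0 0%N val) //.
by apply: (sorted_ltn_nth ltn_trans) => //; rewrite inE size_map.
Qed.

End IncreasingMaps.

(** * The inner product of alternating forms *)

Section InnerProduct.
Variables (R : realType) (n k : nat).
Implicit Type a : 'M[R]_(k, n) -> R.

(** A Cauchy-Binet formula. Both sides are alternating in [U], so they need only be compared on
    tuples of basis vectors, and an injective tuple is, up to sign, the increasing enumeration of
    its image. *)
Lemma alt_expand a (U : 'M[R]_(k, n)) : alternating a ->
  a U = \sum_(s : {ffun 'I_k -> 'I_n} | increasing s)
          a (rowsub s 1%:M) * \det (colsub s U).
Proof.
move=> a_alt; apply/eqP; rewrite -subr_eq0; apply/eqP.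
pose b (j : 'I_n) : 'rV[R]_n := delta_mx 0 j.
pose rhs (U : 'M[R]_(k, n)) := \sum_(s : {ffun 'I_k -> 'I_n} | increasing s)
  a (rowsub s 1%:M) * \det (colsub s U).
have rhs_alt : alternating rhs.
  pose N (s : 'I_k -> 'I_n) : 'M[R]_(n, k) := colsub s 1%:M.
  have colsubE (s : 'I_k -> 'I_n) (B : 'M[R]_(k, n)) : colsub s B = B *m N s.
    by rewrite /N mulmx_colsub mulmx1.
  split=> [A B C i x y e1 e2 e3|A i j ij e].
    rewrite /rhs !mulr_sumr -big_split; apply: eq_bigr => s _ /=.
    rewrite !colsubE ((alternating_det (N s)).1 A B C i x y) //; ring.
  rewrite /rhs big1 // => s _.
  by rewrite !colsubE ((alternating_det (N s)).2 A i j ij e) mulr0.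
have bE (tau : 'I_k -> 'I_n) : \matrix_(x < k) b (tau x) = rowsub tau 1%:M :> 'M[R]_(k, n).
  by apply/matrixP => x y; rewrite !mxE eqxx /= eq_sym.
apply: (alt_set_vanish (alternating_sub a_alt rhs_alt) (b := b)) => [tau|i]; last first.
  by exists (fun j => row i U 0 j); apply: row_sum_delta.
case: (pselect (injective tau)) => [tau_inj|ninj]; last first.
  by rewrite (alt_tuple_notinj a_alt) // (alt_tuple_notinj rhs_alt) // subrr.
have [s inc [_ im]] : exists2 s : {ffun 'I_k -> 'I_n}, increasing s &
    (forall i, s i \in tau @: 'I_k) /\ (forall x, x \in tau @: 'I_k -> exists i, s i = x).
  by apply: increasing_exists; rewrite card_imset // card_ord.
have im' i : exists j, tau i = s j.
  by have [|j <-] := im (tau i); [apply: imset_f | exists j].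
have [q eq_q] := tuple_perm tau_inj im'.
rewrite !(alt_tuple_perm _ b eq_q) // -mulrBr bE.
apply/eqP; rewrite mulf_eq0 subr_eq0; apply/orP; right.
rewrite /rhs (bigD1 s) //= big1 ?addr0 => [|s' /andP[inc' s's]].
  rewrite -[colsub _ _]mxsub_comp (_ : mxsub _ _ _ = 1%:M) ?det1 ?mulr1 //.
  by apply/matrixP => x y; rewrite !mxE (inj_eq (increasing_inj inc)).
(* Distinct increasing maps have distinct images; an index of [s] missed by [s'] gives a zero row in
   the minor. *)
have [x sx] : exists x, forall y, s x != s' y.
  apply: contrapT => nex; move/eqP: s's; apply; apply/esym.
  apply: increasing_eq => // i; apply: contrapT => ni; apply: nex; exists i => j.
  by apply/eqP => e; apply: ni; exists j.
rewrite (expand_det_row _ x) big1 ?mulr0 // => y _.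
by rewrite !mxE (negbTE (sx y)) mul0r.
Qed.

(** The determinant represents evaluation at the rows of [U]. This turns inner products with
    decomposable test forms into evaluations. *)
Lemma ip_det a (U : 'M[R]_(k, n)) :
  alternating a -> ip a (fun A => \det (A *m U^T)) = a U.
Proof.
move=> /(alt_expand U) ->; apply: eq_bigr => s _.
rewrite mul_rowsub_mx mul1mx -det_tr; congr (_ * \det _).
by apply/matrixP => i j; rewrite !mxE.
Qed.

Lemma ip_scaler a b c : ip a (fun A => c * b A) = c * ip a b.
Proof. by rewrite mulr_sumr; apply: eq_bigr => s _; rewrite mulrCA. Qed.

End InnerProduct.

(** * Wedge products of 1-forms as determinants *)

Section Wedges.
Variables (R : realType) (n : nat).

(* The two permutation sums decouple after the substitution s = tau * s':
   what remains is the number of permutations preserving both blocks. *)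
Lemma det_wedge p q : exists2 c : R, c != 0 &
  forall (U : 'M[R]_(p, n)) (V : 'M[R]_(q, n)),
  wedge (fun A => \det (A *m U^T)) (fun A => \det (A *m V^T)) =
  fun A => c * \det (A *m (col_mx U V)^T).
Proof.
(* The product of the entries of [m] along a permutation is 1 if both blocks are preserved and 0
   otherwise, so [c0] is a count. *)
pose m : 'M[R]_(p + q) := block_mx (const_mx 1) 0 0 (const_mx 1).
pose c0 := \sum_(s : 'S_(p + q)) \prod_i m i (s i).
exists (((p`! * q`!)%:R)^-1 * c0).
  rewrite mulf_neq0 // ?invr_neq0 ?pnatr_eq0 -?lt0n ?muln_gt0 ?fact_gt0 //.
  have m_ge0 i j : 0 <= m i j.
    by rewrite /m; case: (split_ordP i) => i' ->; case: (split_ordP j) => j' ->;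
      rewrite ?block_mxEul ?block_mxEur ?block_mxEdl ?block_mxEdr mxE ?ler01.
  rewrite gt_eqF // /c0 (bigD1 (1%g : 'S_(p + q))) //= ltr_pwDl ?sumr_ge0 //; last first.
    by move=> s _; apply: prodr_ge0.
  apply: prodr_gt0 => i _; rewrite perm1 /m.
  by case: (split_ordP i) => i' ->; rewrite ?block_mxEul ?block_mxEdr mxE ltr01.
move=> U V; apply/funext => A; rewrite /wedge -mulrA; congr (_ * _).
pose B := A *m (col_mx U V)^T.
transitivity (\sum_(s : 'S_(p + q)) \sum_(u : 'S_(p + q))
    (-1) ^+ s * (-1) ^+ u * \prod_i B (s i) (u i) * \prod_i m i (u i)).
  apply: eq_bigr => s _.
  pose C := row_perm s B.
  have -> : usubmx (row_perm s A) *m U^T = ulsubmx C.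
    apply/matrixP => i j; rewrite !mxE; apply: eq_bigr => l _.
    by rewrite !mxE (unsplitK (inl _ j)).
  have -> : dsubmx (row_perm s A) *m V^T = drsubmx C.
    apply/matrixP => i j; rewrite !mxE; apply: eq_bigr => l _.
    by rewrite !mxE (unsplitK (inr _ j)).
  (* The two minors multiply to the determinant of the block diagonal part of [C], which is the
     entrywise product of [C] and [m]. *)
  rewrite -mulrA -(det_ublock _ 0) mulr_sumr; apply: eq_bigr => u _.
  rewrite -!mulrA; congr (_ * (_ * _)); rewrite -big_split; apply: eq_bigr => i _ /=.
  move: (u i) => j; rewrite /m.
  by case: (split_ordP i) => i' ->; case: (split_ordP j) => j' ->;
    rewrite ?block_mxEul ?block_mxEur ?block_mxEdl ?block_mxEdr !mxE ?mulr1 ?mulr0.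
rewrite exchange_big /= /c0 mulr_suml; apply: eq_bigr => u _.
rewrite -det_tr /determinant mulr_sumr (reindex_inj (mulgI u)) /=.
apply: eq_bigr => s _.
rewrite odd_permM signr_addb mulrAC [_ * _ * (-1) ^+ u]mulrAC -signr_addb addbb mul1r.
rewrite [RHS]mulrCA -mulrA; congr (_ * (_ * _)).
rewrite [RHS](reindex_perm u) /=.
by apply: eq_bigr => i _; rewrite !mxE permM.
Qed.

Lemma wedges_det m : exists2 c : R, c != 0 & forall u : 'I_m -> 'rV[R]_n,
  wedges u = fun A => c * \det (A *m (\matrix_(i < m) u i)^T).
Proof.
elim: m => [|m [c c0 IHm]].
  exists 1 => [|u]; first exact: oner_neq0.
  by apply/funext => A; rewrite det_mx00 mulr1.
have [c' c'0 W] := det_wedge 1 m; exists (c * c') => [|u].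
  by rewrite mulf_neq0.
have -> : \matrix_(i < m.+1) u i =
    col_mx (u ord0) (\matrix_(i < m) u (lift ord0 i)) :> 'M[R]_(1 + m, n).
  apply/row_matrixP => i; rewrite rowK.
  case: (@split_ordP 1 m i) => j ->.
    by rewrite rowKu row_id (ord1 j); congr u; apply: val_inj.
  by rewrite rowKd rowK; congr u; apply: val_inj.
apply/funext => A; rewrite -mulrA -(congr1 (fun f => f A) (W _ _)) /=.
rewrite IHm /wedge mulrCA; congr (_ * _); rewrite mulr_sumr.
apply: eq_bigr => s _; by rewrite [LHS]mulrCA /flat det_mx11.
Qed.

Lemma wedge_wedges_det p q : exists2 c : R, c != 0 &
  forall (u : 'I_p -> 'rV[R]_n) (v : 'I_q -> 'rV[R]_n),
  wedge (wedges u) (wedges v) =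
  fun A => c * \det (A *m (col_mx (\matrix_i u i) (\matrix_i v i))^T).
Proof.
have [c c0 cE] := det_wedge p q.
have [c1 c10 c1E] := wedges_det p; have [c2 c20 c2E] := wedges_det q.
exists (c1 * c2 * c) => [|u v]; first by rewrite !mulf_neq0.
rewrite c1E c2E; apply/funext => A.
rewrite -mulrA -(congr1 (fun f => f A) (cE _ _)) /wedge mulrCA; congr (_ * _).
rewrite mulr_sumr; apply: eq_bigr => s _.
by move: (_ ^+ _) (\det _) (\det _) => x y z; ring.
Qed.

Definition tag_rows (L : Type) k (b : L -> 'rV[R]_n) (tau : 'I_k -> L) :
  'M[R]_(k, n) := \matrix_(x < k) b (tau x).

End Wedges.

(** * Polynomial functions and interpolation on the lattice *)

Section PolynomialFunctions.
Variable R : realType.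

Section OneDomain.
Variable V : finType.
Implicit Types (x : V -> R) (b : {ffun V -> nat}) (f g : (V -> R) -> R).
Implicit Types P Q : pred nat.

Definition mono x b : R := \prod_i x i ^+ b i.
Definition mdeg b : nat := (\sum_i b i)%N.

(** The predicate [P] on degrees covers the homogeneous case [pred1 r], bounded degree [leq^~ m] and
    arbitrary degree [predT]. The variables are either the coordinates of a vector space or all
    vertices of the mesh. *)
Definition Pol P f : Prop :=
  exists2 s : seq (R * {ffun V -> nat}), all (fun p => P (mdeg p.2)) s &
  forall x, f x = \sum_(p <- s) p.1 * mono x p.2.

Lemma Pol_ext P f g : f =1 g -> Pol P f -> Pol P g.
Proof. by move=> fg [s sP sE]; exists s => // x; rewrite -fg. Qed.

Lemma Pol_mono P b c : P (mdeg b) -> Pol P (fun x => c * mono x b).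
Proof. by exists [:: (c, b)] => [|x]; rewrite /= ?andbT // big_seq1. Qed.

Lemma Pol0 P : Pol P (fun=> 0).
Proof. by exists [::] => // x; rewrite big_nil. Qed.

Lemma PolD P f g : Pol P f -> Pol P g -> Pol P (fun x => f x + g x).
Proof.
move=> [s sP sE] [s' sP' sE']; exists (s ++ s') => [|x]; first by rewrite all_cat sP.
by rewrite sE sE' big_cat.
Qed.

Lemma Pol_sum P (I : Type) (r : seq I) (p : pred I) (f : I -> (V -> R) -> R) :
  (forall i, p i -> Pol P (f i)) -> Pol P (fun x => \sum_(i <- r | p i) f i x).
Proof.
move=> fP; elim: r => [|i r IHr].
  by apply: Pol_ext (Pol0 P) => x; rewrite big_nil.
case pi: (p i).
  by apply: Pol_ext (PolD (fP i pi) IHr) => x; rewrite big_cons pi.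
by apply: Pol_ext IHr => x; rewrite big_cons pi.
Qed.

Lemma mono0 x : mono x [ffun=> 0%N] = 1.
Proof. by rewrite /mono big1 // => i _; rewrite ffunE. Qed.

Lemma mdeg0 : mdeg [ffun=> 0%N] = 0%N.
Proof. by rewrite /mdeg big1 // => i _; rewrite ffunE. Qed.

Lemma Pol_const P c : P 0%N -> Pol P (fun=> c).
Proof.
move=> P0; apply: Pol_ext (Pol_mono (b := [ffun=> 0%N]) c _) => [x|].
  by rewrite mono0 mulr1.
by rewrite mdeg0.
Qed.

Lemma Pol_var P i : P 1%N -> Pol P (fun x => x i).
Proof.
move=> P1; apply: Pol_ext (Pol_mono (b := [ffun j => (j == i) : nat]) 1 _) => [x|].
  rewrite mul1r /mono (bigD1 i) //= ffunE eqxx expr1 big1 ?mulr1 // => j /negbTE ji.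
  by rewrite ffunE ji.
rewrite /mdeg (bigD1 i) //= ffunE eqxx big1 ?addn0 // => j /negbTE ji.
by rewrite ffunE ji.
Qed.

Lemma PolM P1 P2 P f g : (forall m n, P1 m -> P2 n -> P (m + n)%N) ->
  Pol P1 f -> Pol P2 g -> Pol P (fun x => f x * g x).
Proof.
move=> P12 [s sP sE] [s' sP' sE'].
have: Pol P (fun x => \sum_(p <- s | P1 (mdeg p.2)) \sum_(q <- s' | P2 (mdeg q.2))
    p.1 * q.1 * mono x [ffun i => (p.2 i + q.2 i)%N]).
  apply: Pol_sum => p p1; apply: Pol_sum => q q2; apply: Pol_mono.
  rewrite (_ : mdeg _ = mdeg p.2 + mdeg q.2)%N; first exact: P12.
  by rewrite /mdeg -big_split; apply: eq_bigr => i _; rewrite ffunE.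
apply: Pol_ext => x; rewrite sE sE' mulr_suml big_seq_cond [RHS]big_seq_cond.
have e1 (p : R * {ffun V -> nat}) : (p \in s) && P1 (mdeg p.2) = (p \in s) && true.
  by case ps: (p \in s) => //=; have /allP/(_ p ps)-> := sP.
rewrite (eq_bigl _ _ e1); apply: eq_bigr => p _; rewrite mulr_sumr.
rewrite big_seq_cond [RHS]big_seq_cond.
have e2 (q : R * {ffun V -> nat}) : (q \in s') && P2 (mdeg q.2) = (q \in s') && true.
  by case qs: (q \in s') => //=; have /allP/(_ q qs)-> := sP'.
rewrite (eq_bigl _ _ e2); apply: eq_bigr => q _.
rewrite mulrACA; congr (_ * _); rewrite /mono -big_split.
by apply: eq_bigr => i _; rewrite ffunE exprD.
Qed.

Lemma PolZ P c f : Pol P f -> Pol P (fun x => c * f x).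
Proof.
by move=> Pf; apply: (PolM (P1 := pred1 0%N)) Pf => [m n /eqP->//|]; exact: Pol_const.
Qed.

Lemma PolB P f g : Pol P f -> Pol P g -> Pol P (fun x => f x - g x).
Proof.
by move=> Pf Pg; apply: Pol_ext (PolD Pf (PolZ (-1) Pg)) => x; rewrite mulN1r.
Qed.

(* D n stands for degree n, degree at most n, or any degree *)
Section Graded.
Variable D : nat -> pred nat.
Hypotheses (D0 : D 0 0) (DD : forall m n i j, D m i -> D n j -> D (m + n)%N (i + j)%N).

Lemma Pol_prod (I : Type) (r : seq I) (p : pred I) (n : I -> nat)
    (f : I -> (V -> R) -> R) :
  (forall i, p i -> Pol (D (n i)) (f i)) ->
  Pol (D (\sum_(i <- r | p i) n i)) (fun x => \prod_(i <- r | p i) f i x).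
Proof.
move=> fP; elim: r => [|i r IHr].
  by rewrite big_nil; apply: Pol_ext (Pol_const 1 D0) => x; rewrite big_nil.
rewrite big_cons; case pi: (p i).
  apply: Pol_ext (PolM _ (fP i pi) IHr) => [x|a b]; last exact: DD.
  by rewrite big_cons pi.
by apply: Pol_ext IHr => x; rewrite big_cons pi.
Qed.

Lemma Pol_exp n m f : Pol (D n) f -> Pol (D (n * m)) (fun x => f x ^+ m).
Proof.
move=> fP; elim: m => [|m IHm]; first by rewrite muln0; apply: Pol_const.
by rewrite mulnS; apply: Pol_ext (PolM _ fP IHm) => [x|a b]; [rewrite exprS|exact: DD].
Qed.
End Graded.

Definition nat_ffun m (a : {ffun V -> 'I_m.+1}) : {ffun V -> nat} :=
  [ffun i => val (a i)].

Lemma mdeg_ge b i : (b i <= mdeg b)%N.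
Proof. by rewrite /mdeg (bigD1 i) //= leq_addr. Qed.

(** No exponent exceeds the degree, hence [m]: collecting equal exponents gives coefficients indexed
    by a finite type, as linear algebra requires. *)
Lemma Pol_coef P m f : (forall n, P n -> (n <= m)%N) -> Pol P f ->
  exists c : {ffun V -> 'I_m.+1} -> R, forall x,
    f x = \sum_(a | P (mdeg (nat_ffun a))) c a * mono x (nat_ffun a).
Proof.
move=> Pm [s sP sE].
pose h (b : {ffun V -> nat}) : {ffun V -> 'I_m.+1} := [ffun i => inord (b i)].
have hK p : p \in s -> nat_ffun (h p.2) = p.2.
  move=> ps; apply/ffunP => i; rewrite !ffunE /= inordK // ltnS.
  by rewrite (leq_trans (mdeg_ge _ i)) // Pm // (allP sP).
exists (fun a => \sum_(p <- s | h p.2 == a) p.1) => x; rewrite sE.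
rewrite big_seq (partition_big (fun p => h p.2) (fun a => P (mdeg (nat_ffun a)))) /=.
  apply: eq_bigr => a _; rewrite mulr_suml -big_seq_cond big_seq_cond.
  rewrite [RHS]big_seq_cond; apply: eq_bigr => p /andP[ps /eqP <-].
  by rewrite hK.
by move=> p ps; rewrite hK // (allP sP).
Qed.

Lemma Pol_of_coef P m (c : {ffun V -> 'I_m.+1} -> R) :
  Pol P (fun x => \sum_(a | P (mdeg (nat_ffun a))) c a * mono x (nat_ffun a)).
Proof. by apply: Pol_sum => a Pa; apply: Pol_mono. Qed.

End OneDomain.

Lemma Pol_comp (V W : finType) (P Q : pred nat) (f : (V -> R) -> R)
    (g : V -> (W -> R) -> R) : Pol P f ->
    (forall b, P (mdeg b) -> Pol Q (fun x => mono (g^~ x) b)) ->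
  Pol Q (fun x => f (g^~ x)).
Proof.
move=> [s sP sE] gQ.
have: Pol Q (fun x => \sum_(p <- s | P (mdeg p.2)) p.1 * mono (g^~ x) p.2).
  by apply: Pol_sum => p /gQ; apply: PolZ.
apply: Pol_ext => x; rewrite sE big_seq_cond [RHS]big_seq.
apply: eq_bigl => p; case ps: (p \in s) => //=.
by have /allP/(_ p ps)-> := sP.
Qed.

Lemma Pol_mono_comp (V W : finType) (D : nat -> pred nat)
    (D0 : D 0 0) (DD : forall m n i j, D m i -> D n j -> D (m + n)%N (i + j)%N)
    (g : V -> (W -> R) -> R) (b : {ffun V -> nat}) :
  (forall i, Pol (D 1) (g i)) -> Pol (D (mdeg b)) (fun x => mono (g^~ x) b).
Proof.
move=> gP; apply: Pol_prod => // i _.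
by rewrite -[X in D X]mul1n; apply: Pol_exp.
Qed.

Lemma poly_leP n m (p : 'rV[R]_n -> R) :
  poly_le m%:Z p <->
  exists2 f : ('I_n -> R) -> R, Pol (leq^~ m) f & forall x, p x = f (x 0).
Proof.
have E (a : {ffun 'I_n -> 'I_m.+1}) (x : 'rV[R]_n) :
    \prod_i x 0 i ^+ a i = mono (x 0) (nat_ffun a).
  by apply: eq_bigr => i _; rewrite ffunE.
have E' (a : {ffun 'I_n -> 'I_m.+1}) :
    (((\sum_i a i)%N)%:Z <= m%:Z) = (mdeg (nat_ffun a) <= m)%N.
  by rewrite lez_nat; congr (_ <= _)%N; apply: eq_bigr => i _; rewrite ffunE.
split=> [[c pE]|[f /(Pol_coef (m := m) (fun _ => id))[c fE] pE]].
  exists (fun x => \sum_(a : {ffun 'I_n -> 'I_m.+1} | (mdeg (nat_ffun a) <= m)%N)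
    c a * mono x (nat_ffun a)); first exact: Pol_of_coef.
  by move=> x; rewrite pE (eq_bigl _ _ E'); apply: eq_bigr => a _; rewrite E.
exists c => x; rewrite pE fE [RHS](eq_bigl _ _ E').
by apply: eq_bigr => a _; rewrite E.
Qed.

End PolynomialFunctions.

(** * Lagrange polynomials at lattice points *)

Section FallingFactorials.
Variables (R : realType) (V : finType).

Lemma prod_ffact (g a : nat) :
  \prod_(0 <= j < a) (g%:R - j%:R) = (g ^_ a)%:R :> R.
Proof.
elim: a => [|a IHa]; first by rewrite big_nil.
rewrite big_nat_recr //= IHa ffactnSr natrM.
case: (leqP a g) => [ag|ga]; first by rewrite natrB.
by rewrite ffact_small // !mul0r.
Qed.

(** Equal sums with [g] different from [a] force [g j < a j] for some [j], and that falling
    factorial is 0. This is why a Lagrange polynomial vanishes at all other lattice points. *)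
Lemma prod_ffact_eq0 (T : {pred V}) (g a : V -> nat) :
    (\sum_(i in T) g i = \sum_(i in T) a i)%N ->
    (exists2 i, i \in T & g i <> a i) ->
  \prod_(i in T) (g i ^_ a i)%:R = 0 :> R.
Proof.
move=> sum_eq [i iT ne].
have [j /andP[jT ltj]] : exists j, (j \in T) && (g j < a j)%N.
  apply/existsP; apply: contraT; rewrite negb_exists => /forallP ge.
  have le j : j \in T -> (a j <= g j)%N.
    by move=> jT; have := ge j; rewrite jT /= -leqNgt.
  have lt : (a i < g i)%N by rewrite ltn_neqAle le // andbT; apply/eqP => e; apply: ne.
  move: sum_eq; rewrite (bigD1 i) //= [RHS](bigD1 i) //=.
  have : (\sum_(j in T | j != i) a j <= \sum_(j in T | j != i) g j)%N.
    by apply: leq_sum => j /andP[/le].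
  lia.
by rewrite (bigD1 j) //= ffact_small // mul0r.
Qed.

End FallingFactorials.

Section Interpolation.
Variables (R : realType) (V : finType) (r : nat).
Hypothesis r_gt0 : (0 < r)%N.
Local Notation index := {ffun V -> 'I_r.+1}.

Definition multi_indices (S : {set V}) : {set index} :=
  [set a | (mdeg (nat_ffun a) == r) && [forall i, (a i != ord0) ==> (i \in S)]].

Lemma multi_indicesP (S : {set V}) (a : index) :
  reflect ((\sum_i a i)%N = r /\ forall i, i \notin S -> a i = ord0)
          (a \in multi_indices S).
Proof.
have E : mdeg (nat_ffun a) = (\sum_i a i)%N.
  by apply: eq_bigr => i _; rewrite ffunE.
rewrite inE E; apply: (iffP andP) => [[/eqP-> /forallP H]|[-> H]]; split => //.
  move=> i iS; apply/eqP/negPn; move: (H i); rewrite (negbTE iS) implybF //.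
by apply/forallP => i; apply/implyP; apply: contraR => /H->.
Qed.

Definition lattice_pt (a : index) (i : V) : R := (val (a i))%:R / r%:R.

(** The Lagrange polynomial is homogenized by replacing the constant [j] with [j] times the sum of
    the variables, which is 1 at lattice points. *)
Lemma lagrange_hom (a : index) (S : {set V}) : a \in multi_indices S ->
  exists2 f : (V -> R) -> R, Pol (pred1 r) f &
  forall g : index, g \in multi_indices S ->
    f (lattice_pt g) = \prod_i (val (g i) ^_ val (a i))%:R.
Proof.
move=> /multi_indicesP[aE _].
exists (fun x => \prod_i \prod_(0 <= j < val (a i)) (r%:R * x i - j%:R * \sum_l x l)).
  rewrite -[X in pred1 X]aE; apply: (Pol_prod (D := fun n => pred1 n)) => //=.
    by move=> ? ? ? ? /eqP-> /eqP->.
  move=> i _; have E : (\sum_(0 <= j < val (a i)) 1)%N = val (a i).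
    by rewrite sum_nat_const_nat subn0 muln1.
  rewrite -[X in pred1 X]E.
  apply: (Pol_prod (D := fun n => pred1 n)) => //=.
    by move=> ? ? ? ? /eqP-> /eqP->.
  move=> j _; apply: PolB; apply: PolZ; first exact: Pol_var.
  by apply: Pol_sum => l _; apply: Pol_var.
move=> g /multi_indicesP[gE _]; apply: eq_bigr => i _.
have r0 : r%:R != 0 :> R by rewrite pnatr_eq0 -lt0n.
rewrite -prod_ffact; apply: eq_bigr => j _.
rewrite /lattice_pt -mulr_suml -natr_sum gE divff // mulr1.
by rewrite mulrCA divff // mulr1.
Qed.

Lemma mono_supp (S : {set V}) (a : index) (x : V -> R) :
  mdeg (nat_ffun a) = r -> (forall i, i \notin S -> x i = 0) ->
  a \notin multi_indices S -> mono x (nat_ffun a) = 0.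
Proof.
move=> ar x0; rewrite inE ar eqxx negb_forall => /existsP[i].
rewrite negb_imply => /andP[ai iS]; rewrite /mono (bigD1 i) //= ffunE x0 //.
by rewrite expr0n (_ : _ == _ = false) ?mul0r //; apply/negbTE.
Qed.

(* The matrix E of the monomials at the lattice points is square, and the
   Lagrange polynomials provide a left inverse up to a diagonal factor. *)
Lemma lattice_coef0 (S : {set V}) (c : index -> R) :
  (forall g, g \in multi_indices S ->
     \sum_(a in multi_indices S) c a * mono (lattice_pt g) (nat_ffun a) = 0) ->
  forall a, a \in multi_indices S -> c a = 0.
Proof.
move=> c0; pose N := #|multi_indices S|.
pose e (i : 'I_N) : index := enum_val i.
have eS i : e i \in multi_indices S by apply: enum_valP.
have /fin_all_exists[L LE] (i : 'I_N) : exists l : index -> R, forall g,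
    g \in multi_indices S ->
    \sum_(a in multi_indices S) l a * mono (lattice_pt g) (nat_ffun a) =
    \prod_j (val (g j) ^_ val (e i j))%:R.
  have [f /(Pol_coef (m := r))[n /eqP->//|l fE] fg] := lagrange_hom (eS i).
  exists l => g gS; rewrite -fg // fE; apply/esym.
  (* Monomials involving a variable outside [S] vanish at the lattice points of [S]. *)
  rewrite (bigID (mem (multi_indices S))) /= [X in _ + X]big1 ?addr0.
    by apply: eq_bigl => a; rewrite inE; case: eqP.
  move=> a /andP[/eqP ar aS]; rewrite (mono_supp ar _ aS) ?mulr0 // => j jS.
  by have /multi_indicesP[_ gz] := gS; rewrite /lattice_pt gz ?mul0r.
pose E := \matrix_(a < N, g < N) mono (lattice_pt (e g)) (nat_ffun (e a)).
pose LM := \matrix_(i < N, a < N) L i (e a).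
have LME : LM *m E = diag_mx (\row_i \prod_j (val (e i j))`!%:R).
  apply/matrixP => i g; rewrite !mxE.
  transitivity (\prod_j (val (e g j) ^_ val (e i j))%:R : R).
    rewrite -LE // [RHS]big_enum_val; apply: eq_bigr => a _; rewrite !mxE //.
  case: (eqVneq i g) => [->|ig].
    by rewrite mulr1n; apply: eq_bigr => j _; rewrite ffactnn.
  rewrite mulr0n; apply: prod_ffact_eq0.
    by have /multi_indicesP[-> _] := eS g; have /multi_indicesP[-> _] := eS i.
  apply: contrapT => H; move/eqP: ig; apply; apply: enum_val_inj.
  apply/ffunP => j; apply/val_inj; apply: contrapT => ne; apply: H; exists j => //.
  by move=> /esym.
have Eu : E \in unitmx.
  suff : LM *m E \in unitmx by rewrite unitmx_mul => /andP[].
  rewrite LME unitmxE det_diag unitfE; apply/prodf_neq0 => i _; rewrite mxE.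
  by apply/prodf_neq0 => j _; rewrite pnatr_eq0 -lt0n fact_gt0.
have cE : (\row_a c (e a)) *m E = 0.
  apply/rowP => g; rewrite !mxE -[RHS](c0 _ (eS g)).
  by rewrite [RHS]big_enum_val; apply: eq_bigr => a _; rewrite !mxE.
have {}cE : \row_a c (e a) = 0 by rewrite -(mulmxK Eu (\row_a c (e a))) cE mul0mx.
move=> a aS; have /rowP/(_ (enum_rank_in aS a)) := cE.
by rewrite !mxE /e enum_rankK_in.
Qed.

Lemma hom_lattice_vanish (S : {set V}) (f : (V -> R) -> R) : Pol (pred1 r) f ->
  (forall g, g \in multi_indices S -> f (lattice_pt g) = 0) ->
  forall x, (forall i, i \notin S -> x i = 0) -> f x = 0.
Proof.
move=> /(Pol_coef (m := r))[n /eqP->//|c fE] f0.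
have fS x : (forall i, i \notin S -> x i = 0) ->
    f x = \sum_(a in multi_indices S) c a * mono x (nat_ffun a).
  move=> x0; rewrite fE (bigID (mem (multi_indices S))) /= [X in _ + X]big1 ?addr0.
    by apply: eq_bigl => a; rewrite inE; case: eqP.
  by move=> a /andP[/eqP ar aS]; rewrite (mono_supp ar x0 aS) mulr0.
have c0 : forall a, a \in multi_indices S -> c a = 0.
  apply: lattice_coef0 => g gS; rewrite -fS ?f0 // => i iS.
  by have /multi_indicesP[_ gz] := gS; rewrite /lattice_pt gz ?mul0r.
by move=> x x0; rewrite fS // big1 // => a /c0->; rewrite mul0r.
Qed.

(* On a proper subset S' of S, only the monomials supported in S' survive, and
   they vanish by interpolation: all remaining monomials have full support. *)
Lemma bubble_factor (S : {set V}) (f : (V -> R) -> R) : Pol (pred1 r) f ->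
    (forall x (S' : {set V}), S' \proper S -> (forall i, 0 <= x i) ->
       (forall i, i \notin S' -> x i = 0) -> \sum_(i in S') x i = 1 -> f x = 0) ->
  exists Q : (V -> R) -> R,
    [/\ Pol (pred1 (r - #|S|)%N) Q, (r < #|S|)%N -> forall x, Q x = 0
      & forall x, (forall i, i \notin S -> x i = 0) ->
          f x = \prod_(i in S) x i * Q x].
Proof.
move=> /(Pol_coef (m := r))[n /eqP->//|c fE] f0.
have fS (S' : {set V}) x : (forall i, i \notin S' -> x i = 0) ->
    f x = \sum_(a in multi_indices S') c a * mono x (nat_ffun a).
  move=> x0; rewrite fE (bigID (mem (multi_indices S'))) /= [X in _ + X]big1 ?addr0.
    by apply: eq_bigl => a; rewrite inE; case: eqP.
  by move=> a /andP[/eqP ar aS]; rewrite (mono_supp ar x0 aS) mulr0.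
pose supp (a : index) : {set V} := [set i | a i != ord0].
have c0 a : a \in multi_indices S -> supp a != S -> c a = 0.
  move=> aS saS.
  have [as_ azero] := multi_indicesP _ _ aS.
  have sub : supp a \proper S.
    rewrite finset.properEneq saS; apply/fintype.subsetP => i; rewrite inE.
    by apply: contraR => /azero->.
  apply: (@lattice_coef0 (supp a)) => [g gS|]; last first.
    by apply/multi_indicesP; split=> // i; rewrite inE negbK => /eqP.
  have [gs gzero] := multi_indicesP _ _ gS.
  have lat0 i : i \notin supp a -> lattice_pt g i = 0.
    by move=> /gzero; rewrite /lattice_pt => ->; rewrite mul0r.
  rewrite -fS //; apply: (f0 _ (supp a)) => // [i|].
    by rewrite /lattice_pt divr_ge0.
  transitivity (\sum_i lattice_pt g i).
    by rewrite [RHS](bigID (mem (supp a))) /= [X in _ = _ + X]big1 ?addr0.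
  by rewrite /lattice_pt -mulr_suml -natr_sum gs divff // pnatr_eq0 -lt0n.
pose b1 (a : index) : {ffun V -> nat} := [ffun i => (a i - (i \in S))%N].
pose A : {set index} := [set a in multi_indices S | supp a == S].
have Aadd a i : a \in A -> (b1 a i + (i \in S))%N = a i.
  rewrite inE => /andP[_ /eqP sa]; rewrite ffunE subnK // -sa inE.
  by rewrite -lt0n; case: (a i) => [[]].
have Adeg a : a \in A -> (mdeg (b1 a) + #|S|)%N = r.
  move=> aA; move: (aA); rewrite inE => /andP[/multi_indicesP[ar _] _].
  rewrite -[RHS]ar -sum1_card big_mkcond -big_split; apply: eq_bigr => i _ /=.
  by rewrite -(Aadd a i aA); case: (i \in S).
(* [b1] lowers the exponents on [S] by one. If [r < #|S|] no multi-index has full support, so [A] is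
   empty and [Q] is zero, although the truncated difference then reads degree 0. *)
exists (fun x => \sum_(a in A) c a * mono x (b1 a)); split.
- apply: Pol_sum => a /Adeg ar; apply: Pol_mono => /=; apply/eqP; lia.
- move=> rS x; rewrite big1 // => a /Adeg; lia.
- move=> x x0; rewrite (fS S) // (bigID (fun a => supp a == S)) /= [X in _ + X]big1 ?addr0.
    rewrite mulr_sumr; apply: eq_big => [a|a]; first by rewrite [RHS]inE.
    move=> aA'; have aA : a \in A by rewrite inE.
    rewrite mulrCA; congr (_ * _); rewrite big_mkcond -big_split.
    apply: eq_bigr => i _ /=.
    have -> : nat_ffun a i = (b1 a i + (i \in S))%N by rewrite Aadd // ffunE.
    rewrite addnC exprD.
    by case: (i \in S); rewrite ?expr1 ?expr0.
  by move=> a /andP[aS saS]; rewrite c0 ?mul0r.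
Qed.

End Interpolation.

(** * Integration of polynomials over simplices *)

Section PolynomialPrimitive.
Variable R : realType.
Implicit Types p q : {poly R}.

(* the coefficient of degree 0 is p`_0 / 0 = 0 *)
Definition primitive p : {poly R} :=
  \poly_(i < (size p).+1) (p`_i.-1 / i%:R).

Lemma coef_primitive p i : (primitive p)`_i = p`_i.-1 / i%:R.
Proof.
rewrite coef_poly; case: ltnP => // le; rewrite nth_default ?mul0r //.
by rewrite -ltnS prednK // (leq_ltn_trans _ le).
Qed.

Lemma deriv_primitive p : (primitive p)^`() = p.
Proof.
apply/polyP => i; rewrite coef_deriv coef_primitive /=.
by rewrite -(mulr_natr (_ / _)) divfK // pnatr_eq0.
Qed.

Lemma primitive_lin c p q : primitive (c *: p + q) = c *: primitive p + primitive q.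
Proof.
apply/polyP => i.
by rewrite !(coefD, coefZ, coef_primitive) mulrDl mulrA.
Qed.

Lemma primitive0 : primitive 0 = 0.
Proof. by apply/polyP => i; rewrite coef_primitive !coef0 mul0r. Qed.

Lemma primitive_sum (I : Type) (s : seq I) (c : I -> R) (p : I -> {poly R}) :
  primitive (\sum_(i <- s) c i *: p i) = \sum_(i <- s) c i *: primitive (p i).
Proof.
elim: s => [|i s IHs]; first by rewrite !big_nil primitive0.
by rewrite !big_cons primitive_lin IHs.
Qed.

Lemma primitiveXn (n : nat) : primitive 'X^n = n.+1%:R^-1 *: 'X^(n.+1).
Proof.
apply/polyP => -[|i]; rewrite coef_primitive coefZ !coefXn /=.
  by rewrite invr0 !mulr0.
by rewrite eqSS; case: eqVneq => [->|_]; rewrite ?mul0r ?mulr0 // mul1r mulr1.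
Qed.

Lemma primitive_at0 p : (primitive p).[0] = 0.
Proof. by rewrite horner_coef0 coef_primitive invr0 mulr0. Qed.

Lemma integral_horner p (a b : R) : a < b ->
  \int[lebesgue_measure]_(x in `[a, b]) p.[x] =
  (primitive p).[b] - (primitive p).[a].
Proof.
move=> ab; rewrite /Rintegral (@continuous_FTC2 _ _ (horner (primitive p))) //=.
- by apply: continuous_subspaceT; apply: continuous_horner.
- split=> [x _| |]; first exact: derivable_horner.
  + by apply: cvg_at_right_filter; apply: continuous_horner.
  + by apply: cvg_at_left_filter; apply: continuous_horner.
- by move=> x _; rewrite -derivE deriv_primitive.
Qed.

Lemma integral_horner0 p (a : R) : 0 <= a ->
  \int[lebesgue_measure]_(x in `[0, a]) p.[x] = (primitive p).[a].
Proof.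
rewrite le_eqVlt => /predU1P[<-|a0]; last first.
  by rewrite integral_horner // primitive_at0 subr0.
by rewrite primitive_at0 set_itv1 Rintegral_set1.
Qed.

Lemma poly_zero_on_itv p (a : R) : 0 < a ->
  (forall x, 0 <= x <= a -> p.[x] = 0) -> p = 0.
Proof.
(* The points a, a/2, a/3, ... provide [size p] distinct roots. *)
move=> a0 p0; pose s := mkseq (fun i => a / i.+1%:R) (size p).
apply: (@roots_geq_poly_eq0 _ _ s).
- apply/allP => x /mapP[i _ ->]; apply/rootP/p0.
  rewrite divr_ge0 ?(ltW a0) //= ler_pdivrMr ?ltr0Sn // ler_peMr ?(ltW a0) //.
  by rewrite ler1n.
- rewrite map_inj_uniq ?iota_uniq // => i j /(mulfI (lt0r_neq0 a0))/invr_inj/eqP.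
  by rewrite eqr_nat => /eqP[].
- by rewrite size_mkseq.
Qed.

(** The primitive is nondecreasing on the interval and 0 at both ends, hence zero there, hence the
    zero polynomial; so is its derivative. *)
Lemma nonneg_integral0 p (a : R) : 0 < a ->
    (forall x, 0 <= x <= a -> 0 <= p.[x]) ->
    \int[lebesgue_measure]_(x in `[0, a]) p.[x] = 0 -> p = 0.
Proof.
move=> a0 p_ge0; rewrite integral_horner0 ?(ltW a0) // => Pa.
rewrite -(deriv_primitive p) (@poly_zero_on_itv (primitive p) a) ?deriv0 //.
move=> x /andP[x0 xa]; apply/eqP; rewrite eq_le; apply/andP; split; last first.
  rewrite -integral_horner0 //; apply: Rintegral_ge0 => y /=.
  rewrite in_itv /= => /andP[y0 yx]; apply: p_ge0.
  by rewrite y0 (le_trans yx).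
have [->|x_a] := eqVneq x a; first by rewrite Pa.
have {x_a}xa : x < a by rewrite lt_neqAle x_a.
rewrite -subr_ge0 -[X in X - _]Pa -integral_horner //.
apply: Rintegral_ge0 => y /=; rewrite in_itv /= => /andP[xy ya].
by apply: p_ge0; rewrite ya (le_trans x0).
Qed.

(** Euler's beta integral after scaling. Only the homogeneity in [a] matters; the constant stays
    implicit. *)
Lemma beta_integral (m n : nat) : exists B : R, forall a : R,
  (primitive ('X^m * (a%:P - 'X) ^+ n)).[a] = B * a ^+ (m + n).+1.
Proof.
exists (\sum_(i < n.+1) ((-1) ^+ i *+ 'C(n, i)) / (m + i).+1%:R) => a.
have -> : 'X^m * (a%:P - 'X) ^+ n =
    \sum_(i < n.+1) (((-1) ^+ i *+ 'C(n, i)) * a ^+ (n - i)) *: 'X^(m + i).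
  rewrite exprBn mulr_sumr; apply: eq_bigr => i _.
  rewrite mulrnAr mulrnAl -scalerMnl exprD; congr (_ *+ _).
  by rewrite -mul_polyC rmorphM /= !rmorphXn /= rmorphN1 mulrCA.
rewrite primitive_sum horner_sum mulr_suml; apply: eq_bigr => i _.
rewrite hornerZ primitiveXn hornerZ hornerXn mulrACA -exprD.
by congr (_ * a ^+ _); have := ltn_ord i; lia.
Qed.

End PolynomialPrimitive.

(** * Iterated integrals of polynomials over the corner simplex *)

Section CornerIntegral.
Variable R : realType.

Definition polyfun n (u : 'rV[R]_n -> R) : Prop :=
  exists2 s : seq (R * {ffun 'I_n -> nat}), true &
  forall y, u y = \sum_(p <- s) p.1 * mono (y 0) p.2.

Definition tail_exp n (b : {ffun 'I_n.+1 -> nat}) : {ffun 'I_n -> nat} :=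
  [ffun i => b (lift ord0 i)].

Lemma mono_row_mx n (x : R) (y : 'rV[R]_n) (b : {ffun 'I_n.+1 -> nat}) :
  mono ((row_mx (x%:M : 'M[R]_1) y : 'rV[R]_n.+1) 0) b =
  x ^+ b ord0 * mono (y 0) (tail_exp b).
Proof.
rewrite /mono big_ord_recl; congr (_ * _).
  congr (_ ^+ _); rewrite (_ : ord0 = lshift n (ord0 : 'I_1)); last exact: val_inj.
  by rewrite (@row_mxEl _ 1 1 n) mxE.
apply: eq_bigr => i _; rewrite ffunE; congr (_ ^+ _).
rewrite (_ : lift ord0 i = rshift 1 i); last exact: val_inj.
by rewrite (@row_mxEr _ 1 1 n).
Qed.

Lemma mdeg_tail n (b : {ffun 'I_n.+1 -> nat}) :
  mdeg b = (b ord0 + mdeg (tail_exp b))%N.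
Proof.
rewrite /mdeg big_ord_recl; congr (_ + _)%N.
by apply: eq_bigr => i _; rewrite ffunE.
Qed.

Definition slice_terms n (x : R) (s : seq (R * {ffun 'I_n.+1 -> nat})) :
    seq (R * {ffun 'I_n -> nat}) :=
  [seq (p.1 * x ^+ p.2 ord0, tail_exp p.2) | p : R * {ffun 'I_n.+1 -> nat} <- s].

Lemma slice_termsE n (x : R) s (u : 'rV[R]_n.+1 -> R) (y : 'rV[R]_n) :
  (forall y : 'rV[R]_n.+1, u y = \sum_(p <- s) p.1 * mono (y 0) p.2) ->
  u (row_mx (x%:M : 'M[R]_1) y) = \sum_(p <- slice_terms x s) p.1 * mono (y 0) p.2.
Proof.
move=> uE; rewrite big_map uE; apply: eq_bigr => p _.
by rewrite mono_row_mx /= mulrA.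
Qed.

(** A monomial integrates over the corner simplex of size [a] to a constant times a power of [a].
    Applied to the slice of size [a - x], this makes the outer integrand a polynomial in [x], so
    that analysis is confined to polynomials in one variable. *)
Lemma corner_int_terms n : exists K : {ffun 'I_n -> nat} -> R,
  forall (s : seq (R * {ffun 'I_n -> nat})) (u : 'rV[R]_n -> R) (a : R), 0 <= a ->
  (forall y : 'rV[R]_n, u y = \sum_(p <- s) p.1 * mono (y 0) p.2) ->
  corner_int a u = \sum_(p <- s) p.1 * K p.2 * a ^+ (n + mdeg p.2).
Proof.
elim: n => [|n [K KE]].
  exists (fun=> 1) => s u a a0 uE /=; rewrite uE; apply: eq_bigr => p _.
  by rewrite /mono /mdeg !big_ord0 expr0 !mulr1.
have [B BE] : exists B : nat * nat -> R, 
      forall (mn : nat * nat) (a : R),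
    (primitive ('X^(mn.1) * (a%:P - 'X) ^+ mn.2)).[a] = B mn * a ^+ (mn.1 + mn.2).+1.
  by have /choice[B BE] := fun mn : nat * nat => beta_integral R mn.1 mn.2; exists B.
exists (fun b => K (tail_exp b) * B (b ord0, (n + mdeg (tail_exp b))%N)).
move=> s u a a0 uE /=.
pose q := \sum_(p <- s) (p.1 * K (tail_exp p.2)) *:
  ('X^(p.2 ord0) * (a%:P - 'X) ^+ (n + mdeg (tail_exp p.2))).
transitivity (\int[lebesgue_measure]_(x in `[0, a]) q.[x]).
  apply: eq_Rintegral => x; rewrite inE /= in_itv /= => /andP[x0 xa].
  rewrite (KE (slice_terms x s)) ?subr_ge0 // => [|y]; last exact: slice_termsE.
  rewrite big_map /q horner_sum; apply: eq_bigr => p _.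
  by rewrite !hornerE /= -!mulrA; congr (_ * _); rewrite mulrCA.
rewrite integral_horner0 // primitive_sum horner_sum; apply: eq_bigr => p _.
rewrite !hornerE /= (BE (p.2 ord0, _)) /= mdeg_tail mulrA; congr (_ * _ * a ^+ _).
lia.
Qed.

Lemma corner_int_slice_poly n (u : 'rV[R]_n.+1 -> R) (a : R) : polyfun u ->
  exists q : {poly R}, forall x, 0 <= x <= a ->
    corner_int (a - x) (fun y : 'rV[R]_n => u (row_mx (x%:M : 'M[R]_1) y)) = q.[x].
Proof.
move=> [s _ uE]; have [K KE] := corner_int_terms n.
exists (\sum_(p <- s) (p.1 * K (tail_exp p.2)) *:
  ('X^(p.2 ord0) * (a%:P - 'X) ^+ (n + mdeg (tail_exp p.2)))) => x /andP[x0 xa].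
rewrite (KE (slice_terms x s)) ?subr_ge0 // => [|y]; last exact: slice_termsE.
rewrite big_map horner_sum; apply: eq_bigr => p _.
by rewrite !hornerE /= -!mulrA; congr (_ * _); rewrite mulrCA.
Qed.

Lemma corner_intB n (u v : 'rV[R]_n -> R) (a : R) : 0 <= a ->
  polyfun u -> polyfun v ->
  corner_int a (fun y => u y - v y) = corner_int a u - corner_int a v.
Proof.
move=> a0 [s _ uE] [s' _ vE]; have [K KE] := corner_int_terms n.
rewrite (KE s u) // (KE s' v) //.
rewrite (KE (s ++ [seq (- p.1, p.2) | p <- s'])) // => [|y]; last first.
  rewrite big_cat big_map /= uE vE -sumrN; congr (_ + _).
  by apply: eq_bigr => p _; rewrite mulNr.
rewrite big_cat big_map /= -sumrN; congr (_ + _).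
by apply: eq_bigr => p _; rewrite !mulNr.
Qed.

Definition corner n (a : R) (y : 'rV[R]_n) : Prop :=
  (forall i, 0 <= y 0 i) /\ \sum_i y 0 i <= a.

Lemma corner_row_mx n (a x : R) (y : 'rV[R]_n) :
  0 <= x -> corner (a - x) y -> corner a (row_mx (x%:M : 'M[R]_1) y : 'rV[R]_n.+1).
Proof.
move=> x0 [y0 ya].
have E0 : (row_mx (x%:M : 'M[R]_1) y : 'rV[R]_n.+1) 0 ord0 = x.
  rewrite (_ : ord0 = lshift n (ord0 : 'I_1)); last exact: val_inj.
  by rewrite (@row_mxEl _ 1 1 n) mxE.
have E1 i : (row_mx (x%:M : 'M[R]_1) y : 'rV[R]_n.+1) 0 (lift ord0 i) = y 0 i.
  rewrite (_ : lift ord0 i = rshift 1 i); last exact: val_inj.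
  by rewrite (@row_mxEr _ 1 1 n).
split=> [i|].
  by case: (unliftP ord0 i) => [j ->|->]; rewrite ?E0 ?E1.
rewrite big_ord_recl E0 -lerBrDl; apply: le_trans ya.
by apply: ler_sum => i _; rewrite E1.
Qed.

Lemma eq_corner_int n (u v : 'rV[R]_n -> R) (a : R) : 0 <= a ->
  (forall y, corner a y -> u y = v y) -> corner_int a u = corner_int a v.
Proof.
elim: n u v a => [|n IHn] u v a a0 uv /=.
  by apply: uv; split=> [[]|] //; rewrite big_ord0.
apply: eq_Rintegral => x; rewrite inE /= in_itv /= => /andP[x0 xa].
by apply: IHn => [|y cy]; [rewrite subr_ge0|apply: uv; exact: corner_row_mx].
Qed.

Lemma corner_int_ge0 n (u : 'rV[R]_n -> R) (a : R) : 0 <= a ->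
  (forall y, corner a y -> 0 <= u y) -> 0 <= corner_int a u.
Proof.
elim: n u a => [|n IHn] u a a0 u0 /=.
  by apply: u0; split=> [[]|] //; rewrite big_ord0.
apply: Rintegral_ge0 => x /=; rewrite in_itv /= => /andP[x0 xa].
by apply: IHn => [|y cy]; [rewrite subr_ge0|apply: u0; exact: corner_row_mx].
Qed.

(** The slice integrals form a nonnegative polynomial in the first coordinate with integral 0, hence
    the zero polynomial, and induction applies to each slice. The strict bound on the sum keeps the
    slice size [a - x] positive. *)
Lemma corner_int_eq0 n (u : 'rV[R]_n -> R) (a : R) : 0 < a -> polyfun u ->
    (forall y, corner a y -> 0 <= u y) -> corner_int a u = 0 ->
  forall y : 'rV[R]_n, (forall i, 0 <= y 0 i) -> \sum_i y 0 i < a -> u y = 0.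
Proof.
elim: n u a => [|n IHn] u a a0 up u0 /=.
  by move=> <- y _ _; congr u; apply/rowP => -[].
have [q qE] := corner_int_slice_poly a up => int0 y y0 ya.
have q0 : q = 0.
  apply: (nonneg_integral0 a0) => [x xa|].
    rewrite -qE //; move/andP: xa => [x0 xa].
    apply: corner_int_ge0 => [|z cz]; first by rewrite subr_ge0.
    by apply: u0; apply: corner_row_mx.
  rewrite -[RHS]int0; apply: eq_Rintegral => x; rewrite inE /= in_itv /= => xa.
  by rewrite qE.
pose x := y 0 ord0; pose z : 'rV[R]_n := \row_i y 0 (lift ord0 i).
have ->: y = row_mx (x%:M : 'M[R]_1) z :> 'rV[R]_n.+1.
  apply/rowP => i; case: (unliftP ord0 i) => [j ->|->].
    rewrite [in RHS](_ : lift ord0 j = rshift 1 j); last exact: val_inj.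
    by rewrite (@row_mxEr _ 1 1 n) mxE.
  rewrite [in RHS](_ : ord0 = lshift n (ord0 : 'I_1)); last exact: val_inj.
  by rewrite (@row_mxEl _ 1 1 n) mxE.
have zsum : \sum_i z 0 i < a - x.
  rewrite ltrBrDl; move: ya; rewrite big_ord_recl.
  by under [X in _ -> _ + X < _]eq_bigr do rewrite mxE.
have xa : x < a.
  rewrite -subr_gt0; apply: le_lt_trans zsum.
  by apply: sumr_ge0 => i _; rewrite mxE.
apply: (IHn (fun z => u (row_mx (x%:M : 'M[R]_1) z)) (a - x)) => //.
- by rewrite subr_gt0.
- have [s _ uE] := up.
  by exists (slice_terms x s) => // z'; apply: slice_termsE.
- by move=> z' cz; apply: u0; apply: corner_row_mx => //; apply: y0.
- by rewrite qE ?q0 ?horner0 // y0 ltW.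
- by move=> i; rewrite mxE.
Qed.

End CornerIntegral.

(** * Faces and barycentric coordinates *)

Section Dot.
Variables (R : realType) (d : nat).
Implicit Types x y z : 'rV[R]_d.

Lemma dotE x y : dot x y = \sum_i x 0 i * y 0 i.
Proof. by rewrite /dot mxE; apply: eq_bigr => i _; rewrite mxE. Qed.

Lemma dotC x y : dot x y = dot y x.
Proof. by rewrite !dotE; apply: eq_bigr => i _; rewrite mulrC. Qed.

Lemma dotDl x y z : dot (x + y) z = dot x z + dot y z.
Proof. by rewrite /dot mulmxDl mxE. Qed.

Lemma dotZl a x y : dot (a *: x) y = a * dot x y.
Proof. by rewrite /dot -scalemxAl mxE. Qed.

Lemma dotBl x y z : dot (x - y) z = dot x z - dot y z.
Proof. by rewrite dotDl -scaleN1r dotZl mulN1r. Qed.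

Lemma dot0l y : dot 0 y = 0.
Proof. by rewrite /dot mul0mx mxE. Qed.

Lemma dotxx_eq0 x : (dot x x == 0) = (x == 0).
Proof.
rewrite dotE; apply/eqP/eqP => [|->]; last by rewrite big1 // => i _; rewrite mxE mul0r.
move=> /eqP; rewrite psumr_eq0 => [/allP x0|i _]; last by rewrite -expr2 sqr_ge0.
apply/rowP => i; have := x0 i; rewrite mem_index_enum => /(_ isT).
by rewrite /= -expr2 sqrf_eq0 mxE => /eqP.
Qed.

Lemma mulmx_trE m p (A : 'M[R]_(m, d)) (B : 'M[R]_(p, d)) i j :
  (A *m B^T) i j = dot (row i A) (row j B).
Proof. by rewrite dotE mxE; apply: eq_bigr => l _; rewrite !mxE. Qed.

End Dot.

Section Faces.
Variables (R : realType) (d : nat) (M : mesh R d).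
Local Notation V := 'I_(nvert M).
Implicit Types (e f g T : {set V}) (i j : V) (c : V -> R).
Hypothesis elems_free :
  forall T, T \in elems M -> #|T| = d.+1 /\ row_free (vmx T).

(** Weights are indexed by all mesh vertices and set to zero off a face, so that one [c] describes
    the point in every face containing it. *)
Definition point c : 'rV[R]_d := \sum_i c i *: vert i.

Definition is_face f := exists2 T, T \in elems M & f \subset T.

Definition supported f c := forall i, i \notin f -> c i = 0.

Lemma is_face_sub e f : e \subset f -> is_face f -> is_face e.
Proof. by move=> ef [T TM fT]; exists T => //; apply: fintype.subset_trans fT. Qed.

Lemma elems_face T : T \in elems M -> is_face T.
Proof. by exists T. Qed.

Lemma supported_sub e f c : e \subset f -> supported e c -> supported f c.
Proof. by move=> /fintype.subsetP ef ec i /(contra (ef i)); apply: ec. Qed.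

Lemma sum_supported (W : zmodType) f (F : V -> W) :
  (forall i, i \notin f -> F i = 0) -> \sum_i F i = \sum_(i in f) F i.
Proof. by move=> F0; rewrite (bigID (mem f)) /= [X in _ + X]big1 ?addr0. Qed.

Lemma mul_vmx f (u : 'rV[R]_#|f|) : u *m vmx f =
  row_mx (\sum_j u 0 j *: vert (enum_val j)) (\sum_j u 0 j)%:M.
Proof.
apply/rowP => l; rewrite mxE; case: (split_ordP l) => l' ->.
  rewrite row_mxEl summxE; apply: eq_bigr => j _.
  by rewrite mxE row_mxEl mxE.
rewrite row_mxEr (ord1 l') mxE mulr1n; apply: eq_bigr => j _.
by rewrite mxE row_mxEr mxE mulr1.
Qed.

(** A linear relation between the vertices of [f], padded by zeros, is one between the vertices of
    an element. *)
Lemma face_row_free f : is_face f -> row_free (vmx f).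
Proof.
move=> [T TM fT]; have [_ Tfree] := elems_free TM.
apply: inj_row_free => u u0.
pose c i := \sum_(j | enum_val j == i) u 0 j.
have cE (j : 'I_#|f|) : c (enum_val j) = u 0 j.
  rewrite /c (bigD1 j) //= big1 ?addr0 // => j' /andP[/eqP/enum_val_inj->].
  by rewrite eqxx.
have c0 : supported f c.
  move=> i; apply: contraNeq => ci; apply: contraT => iF.
  move/eqP: ci; case; rewrite /c big1 // => j /eqP ij.
  by move: iF; rewrite -ij enum_valP.
have conv (W : lmodType R) (F : V -> W) g : supported g c ->
    \sum_(j < #|g|) c (enum_val j) *: F (enum_val j) = \sum_i c i *: F i.
  move=> cg; rewrite (sum_supported (f := g)); last first.
    by move=> i /cg->; apply: scale0r.
  by rewrite [RHS]big_enum_val.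
have cT : supported T c := supported_sub fT c0.
pose uT : 'rV[R]_#|T| := \row_j c (enum_val j).
have uT0 : uT *m vmx T = 0.
  rewrite mul_vmx -[RHS]u0 mul_vmx; congr (row_mx _ _%:M).
    rewrite (eq_bigr (fun j : 'I_#|T| => c (enum_val j) *: vert (enum_val j))) => [|j _].
      rewrite (conv _ (fun i => vert i)) // -(conv _ (fun i => vert i) f) //.
      by apply: eq_bigr => j _; rewrite cE.
    by rewrite mxE.
  rewrite (eq_bigr (fun j : 'I_#|T| => c (enum_val j) *: (1 : R^o))) => [|j _].
    rewrite (conv _ (fun=> 1)) // -(conv _ (fun=> 1) f) //.
    by apply: eq_bigr => j _; rewrite cE; apply: mulr1.
  by rewrite mxE; apply/esym; apply: mulr1.
have /(row_free_inj Tfree) uT00 : uT *m vmx T = 0 *m vmx T by rewrite mul0mx.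
apply/rowP => j; rewrite mxE -cE.
have jT : enum_val j \in T by apply: (fintype.subsetP fT); apply: enum_valP.
have /rowP/(_ (enum_rank_in jT (enum_val j))) := uT00.
by rewrite !mxE enum_rankK_in.
Qed.

Lemma bary_point f c : is_face f -> supported f c -> \sum_i c i = 1 ->
  forall i, bary f i (point c) = c i.
Proof.
move=> /face_row_free f_free c0 c1 i.
pose u : 'rV[R]_#|f| := \row_j c (enum_val j).
rewrite /bary (_ : row_mx (point c) (1%:M : 'M[R]_1) = u *m vmx f); last first.
  rewrite mul_vmx; congr (row_mx _ _%:M).
    rewrite /point (sum_supported (f := f)) => [|j /c0->]; last exact: scale0r.
    by rewrite [LHS]big_enum_val; apply: eq_bigr => j _; rewrite mxE.
  rewrite -c1 (sum_supported (f := f)) // [LHS]big_enum_val.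
  by apply: eq_bigr => j _; rewrite mxE.
rewrite -mulmxA mulmxVp // mulmx1.
have [fi|fi] := boolP (i \in f).
  rewrite (bigD1 (enum_rank_in fi i)) /= ?enum_rankK_in // big1 ?addr0 => [|j].
    by rewrite mxE enum_rankK_in.
  move=> /andP[/eqP ji /negP[]]; apply/eqP/enum_val_inj.
  by rewrite enum_rankK_in.
rewrite big1 ?c0 // => j /eqP ji; by move: fi; rewrite -ji enum_valP.
Qed.

(** The linear part of the affine function [bary f i]. Off the affine hull of [f] it depends on the
    choice of generalized inverse, so only its products with tangent vectors of [f] are
    meaningful. *)
Definition bary_lin f i : 'rV[R]_d :=
  (\sum_(j < #|f| | enum_val j == i) col j (usubmx (pinvmx (vmx f))))^T.

Lemma baryE f i x : bary f i x = dot x (bary_lin f i) + bary f i 0.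
Proof.
rewrite /bary /dot trmxK mulmx_sumr summxE -big_split; apply: eq_bigr => j _ /=.
set P := pinvmx _; rewrite -[P]vsubmxK !mul_row_col mul0mx add0r mxE; congr (_ + _).
by rewrite col_mxKu !mxE; apply: eq_bigr => l _; rewrite !mxE.
Qed.

Lemma baryD f i x v : bary f i (x + v) = bary f i x + dot v (bary_lin f i).
Proof. by rewrite baryE [in RHS]baryE dotDl; ring. Qed.

Lemma derive_bary f i (x v : 'rV[R]_d) : 'D_v (bary f i) x = dot v (bary_lin f i).
Proof.
rewrite /derive; apply/cvg_lim => //.
apply: cvg_near_cst; near=> h => /=.
have h0 : h != 0 by near: h; exact: nbhs_dnbhs_neq.
by rewrite (addrC (h *: v)) baryD dotZl addrAC subrr add0r -[_ *: _]/(_ * _) mulKf.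
Unshelve. all: by end_near.
Qed.

Lemma vertE i : vert i = point (fun j => (j == i)%:R).
Proof.
rewrite /point (bigD1 i) //= eqxx scale1r big1 ?addr0 // => j /negbTE->.
exact: scale0r.
Qed.

Lemma bary_vert f i j : is_face f -> j \in f -> bary f i (vert j) = (i == j)%:R.
Proof.
move=> ff jf; rewrite vertE bary_point // => [l|].
  by apply: contraNeq; rewrite pnatr_eq0 eqb0 negbK => /eqP->.
by rewrite (bigD1 j) //= eqxx big1 ?addr0 // => l /negbTE->.
Qed.

Lemma dot_bary_lin f i a b : is_face f -> a \in f -> b \in f ->
  dot (vert a - vert b) (bary_lin f i) = (i == a)%:R - (i == b)%:R.
Proof.
move=> ff af bf; rewrite -!(bary_vert _ ff) //.
by have := baryD f i (vert b) (vert a - vert b); rewrite addrC subrK => ->; ring.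
Qed.

Lemma tangent_edge f a b : a \in f -> b \in f -> (vert a - vert b <= tangent f)%MS.
Proof.
move=> af bf; rewrite /tangent (sumsmx_sup b) // (sumsmx_sup a) //.
by rewrite genmxE.
Qed.

Lemma tangent_sub m f (A : 'M[R]_(m, d)) :
  (forall a b, a \in f -> b \in f -> (vert a - vert b <= A)%MS) ->
  (tangent f <= A)%MS.
Proof.
by move=> H; apply/sumsmx_subP => b bf; apply/sumsmx_subP => a af; rewrite genmxE H.
Qed.

Lemma tangentS e f : e \subset f -> (tangent e <= tangent f)%MS.
Proof.
move=> /fintype.subsetP ef; apply: tangent_sub => a b /ef af /ef bf.
exact: tangent_edge.
Qed.

Lemma tangent_dot f (w g : 'rV[R]_d) : (w <= tangent f)%MS ->
  (forall a b, a \in f -> b \in f -> dot (vert a - vert b) g = 0) -> dot w g = 0.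
Proof.
move=> wf g0; have : (tangent f <= kermx g^T)%MS.
  apply: tangent_sub => a b af bf; apply/sub_kermxP/rowP => j.
  by rewrite (ord1 j) [LHS](g0 a b) // mxE.
by move=> /(submx_trans wf)/sub_kermxP e; rewrite /dot e mxE.
Qed.

(** Barycentric coordinates restrict to subfaces, and those of vertices outside [g] are zero on [g].
    Hence a gradient taken in an element acts on tangent vectors of a common face in a way
    independent of the element. *)
Lemma tangent_dot_bary f g i (w : 'rV[R]_d) : is_face f -> is_face g -> g \subset f ->
  (w <= tangent g)%MS -> dot w (bary_lin f i) = dot w (bary_lin g i).
Proof.
move=> ff fg /fintype.subsetP gf wg; apply/eqP.
rewrite -subr_eq0 dotC [dot w _]dotC -dotBl dotC.
apply/eqP; apply: (tangent_dot wg) => a b ag bg.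
by rewrite dotC dotBl !(dotC (bary_lin _ _)) !dot_bary_lin ?gf // subrr.
Qed.

End Faces.

(** * Frames and test forms *)

Section Frames.
Variables (R : realType) (d : nat) (M : mesh R d).
Local Notation V := 'I_(nvert M).
Implicit Types (e f g T : {set V}) (i j : V) (w : 'rV[R]_d).
Hypothesis elems_free :
  forall T, T \in elems M -> #|T| = d.+1 /\ row_free (vmx T).
Variable t : forall e : {set V}, 'M[R]_(sdim e, d).
Hypothesis t_orth : forall e, is_face e -> e != finset.set0 ->
  t e *m (t e)^T = 1%:M.
Hypothesis t_tan : forall e, is_face e -> e != finset.set0 ->
  (t e :=: tangent e)%MS.

Lemma submx_sub_diff m (A : 'M[R]_(m, d)) (u v w : 'rV[R]_d) :
  (u - w <= A)%MS -> (v - w <= A)%MS -> (u - v <= A)%MS.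
Proof.
move=> uw vw; have -> : u - v = (u - w) - (v - w) by rewrite opprB addrA subrK.
by rewrite addmx_sub // eqmx_opp.
Qed.

Lemma grad_bary m (B : 'M[R]_(m, d)) f j x :
  grad B (bary f j) x = bary_lin f j *m B^T *m B.
Proof.
rewrite mulmx_sum_row /grad; apply: eq_bigr => l _.
by rewrite derive_bary mulmx_trE row_id dotC.
Qed.

(* the vector dual to d_(e + j) lambda_j: it spans the normal of e in e + j *)
Definition normal e j : 'rV[R]_d := surface_grad t (j |: e)%SET j.

Section Normal.
Variables (e : {set V}) (j : V).
Hypotheses (je : is_face (j |: e)%SET) (e0 : e != finset.set0) (jNe : j \notin e).

Let je0 : (j |: e)%SET != finset.set0.
Proof. by apply/finset.set0Pn; exists j; rewrite finset.setU11. Qed.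

Let e_face : is_face e.
Proof. by apply: is_face_sub je; apply: finset.subsetUr. Qed.

Lemma normal_tangent : (normal e j <= tangent (j |: e)%SET)%MS.
Proof. by rewrite /normal /surface_grad grad_bary -t_tan // submxMl. Qed.

(** [normal e j] is the orthogonal projection of the barycentric gradient onto the tangent space of
    [j |: e]. *)
Lemma dot_normal w : (w <= tangent (j |: e)%SET)%MS ->
  dot w (normal e j) = dot w (bary_lin (j |: e)%SET j).
Proof.
rewrite -t_tan // => /submxP[c ->].
rewrite /normal /surface_grad grad_bary /dot !trmx_mul trmxK.
by rewrite -!mulmxA (mulmxA (t _) _ (_ *m _)) t_orth // mul1mx.
Qed.

Lemma normal_perp w : (w <= tangent e)%MS -> dot w (normal e j) = 0.
Proof.
move=> we; rewrite dot_normal; last first.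
  by apply: submx_trans we _; apply: tangentS; apply: finset.subsetUr.
apply: (tangent_dot we) => a b ae be.
rewrite (dot_bary_lin elems_free) ?finset.in_setU ?ae ?be ?orbT //.
have -> : (j == a) = false by apply: contraNF jNe => /eqP->.
have -> : (j == b) = false by apply: contraNF jNe => /eqP->.
exact: subrr.
Qed.

Lemma dot_edge_normal a : a \in e -> dot (vert j - vert a) (normal e j) = 1.
Proof.
move=> ae; have aje : a \in (j |: e)%SET by rewrite finset.in_setU ae orbT.
rewrite dot_normal ?tangent_edge ?finset.setU11 //.
rewrite (dot_bary_lin elems_free) ?finset.setU11 // eqxx.
have -> : (j == a) = false by apply: contraNF jNe => /eqP->.
exact: subr0.
Qed.

Lemma normal_neq0 : normal e j != 0.
Proof.
have /finset.set0Pn[a ae] := e0; apply: contra_eq_neq (dot_edge_normal ae) => ->.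
by rewrite dotC dot0l eq_sym oner_neq0.
Qed.

(** The normal is a tangent vector of [e] plus a multiple [mu] of the edge. Pairing with the normal
    gives [mu] equal to its squared length, which is nonzero, so the relation can be solved for the
    edge. *)
Lemma edge_normal_span a : a \in e ->
  (vert j - vert a <= tangent e + <<normal e j>>)%MS.
Proof.
move=> ae; pose D := vert j - vert a.
have : (tangent (j |: e)%SET <= tangent e + <<D>>)%MS.
  have H b : b \in (j |: e)%SET -> (vert b - vert a <= tangent e + <<D>>)%MS.
    rewrite !inE => /predU1P[->|be].
      by apply: submx_trans (addsmxSr _ _); rewrite genmxE.
    by apply: submx_trans (addsmxSl _ _); apply: tangent_edge.
  apply: tangent_sub => b b' /H bH /H b'H.
  by apply: submx_sub_diff bH b'H.
move=> /(submx_trans normal_tangent)/sub_addsmxP[[u v] /= E].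
have /sub_rVP[mu Dmu] : (v *m <<D>> <= D)%MS by rewrite -(genmxE D) submxMl.
rewrite Dmu in E.
have uperp : dot (u *m tangent e) (normal e j) = 0 by rewrite normal_perp ?submxMl.
have := congr1 (fun z => dot z (normal e j)) E.
rewrite dotDl uperp add0r dotZl dot_edge_normal // mulr1 => nn.
have mu0 : mu != 0 by rewrite -nn dotxx_eq0 normal_neq0.
rewrite -/D; have -> : D = mu^-1 *: (normal e j) - mu^-1 *: (u *m tangent e).
  by rewrite -scalerBr {1}E addrC addKr scalerA mulVf ?scale1r.
rewrite addmx_sub ?eqmx_opp //.
  by apply: submx_trans (addsmxSr _ _); rewrite genmxE scalemx_sub.
by apply: submx_trans (addsmxSl _ _); rewrite scalemx_sub ?submxMl.
Qed.

End Normal.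

Lemma tangent_span e f : e \subset f -> is_face f -> e != finset.set0 ->
  (tangent f <= t e + \sum_(j in (f :\: e)%SET) <<normal e j>>)%MS.
Proof.
move=> ef ff e0; have /finset.set0Pn[v0 v0e] := e0.
set S := (_ + _)%MS.
have H b : b \in f -> (vert b - vert v0 <= S)%MS.
  move=> bf; have [be|bNe] := boolP (b \in e).
    apply: submx_trans (addsmxSl _ _); rewrite t_tan //; last exact: is_face_sub ff.
    exact: tangent_edge.
  have bfe : is_face (b |: e)%SET.
    by apply: is_face_sub ff; rewrite finset.subUset ef finset.sub1set bf.
  apply: submx_trans (edge_normal_span bfe e0 bNe v0e) _.
  rewrite addsmx_sub; apply/andP; split.
    by rewrite -t_tan ?addsmxSl //; exact: is_face_sub ff.
  apply: submx_trans (addsmxSr _ _).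
  by rewrite (sumsmx_sup b) // finset.in_setD bNe.
apply: tangent_sub => b b' /H bH /H b'H.
by apply: submx_sub_diff bH b'H.
Qed.

(** Names for the vectors of a basis adapted to [e]. The type does not mention the larger face, so
    tuples coming from different faces can be compared. The vectors at the vertices are a parameter
    of [frame_vec]: normals for the degrees of freedom, barycentric gradients for the dual forms. *)
Definition label e := ('I_(sdim e) + V)%type.

Definition frame_vec (N : V -> 'rV[R]_d) e (l : label e) : 'rV[R]_d :=
  match l with inl x => row x (t e) | inr j => N j end.

Lemma tangent_coords e f (w : 'rV[R]_d) : e \subset f -> is_face f ->
    e != finset.set0 -> (w <= tangent f)%MS ->
  exists c : label e -> R, w = \sum_l c l *: frame_vec
     (fun j => if j \in (f :\: e)%SET then normal e j else 0) l.
Proof.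
move=> ef ff e0 wf.
have /sub_addsmxP[[u v] /= ->] := submx_trans wf (tangent_span ef ff e0).
have /sub_sumsmxP[q ->] : (v *m (\sum_(j in (f :\: e)%SET) <<normal e j>>)%MS <=
  \sum_(j in (f :\: e)%SET) <<normal e j>>)%MS by apply: submxMl.
have /fin_all_exists[m mE] j : exists m, q j *m <<normal e j>>%MS = m *: normal e j.
  by apply/sub_rVP; rewrite -(genmxE (normal e j)) submxMl.
exists (fun l => match l with inl x => u 0 x | inr j => m j end).
rewrite big_sumType /=; congr (_ + _); first exact: mulmx_sum_row.
rewrite [LHS]big_mkcond; apply: eq_bigr => j _; rewrite mE.
by case: ifP => // _; rewrite scaler0.
Qed.

(** * Test forms as tuples of labels *)

Section TestLabels.
Variable k : nat.

(** The labels of the factors of a test form, in order. The equation [E] is carried along because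
    [sdeg] is a truncated difference; it holds when [sdim f - k <= sdim e] ([test_degree]). *)
Definition test_label e f (s : {ffun 'I_(sdeg k e f) -> 'I_(sdim e)})
    (E : (sdeg k e f + #|(f :\: e)%SET|)%N = k) (x : 'I_k) : label e :=
  match fintype.split (cast_ord (esym E) x) with
  | inl y => inl (s y)
  | inr z => inr (enum_val z)
  end.

Lemma as_degree_det m n (E : m = k) (c : R) (N : 'M[R]_(m, n)) :
  as_degree (fun A : 'M[R]_(m, n) => c * \det (A *m N^T)) =
  fun A : 'M[R]_(k, n) => c * \det (A *m (castmx (E, erefl n) N)^T).
Proof.
by apply/funext => A; case: k / E A => A; rewrite /as_degree conform_mx_id castmx_id.
Qed.

(** Stated for arbitrary vectors [N], in order to serve both the test forms and the dual forms. *)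
Lemma wedge_test_label e f (E : (sdeg k e f + #|(f :\: e)%SET|)%N = k) :
  exists2 c : R, c != 0 & forall s (N : V -> 'rV[R]_d),
  as_degree (wedge (dt t s) (wedges (fun x : 'I_#|(f :\: e)%SET| => N (enum_val x)))) =
  fun A : 'M[R]_(k, d) =>
    c * \det (A *m (tag_rows (@frame_vec N e) (test_label s E))^T).
Proof.
have [c c0 cE] := wedge_wedges_det R d (sdeg k e f) #|(f :\: e)%SET|.
exists c => // s N; rewrite /dt cE (as_degree_det E).
apply/funext => A; congr (_ * \det (_ *m _^T)).
apply/row_matrixP => x; rewrite rowK.
have -> (P : 'M[R]_(sdeg k e f + #|(f :\: e)%SET|, d)) :
    row x (castmx (E, erefl d) P) = row (cast_ord (esym E) x) P.
  by apply/rowP => y; rewrite !mxE castmxE /= cast_ord_id.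
rewrite /test_label; case: split_ordP => y -> /=.
  by rewrite rowKu rowK.
by rewrite rowKd rowK.
Qed.

Lemma ip_test_label e f (E : (sdeg k e f + #|(f :\: e)%SET|)%N = k) :
  exists2 c : R, c != 0 & forall s (a : 'M[R]_(k, d) -> R), alternating a ->
  ip a (test_form t s) = c * a (tag_rows (@frame_vec (normal e) e) (test_label s E)).
Proof.
have [c c0 cE] := wedge_test_label E; exists c => // s a a_alt.
by rewrite /test_form [as_degree _](cE s (normal e)) ip_scaler ip_det.
Qed.

Lemma test_label_tangent e f (s : {ffun 'I_(sdeg k e f) -> 'I_(sdim e)}) E :
    e \subset f -> is_face f -> e != finset.set0 ->
  (tag_rows (@frame_vec (normal e) e) (test_label s E) <= tangent f)%MS.
Proof.
move=> ef ff e0; apply/row_subP => x; rewrite rowK /test_label.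
case: split_ordP => y _ /=.
  apply: submx_trans (row_sub _ _) _; rewrite t_tan //; last exact: is_face_sub ff.
  exact: tangentS.
have := enum_valP y; rewrite finset.in_setD => /andP[yNe yf].
have yef : (enum_val y |: e)%SET \subset f by rewrite finset.subUset ef finset.sub1set yf.
apply: submx_trans (normal_tangent _) _; last exact: tangentS.
exact: is_face_sub ff.
Qed.

Lemma ip_tr_test_label e f (E : (sdeg k e f + #|(f :\: e)%SET|)%N = k) :
    e \subset f -> is_face f -> e != finset.set0 ->
  exists2 c : R, c != 0 & forall s (a : 'M[R]_(k, d) -> R), alternating a ->
  ip (@tr R d M k t f a) (@tr R d M k t f (test_form t s)) =
  c * a (tag_rows (@frame_vec (normal e) e) (test_label s E)).
Proof.
move=> ef ff e0; have [c c0 cE] := wedge_test_label E; exists c => // s a a_alt.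
have f0 : f != finset.set0.
  by apply: contraNneq e0 => f0; rewrite -finset.subset0 -f0.
set N := tag_rows _ _.
have -> : @tr R d M k t f (test_form t s) = fun A => c * \det (A *m (N *m (t f)^T)^T).
  apply/funext => A; rewrite /tr /test_form [as_degree _](cE s (normal e)).
  by rewrite trmx_mul trmxK mulmxA.
rewrite ip_scaler ip_det; last exact: alternating_mulmx.
congr (_ * _); rewrite /tr.
(* The rows of [N] are tangent to [f], so projecting them onto the frame of [f] changes nothing. *)
suff /submxP[u ->] : (N <= t f)%MS by rewrite -!mulmxA (mulmxA (t f)) t_orth ?mul1mx.
rewrite t_tan //; exact: test_label_tangent.
Qed.

Lemma sdim_card e : e != finset.set0 -> #|e| = (sdim e).+1.
Proof. by rewrite -finset.card_gt0 /sdim; case: #|e|. Qed.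

Lemma sdimS e f : e \subset f -> (sdim e <= sdim f)%N.
Proof. by move=> /fintype.subset_leq_card ef; rewrite /sdim -!subn1 leq_sub2r. Qed.

(** An injection forces [sdeg k e f <= sdim e], that is [k <= sdim f]. So the pairs produced by
    [alt_vanish_tangent] lie in the ranges prescribed for moments and indices. *)
Lemma test_range e f (s : {ffun 'I_(sdeg k e f) -> 'I_(sdim e)}) :
    (sdeg k e f + #|(f :\: e)%SET|)%N = k -> e \subset f -> e != finset.set0 ->
    increasing s ->
  (k <= sdim f)%N /\ (sdim f - k <= sdim e)%N.
Proof.
move=> E ef e0 /increasing_inj/leq_card; rewrite !card_ord => le.
have := sdim_card e0; have := fintype.subset_leq_card ef.
move: E; rewrite finset.cardsD (finset.setIidPr ef) /sdeg in le *.
rewrite /sdim in le *; lia.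
Qed.

Lemma test_degree e f : e \subset f -> e != finset.set0 ->
  (sdim f - k <= sdim e)%N -> (sdeg k e f + #|(f :\: e)%SET|)%N = k.
Proof.
move=> ef e0; have := sdim_card e0; have := fintype.subset_leq_card ef.
rewrite finset.cardsD (finset.setIidPr ef) /sdeg /sdim; lia.
Qed.

Lemma alt_row0 (a : 'M[R]_(k, d) -> R) A x : alternating a -> row x A = 0 -> a A = 0.
Proof.
move=> a_alt Ax; rewrite -(set_row_id A x) Ax.
by have := alt_set_row a_alt A x 0 0 0 0; rewrite !scale0r addr0 !mul0r addr0.
Qed.

(* A k-tuple of frame labels selects a subface f' = e + J and a map s. *)
Lemma alt_vanish_tangent e f (a : 'M[R]_(k, d) -> R) :
    alternating a -> e \subset f -> is_face f -> e != finset.set0 ->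
    (forall f' (s : {ffun 'I_(sdeg k e f') -> 'I_(sdim e)})
       (E : (sdeg k e f' + #|(f' :\: e)%SET|)%N = k),
       e \subset f' -> f' \subset f -> increasing s ->
       a (tag_rows (@frame_vec (normal e) e) (test_label s E)) = 0) ->
  forall A : 'M[R]_(k, d), (A <= tangent f)%MS -> a A = 0.
Proof.
move=> a_alt ef ff e0 a0 A Af.
pose N j := if j \in (f :\: e)%SET then normal e j else 0.
apply: (alt_set_vanish a_alt (b := @frame_vec N e)) => [tau|x]; last first.
  by apply: tangent_coords => //; apply: submx_trans (row_sub _ _) Af.
have [tau_inj|ninj] := pselect (injective tau); last exact: alt_tuple_notinj.
(* A vertex label outside [f :\: e] carries the zero vector. *)
have [[x [j [tx jf]]]|tau_ok] :=
    pselect (exists x j, tau x = inr j /\ j \notin (f :\: e)%SET).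
  by apply: (@alt_row0 _ _ x) => //; rewrite rowK tx /= /N (negbTE jf).
have {}tau_ok x j : tau x = inr j -> j \in (f :\: e)%SET.
  by move=> tx; apply: contraT => jf; case: tau_ok; exists x, j.
pose Im := [set tau x | x : 'I_k].
pose S := [set x : 'I_(sdim e) | inl x \in Im]%SET.
pose J := [set j : V | inr j \in Im]%SET.
have Jf j : j \in J -> j \in (f :\: e)%SET.
  by rewrite inE => /imsetP[x _ /esym/tau_ok].
have cardSJ : (#|S| + #|J|)%N = k.
  rewrite -[RHS]card_ord -(card_imset _ tau_inj) -!sum1_card big_sumType /=.
  by congr (_ + _)%N; apply: eq_bigl => l; rewrite inE.
pose f' := (e :|: J)%SET.
have f'e : (f' :\: e)%SET = J.
  apply/finset.setP => j; rewrite finset.in_setD finset.in_setU.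
  case: (boolP (j \in J)) => [/Jf|]; last by case: (j \in e).
  by rewrite finset.in_setD orbT => /andP[->].
have ef' : e \subset f' by apply: finset.subsetUl.
have f'f : f' \subset f.
  rewrite finset.subUset ef; apply/fintype.subsetP => j /Jf.
  by rewrite finset.in_setD => /andP[].
have cardS : #|S| = sdeg k e f'.
  have cf' : #|f'| = (#|e| + #|J|)%N.
    by rewrite -(finset.cardsID e f') f'e (finset.setIidPr ef').
  rewrite /sdeg /sdim cf' -cardSJ; have : (0 < #|e|)%N by rewrite finset.card_gt0.
  by move: #|e| #|J| #|S| => x y z; lia.
have E : (sdeg k e f' + #|(f' :\: e)%SET|)%N = k by rewrite -cardS f'e.
have [s s_inc [_ sS]] := increasing_exists cardS.
have lab x : exists y, tau x = test_label s E y.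
  have tI : tau x \in Im by apply: imset_f.
  case tx: (tau x) tI => [i|j] tI.
    have [|z zi] := sS i; first by rewrite inE.
    exists (cast_ord E (lshift _ z)).
    by rewrite /test_label cast_ordK (unsplitK (inl _ z)) zi.
  have jf' : j \in (f' :\: e)%SET by rewrite f'e inE.
  exists (cast_ord E (rshift _ (enum_rank_in jf' j))).
  by rewrite /test_label cast_ordK (unsplitK (inr _ _)) enum_rankK_in.
have [p tp] := tuple_perm tau_inj lab.
have -> : \matrix_(x < k) frame_vec N (tau x) =
    \matrix_(x < k) frame_vec (normal e) (tau x).
  apply/row_matrixP => x; rewrite !rowK.
  by case tx: (tau x) => [i|j] //=; rewrite /N (tau_ok _ _ tx).
by rewrite (alt_tuple_perm a_alt _ tp) [X in _ * X]a0 ?mulr0.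
Qed.

Lemma test_label_inj e f (s : {ffun 'I_(sdeg k e f) -> 'I_(sdim e)}) E :
  increasing s -> injective (test_label (f := f) s E).
Proof.
move=> /increasing_inj s_inj x y; rewrite /test_label.
case: split_ordP => x' ex; case: split_ordP => y' ey //.
  move=> [/s_inj xy]; apply: (can_inj (cast_ordK (esym E))).
  by rewrite ex ey xy.
move=> [/enum_val_inj xy]; apply: (can_inj (cast_ordK (esym E))).
by rewrite ex ey xy.
Qed.

End TestLabels.

(** Frame vectors of [e] are orthonormal, normals are orthogonal to the tangent space of [e], and
    the coordinate of a vertex outside [e] is constant on [e]. Finally [normal e j] is tangent to
    [j |: e], where every other such coordinate is zero, while that of [j] pairs to the squared
    length of the normal. *)
Lemma label_pairing e T (l l' : label e) : is_face T -> e \subset T ->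
    e != finset.set0 ->
    (forall j, l = inr j -> j \in (T :\: e)%SET) ->
    (forall j, l' = inr j -> j \in (T :\: e)%SET) ->
  (dot (frame_vec (normal e) l) (frame_vec (bary_lin T) l') == 0) = (l != l').
Proof.
move=> fT eT e0 lT l'T; have fe := is_face_sub eT fT.
have dotT (w : 'rV[R]_d) j : (w <= tangent e)%MS -> j \in (T :\: e)%SET ->
    dot w (bary_lin T j) = 0.
  move=> we; rewrite finset.in_setD => /andP[jNe jT].
  rewrite (tangent_dot_bary elems_free j fT fe) //.
  apply: (tangent_dot we) => a b ae be; rewrite (dot_bary_lin elems_free) //.
  have -> : (j == a) = false by apply: contraNF jNe => /eqP->.
  have -> : (j == b) = false by apply: contraNF jNe => /eqP->.
  exact: subrr.
have rowe x : (row x (t e) <= tangent e)%MS by rewrite -t_tan // row_sub.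
case: l lT => [x|j] lT; case: l' l'T => [x'|j'] l'T /=.
- rewrite -mulmx_trE t_orth // mxE -val_eqE /=.
  by rewrite (inj_eq (@inl_inj _ _)) pnatr_eq0 eqb0.
- by rewrite dotT ?eqxx //; apply: l'T.
- have := lT _ erefl; rewrite finset.in_setD => /andP[jNe jT].
  rewrite dotC normal_perp ?eqxx //; apply: is_face_sub fT.
  by rewrite finset.subUset eT finset.sub1set jT.
have := lT _ erefl; rewrite finset.in_setD => /andP[jNe jT].
have := l'T _ erefl; rewrite finset.in_setD => /andP[j'Ne j'T].
have jeT : (j |: e)%SET \subset T by rewrite finset.subUset eT finset.sub1set jT.
have fje := is_face_sub jeT fT.
have ntan := normal_tangent fje.
rewrite (inj_eq (@inr_inj _ _)) (tangent_dot_bary elems_free _ fT fje) //.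
have [<-|jj'] := eqVneq j j'.
  by rewrite -dot_normal // dotxx_eq0 (negbTE (normal_neq0 _ _ _)).
apply/eqP; apply: (tangent_dot ntan) => a b aje bje.
rewrite (dot_bary_lin elems_free) //.
have H c : c \in (j |: e)%SET -> (j' == c) = false.
  rewrite !inE => /predU1P[->|ce]; first by rewrite eq_sym (negbTE jj').
  by apply: contraNF j'Ne => /eqP->.
by rewrite !H // subrr.
Qed.

End Frames.

(** * Polynomials on a face *)

Section PolynomialsOnFaces.
Variables (R : realType) (d : nat) (M : mesh R d).
Local Notation V := 'I_(nvert M).
Implicit Types (e f g T : {set V}) (i j : V) (c : V -> R).
Hypothesis elems_free :
  forall T, T \in elems M -> #|T| = d.+1 /\ row_free (vmx T).

Lemma point_coord c l : point c 0 l = \sum_i c i * vert i 0 l.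
Proof. by rewrite /point summxE; apply: eq_bigr => i _; rewrite mxE. Qed.

Lemma Pol_point (P : pred nat) l : P 1%N -> Pol P (fun c => point c 0 l).
Proof.
move=> P1; apply: Pol_ext (Pol_sum (index_enum V) (p := predT)
  (fun i _ => PolZ (vert i 0 l) (Pol_var R i P1))) => c.
by rewrite point_coord; apply: eq_bigr => i _; rewrite mulrC.
Qed.

(* In barycentric coordinates a polynomial of degree at most r is homogeneous
   of degree r: multiply each monomial by a power of the sum of coordinates. *)
Lemma poly_le_point r (p : 'rV[R]_d -> R) : poly_le r%:Z p ->
  exists2 F : (V -> R) -> R, Pol (pred1 r) F &
    forall c, \sum_i c i = 1 -> p (point c) = F c.
Proof.
move=> /poly_leP[f /(Pol_coef (m := r) (fun _ => id))[a fE] pE].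
exists (fun c => \sum_(b | (mdeg (@nat_ffun 'I_d r b) <= r)%N)
  a b * (mono (fun l => point c 0 l) (nat_ffun b) *
         (\sum_i c i) ^+ (r - mdeg (nat_ffun b)))).
  apply: Pol_sum => b br; apply: PolZ.
  apply: (PolM (P1 := pred1 (mdeg (nat_ffun b)))
    (P2 := pred1 (1 * (r - mdeg (nat_ffun b)))%N)) => [m n /eqP-> /eqP->||].
  - by rewrite mul1n /= subnKC.
  - apply: (Pol_mono_comp (D := fun n => pred1 n)) => //.
      by move=> ? ? ? ? /eqP-> /eqP->; rewrite /= eqxx.
    by move=> l; apply: Pol_point.
  - apply: (Pol_exp (D := fun n => pred1 n)) => //.
      by move=> ? ? ? ? /eqP-> /eqP->; rewrite /= eqxx.
    by apply: Pol_sum => i _; apply: Pol_var.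
move=> c c1; rewrite pE fE; apply: eq_bigr => b _.
by rewrite c1 expr1n mulr1.
Qed.

Lemma Pol_bary e i : Pol (leq^~ 1) (fun y : 'I_d -> R => bary e i (\row_l y l)).
Proof.
have: Pol (leq^~ 1) (fun y : 'I_d -> R =>
    \sum_l bary_lin e i 0 l * y l + bary e i 0).
  apply: PolD; last exact: Pol_const.
  by apply: Pol_sum => l _; apply: PolZ; apply: Pol_var.
apply: Pol_ext => y; rewrite [RHS]baryE dotC dotE; congr (_ + _).
by apply: eq_bigr => l _; rewrite mxE.
Qed.

Lemma poly_le_bary m e (Q : (V -> R) -> R) : Pol (pred1 m) Q ->
  poly_le m%:Z (fun x => Q (fun i => bary e i x)).
Proof.
move=> QP; apply/poly_leP.
exists (fun y => Q (fun i => bary e i (\row_l y l))) => [|x]; last first.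
  by congr Q; apply/funext => i; congr bary; apply/rowP => l; rewrite mxE.
apply: (Pol_comp (g := fun i y => bary e i (\row_l y l)) QP) => b /eqP bm.
rewrite -bm; apply: (Pol_mono_comp (D := fun n => leq^~ n)) => [//||i].
  by move=> ? ? ? ?; apply: leq_add.
exact: Pol_bary.
Qed.

Lemma poly_leZ m (p : 'rV[R]_d -> R) a :
  poly_le m%:Z p -> poly_le m%:Z (fun x => a * p x).
Proof.
move=> /poly_leP[f fP pE]; apply/poly_leP.
by exists (fun y => a * f y) => [|x]; [apply: PolZ | rewrite pE].
Qed.

Lemma poly_le_sum m (I : Type) (s : seq I) (P : pred I) (p : I -> 'rV[R]_d -> R) :
  (forall h, P h -> poly_le m%:Z (p h)) ->
  poly_le m%:Z (fun x => \sum_(h <- s | P h) p h x).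
Proof.
move=> pP; elim: s => [|h s /poly_leP[f fP fE]].
  apply/poly_leP; exists (fun=> 0) => [|x]; first exact: Pol0.
  by rewrite big_nil.
case Pi: (P h).
  have /poly_leP[g gP gE] := pP h Pi.
  apply/poly_leP; exists (fun y => g y + f y) => [|x]; first exact: PolD.
  by rewrite big_cons Pi gE fE.
by apply/poly_leP; exists f => // x; rewrite big_cons Pi fE.
Qed.

Lemma poly_leB m (p q : 'rV[R]_d -> R) :
  poly_le m%:Z p -> poly_le m%:Z q -> poly_le m%:Z (fun x => p x - q x).
Proof.
move=> /poly_leP[f fP pE] /poly_leP[g gP qE]; apply/poly_leP.
by exists (fun y => f y - g y) => [|x]; [apply: PolB | rewrite pE qE].
Qed.

(** * Parametrization of a face by the reference simplex *)

Section Coordinates.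
Variable e : {set V}.
Hypothesis e0 : e != finset.set0.

(** Barycentric coordinates of the image of [y]: the first vertex in the enumeration takes the
    remaining weight, which explains the shift by one in the others. *)
Definition face_coord (y : 'I_(sdim e) -> R) (i : V) : R :=
  if i \in e then
    (index i (enum e) == 0%N)%:R * (1 - \sum_j y j) +
    \sum_(j < sdim e) (index i (enum e) == j.+1)%:R * y j
  else 0.

Lemma size_enum_sdim : size (enum e) = (sdim e).+1.
Proof. by rewrite -cardE sdim_card. Qed.

Lemma face_coord_supported y : supported e (face_coord y).
Proof. by move=> i /negbTE ie; rewrite /face_coord ie. Qed.

Let v0_exists : exists v, v \in e. Proof. exact/finset.set0Pn. Qed.
Let v0 := xchoose v0_exists.
Definition nth_vert m := nth v0 (enum e) m.

Lemma nth_vert_in m : (m < (sdim e).+1)%N -> nth_vert m \in e.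
Proof. by move=> me; rewrite -mem_enum mem_nth // size_enum_sdim. Qed.

Lemma vpointE m : (m < (sdim e).+1)%N -> vpoint e m = vert (nth_vert m).
Proof. by move=> me; rewrite /vpoint (nth_map v0) // size_enum_sdim. Qed.

Lemma face_coord0 y : face_coord y (nth_vert 0) = 1 - \sum_j y j.
Proof.
rewrite /face_coord nth_vert_in // index_uniq ?size_enum_sdim ?enum_uniq // eqxx mul1r.
by rewrite [X in _ + X]big1 ?addr0 // => j _; rewrite mul0r.
Qed.

Lemma face_coordS y (j : 'I_(sdim e)) : face_coord y (nth_vert j.+1) = y j.
Proof.
rewrite /face_coord nth_vert_in ?ltnS ?ltn_ord //.
rewrite index_uniq ?size_enum_sdim ?enum_uniq ?ltnS ?ltn_ord //.
rewrite mul0r add0r (bigD1 j) //= eqxx mul1r big1 ?addr0 // => j' j'j.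
by rewrite eqSS eq_sym val_eqE (negbTE j'j) mul0r.
Qed.

Lemma sum_vertices (W : zmodType) (F : V -> W) :
  (forall i, i \notin e -> F i = 0) ->
  \sum_i F i = F (nth_vert 0) + \sum_(j < sdim e) F (nth_vert j.+1).
Proof.
move=> /sum_supported ->; rewrite -big_enum /= (big_nth v0) size_enum_sdim.
by rewrite big_mkord big_ord_recl.
Qed.

Lemma face_coord_sum y : \sum_i face_coord y i = 1.
Proof.
rewrite sum_vertices ?face_coord0; last exact: face_coord_supported.
by under [X in _ + X]eq_bigr do rewrite face_coordS; rewrite subrK.
Qed.

Lemma point_coordE (y : 'rV[R]_(sdim e)) :
  point (face_coord (y 0)) = vpoint e 0 + y *m edges e.
Proof.
rewrite /point sum_vertices => [|i /face_coord_supported->]; last exact: scale0r.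
rewrite face_coord0 mulmx_sum_row vpointE // scalerBl scale1r -addrA; congr (_ + _).
rewrite scaler_suml -sumrN -big_split; apply: eq_bigr => j _ /=.
rewrite face_coordS rowK !vpointE ?ltnS ?ltn_ord // scalerBr addrC //.
Qed.

Lemma face_coord_surj c : supported e c -> \sum_i c i = 1 ->
  face_coord (fun j : 'I_(sdim e) => c (nth_vert j.+1)) = c.
Proof.
move=> ce c1; apply/funext => i.
have [ie|ie] := boolP (i \in e); last by rewrite face_coord_supported // ce.
have -> : i = nth_vert (index i (enum e)) by rewrite /nth_vert nth_index ?mem_enum.
have : (index i (enum e) < (sdim e).+1)%N.
  by rewrite -size_enum_sdim index_mem mem_enum.
case: (index i (enum e)) => [_|m me]; last first.
  by rewrite (face_coordS _ (Ordinal (me : (m < _)%N))).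
by rewrite face_coord0 -c1 (sum_vertices ce) addrK.
Qed.

Lemma face_coord_ge0 (y : 'rV[R]_(sdim e)) i : corner 1 y -> 0 <= face_coord (y 0) i.
Proof.
move=> [y0 y1]; rewrite /face_coord; case: ifP => // _.
apply: addr_ge0; first by rewrite mulr_ge0 ?subr_ge0.
by apply: sumr_ge0 => j _; rewrite mulr_ge0.
Qed.

Lemma Pol_coord i : Pol predT (face_coord^~ i).
Proof.
rewrite /face_coord; case: (i \in e); last exact: Pol_const.
apply: PolD; last by apply: Pol_sum => j _; apply: PolZ; apply: Pol_var.
apply: PolZ; apply: PolB; first exact: Pol_const.
by apply: Pol_sum => j _; apply: Pol_var.
Qed.

Lemma Pol_poly_le m (p : 'rV[R]_d -> R) : poly_le m p ->
  Pol predT (fun y => p (point (face_coord y))).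
Proof.
case: m => m pm; last first.
  case: pm => a pE; apply: Pol_ext (Pol0 R _ _) => y.
  by rewrite pE big_pred0.
have [F FP FE] := poly_le_point pm.
apply: (@Pol_ext _ _ _ (fun y => F (face_coord y))) => [y|].
  by rewrite FE ?face_coord_sum.
apply: (Pol_comp (g := fun i y => face_coord y i) FP) => b _.
apply: (Pol_mono_comp (D := fun=> predT)) => // i; exact: Pol_coord.
Qed.

Lemma Pol_polyfun n (f : ('I_n -> R) -> R) :
  Pol predT f -> polyfun (fun y : 'rV[R]_n => f (y 0)).
Proof. by move=> [s _ sE]; exists s. Qed.

Lemma simplex_intE (u : 'rV[R]_d -> R) : simplex_int e u =
  Num.sqrt (\det (edges e *m (edges e)^T)) *
  corner_int 1 (fun y : 'rV[R]_(sdim e) => u (point (face_coord (y 0)))).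
Proof.
by rewrite /simplex_int; congr (_ * corner_int 1 _); apply/funext => y; rewrite point_coordE.
Qed.

Lemma eq_simplex_int (u v : 'rV[R]_d -> R) :
    (forall c, (forall i, 0 <= c i) -> supported e c -> \sum_i c i = 1 ->
       u (point c) = v (point c)) ->
  simplex_int e u = simplex_int e v.
Proof.
move=> uv; rewrite !simplex_intE; congr (_ * _).
apply: eq_corner_int => // y cy; apply: uv; last exact: face_coord_sum.
  by move=> i; apply: face_coord_ge0.
exact: face_coord_supported.
Qed.

Lemma simplex_intB m m' (p p' q : 'rV[R]_d -> R) :
    poly_le m p -> poly_le m p' -> poly_le m' q ->
  simplex_int e (fun x => (p x - p' x) * q x) =
  simplex_int e (fun x => p x * q x) - simplex_int e (fun x => p' x * q x).
Proof.
move=> /Pol_poly_le pP /Pol_poly_le p'P /Pol_poly_le qP.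
rewrite !simplex_intE -mulrBr -corner_intB //.
- by congr (_ * corner_int 1 _); apply/funext => y; rewrite mulrBl.
- exact: (Pol_polyfun (PolM (P := predT) (fun _ _ _ _ => isT) pP qP)).
- exact: (Pol_polyfun (PolM (P := predT) (fun _ _ _ _ => isT) p'P qP)).
Qed.

(* Vanishing on the boundary gives p = b * Q with b the product of the
   barycentric coordinates; the test function q = Q makes p * q = b * Q ^+ 2. *)
Lemma moment_vanish r (p : 'rV[R]_d -> R) : (0 < r)%N -> is_face e ->
    0 < \det (edges e *m (edges e)^T) -> poly_le r%:Z p ->
    (forall e', e' \proper e -> forall c, (forall i, 0 <= c i) ->
       supported e' c -> \sum_i c i = 1 -> p (point c) = 0) ->
    (forall q, poly_le (r%:Z - (sdim e).+1%:Z) q ->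
       simplex_int e (fun x => p x * q x) = 0) ->
  forall c, (forall i, 0 <= c i) -> supported e c -> \sum_i c i = 1 ->
    p (point c) = 0.
Proof.
move=> r0 fe gram pr bd mom c c_ge0 ce c1.
have [F FP FE] := poly_le_point pr.
have [Q [QP Q0 FQ]] : exists Q : (V -> R) -> R,
    [/\ Pol (pred1 (r - #|e|)%N) Q, (r < #|e|)%N -> forall x, Q x = 0
      & forall x, (forall i, i \notin e -> x i = 0) ->
          F x = \prod_(i in e) x i * Q x].
  apply: (bubble_factor r0) => // x e' e'e x0 xs x1.
  have xsum : \sum_i x i = 1 by rewrite (sum_supported xs).
  by rewrite -FE //; apply: (bd e').
have pQ a : supported e a -> \sum_i a i = 1 -> p (point a) = \prod_(i in e) a i * Q a.
  by move=> ae a1; rewrite FE // FQ.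
(* If [r < #|e|] the only test function is 0, but then the bubble exceeds degree [r] and [Q] is zero
   already. *)
rewrite pQ //; have [re|er] := ltnP r #|e|; first by rewrite Q0 ?mulr0.
pose q x := Q (fun i => bary e i x).
have qQ a : supported e a -> \sum_i a i = 1 -> q (point a) = Q a.
  by move=> ae a1; congr Q; apply/funext => i; apply: bary_point.
have qP : poly_le (r%:Z - (sdim e).+1%:Z) q.
  by rewrite -sdim_card // subzn //; apply: poly_le_bary.
(* A zero coordinate kills the bubble. Otherwise the weight of the first vertex is positive, which
   is the strict bound in [corner_int_eq0]. *)
have [ci0|ci0] := pselect (exists2 i, i \in e & c i = 0).
  by have [i ie ci] := ci0; rewrite (bigD1 i) //= ci mul0r mul0r.
have {ci0}c_gt0 i : i \in e -> 0 < c i.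
  move=> ie; rewrite lt_neqAle c_ge0 andbT eq_sym.
  by apply/eqP => ci; apply: ci0; exists i.
pose u (y : 'rV[R]_(sdim e)) := p (point (face_coord (y 0))) * q (point (face_coord (y 0))).
have uE y : u y = \prod_(i in e) face_coord (y 0) i * Q (face_coord (y 0)) ^+ 2.
  have cs := @face_coord_supported (y 0); have c1' := face_coord_sum (y 0).
  by rewrite /u pQ // qQ // expr2 mulrA.
pose y : 'rV[R]_(sdim e) := \row_j c (nth_vert j.+1).
have cyE : face_coord (y 0) = c.
  by rewrite -[RHS]face_coord_surj //; congr face_coord; apply/funext => j; rewrite mxE.
have : u y = 0.
  apply: (corner_int_eq0 (ltr01 : (0 : R) < 1)).
  - exact: (Pol_polyfun (PolM (P := predT) (fun _ _ _ _ => isT)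
      (Pol_poly_le pr) (Pol_poly_le qP))).
  - move=> z cz; rewrite uE mulr_ge0 ?sqr_ge0 //.
    by apply: prodr_ge0 => i _; apply: face_coord_ge0.
  - have := mom q qP; rewrite simplex_intE => /eqP.
    by rewrite mulf_eq0 sqrtr_eq0 leNgt gram => /eqP.
  - by move=> j; rewrite mxE.
  rewrite -subr_gt0; have := c_gt0 _ (nth_vert_in (ltn0Sn _)).
  by rewrite -{1}cyE face_coord0.
rewrite uE cyE => /eqP; rewrite mulf_eq0 sqrf_eq0 => /orP[/eqP->|/eqP->].
  by rewrite mul0r.
by rewrite mulr0.
Qed.

End Coordinates.

(** In an orthonormal frame the Gram determinant is the square of the determinant whose sign records
    the orientation. Its positivity allows the volume factor of [simplex_int] to be cancelled. *)
Lemma gram_gt0 e (B : 'M[R]_(sdim e, d)) : e != finset.set0 ->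
    B *m B^T = 1%:M -> (B :=: tangent e)%MS ->
    ((0 < sdim e)%N -> \det (edges e *m B^T) != 0) ->
  0 < \det (edges e *m (edges e)^T).
Proof.
move=> e0 Borth Btan detB.
have edgesE : edges e *m B^T *m B = edges e.
  have /submxP[u ->] : (edges e <= B)%MS.
    rewrite Btan; apply/row_subP => j; rewrite rowK !(vpointE e0) ?ltnS ?ltn_ord //.
    by apply: tangent_edge; apply: nth_vert_in; rewrite ?ltnS ?ltn_ord.
  by rewrite -!mulmxA (mulmxA B) Borth mul1mx.
rewrite -edgesE trmx_mul -mulmxA (mulmxA B) Borth mul1mx det_mulmx det_tr -expr2.
rewrite exprn_even_gt0 //=; case: (posnP (sdim e)) => [s0|]; last exact: detB.
suff det0 n (A : 'M[R]_n) : n = 0%N -> \det A = 1 by rewrite det0 // oner_neq0.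
by move=> n0; subst n; apply: det_mx00.
Qed.

End PolynomialsOnFaces.

(** * Single-valued traces *)

Section Traces.
Variables (R : realType) (d r k : nat) (M : mesh R d).
Local Notation V := 'I_(nvert M).
Implicit Types (e f g : {set V}) (i j : V) (c : V -> R).
Hypothesis r_gt0 : (0 < r)%N.
Hypothesis elems_free :
  forall T, T \in elems M -> #|T| = d.+1 /\ row_free (vmx T).
Variable t : forall e : {set V}, 'M[R]_(sdim e, d).
Hypothesis t_orth : forall e, is_face e -> e != finset.set0 ->
  t e *m (t e)^T = 1%:M.
Hypothesis t_tan : forall e, is_face e -> e != finset.set0 ->
  (t e :=: tangent e)%MS.
Hypothesis gram : forall e, is_face e -> e != finset.set0 ->
  0 < \det (edges e *m (edges e)^T).
Notation pwform := (element M -> 'rV[R]_d -> 'M[R]_(k, d) -> R).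
Implicit Types (w : pwform) (T : element M).

Lemma poly_form_eval (u : 'rV[R]_d -> 'M[R]_(k, d) -> R) (N : 'M[R]_(k, d)) :
  poly_form r u -> poly_le r%:Z (fun x => u x N).
Proof.
move=> [u_alt up].
have -> : (fun x => u x N) = fun x =>
    \sum_(s : {ffun 'I_k -> 'I_d} | increasing s)
      \det (colsub s N) * u x (rowsub s 1%:M).
  apply/funext => x; rewrite (alt_expand _ (u_alt x)).
  by apply: eq_bigr => s _; rewrite mulrC.
by apply: poly_le_sum => s /up; apply: poly_leZ.
Qed.

(* Barycentric coordinates c make this the equality of the pullbacks to f of
   the restrictions of w to T and T', at all points of f. *)
Definition trace_single_valued w : Prop :=
  forall f T T', f != finset.set0 -> f \subset val T -> f \subset val T' ->
  forall c, (forall i, 0 <= c i) -> supported f c -> \sum_i c i = 1 ->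
  forall A : 'M[R]_(k, d), (A <= tangent f)%MS ->
    w T (point c) A = w T' (point c) A.

Lemma element_face f T : f \subset val T -> is_face f.
Proof. by move=> fT; exists (val T) => //; apply: valP. Qed.

(** Strong induction on the number of vertices of [e] with [f] fixed. All faces [f'] between [e] and
    [f] have dimension at most [d.-1], so their moments are among those imposed. *)
Lemma PLambda_trace_lowdim w f T T' : PLambda r t w ->
    f \subset val T -> f \subset val T' -> (sdim f <= d.-1)%N ->
  forall e, e \subset f -> e != finset.set0 ->
  forall c, (forall i, 0 <= c i) -> supported e c -> \sum_i c i = 1 ->
  forall A : 'M[R]_(k, d), (A <= tangent f)%MS ->
    w T (point c) A = w T' (point c) A.
Proof.
move=> [wp wm] fT fT' fd e; have ff := element_face fT.
have [n] := ubnP #|e|; elim: n e => // n IHn e /ltnSE en ef e0.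
move=> c c_ge0 ce c1 A Af.
have fe := is_face_sub ef ff.
apply/eqP; rewrite -subr_eq0; apply/eqP.
pose a A := w T (point c) A - w T' (point c) A.
have a_alt : alternating a.
  by apply: alternating_sub; [have [+ _] := wp T | have [+ _] := wp T']; apply.
apply: (alt_vanish_tangent elems_free t_orth t_tan a_alt ef ff e0) Af => f' s E ef' f'f s_inc.
set N := tag_rows _ _.
have ff' := is_face_sub f'f ff.
have f'0 : f' != finset.set0.
  by apply: contraNneq e0 => f0; rewrite -finset.subset0 -f0.
have Nf : (N <= tangent f)%MS.
  apply: submx_trans (tangentS f'f).
  exact: (test_label_tangent t_tan).
have [c0 c0_neq0 c0E] :=
  ip_tr_test_label t_orth t_tan E ef' ff' e0.
pose p T x := c0 * w T x N.
have pP T0 : poly_le r%:Z (p T0) by apply: poly_leZ; apply: poly_form_eval.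
suff : p T (point c) - p T' (point c) = 0.
  by rewrite -mulrBr => /eqP; rewrite mulf_eq0 (negbTE c0_neq0) => /eqP.
apply: (moment_vanish elems_free e0 r_gt0 fe (gram fe e0)
  (p := fun x => p T x - p T' x)) => //.
- exact: poly_leB.
- move=> e' e'e b b_ge0 be b1.
  rewrite /p (IHn e') ?subrr //.
  + exact: leq_trans (proper_card e'e) en.
  + exact: fintype.subset_trans (proper_sub e'e) ef.
  (* Weights supported in the empty set cannot sum to 1. *)
  + apply: contra_eqN b1 => /eqP e'0; rewrite big1 ?(eq_sym 0) ?oner_neq0 //.
    by move=> i _; apply: be; rewrite e'0 finset.in_set0.
- move=> q qP; rewrite (simplex_intB e0 (pP T) (pP T') qP).
  have [kf' f'ke] := test_range E ef' e0 s_inc.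
  have eq0 T0 : simplex_int e (fun x => p T0 x * q x) =
      simplex_int e (fun x => ip (@tr R d M k t f' (w T0 x))
        (@tr R d M k t f' (test_form t s)) * q x).
    congr simplex_int; apply/funext => x; rewrite c0E //.
    by have [+ _] := wp T0; apply.
  rewrite !eq0; apply/eqP; rewrite subr_eq0; apply/eqP.
  apply: (wm (sdim f') (sdim e)) => //.
  + rewrite kf' /=; apply: leq_trans fd; exact: sdimS.
  + rewrite inE sdim_card // eqxx; apply/existsP; exists (val T).
    by rewrite (valP T) (fintype.subset_trans f'f fT).
  + by rewrite f'ke /= sdimS.
  + by rewrite inE sdim_card // eqxx.
  + exact: fintype.subset_trans f'f fT.
  + exact: fintype.subset_trans f'f fT'.
Qed.

(** Left to right uses the moments in dimension below [d]. Right to left, the integrand of a moment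
    only involves the pullback to [f] at points of [e]. *)
Lemma PLambda_traceP w : PLambda r t w <->
  (forall T, poly_form r (w T)) /\ trace_single_valued w.
Proof.
split=> [wP|[wp tr_w]].
  split=> [|f T T' f0 fT fT' c c_ge0 fc c1 A Af]; first exact: wP.1.
  have [fd|fd] := leqP (sdim f) d.-1.
    by apply: (PLambda_trace_lowdim wP fT fT' fd (fintype.subxx f)).
  (* A face of dimension at least [d] equals any element containing it, so there is nothing to
     compare. *)
  have Tf T0 : f \subset val T0 -> val T0 = f.
    move=> fT0; apply/esym/eqP; rewrite finset.eqEcard fT0.
    have [/eqP Td _] := elems_free (valP T0); rewrite (eqP Td).
    by rewrite sdim_card // ltnS; apply: leq_trans (leqSpred d) fd.
  by have -> : T = T' by apply: val_inj; rewrite (Tf T) // (Tf T').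
split=> // l s f e sg q kl fl ls es qP sg_inc T T' fT fT'.
have ff := element_face fT.
have [ef e0] : e \subset f /\ e != finset.set0.
  move: es; rewrite inE => /andP[/eqP es ->]; split=> //.
  by rewrite -finset.card_gt0 es.
have f0 : f != finset.set0.
  by apply: contraNneq e0 => f0; rewrite -finset.subset0 -f0.
apply: (eq_simplex_int e0) => c c_ge0 ce c1; congr (ip _ _ * _).
apply/funext => A; apply: (tr_w f) => //; first exact: supported_sub ce.
by rewrite -t_tan // submxMl.
Qed.

Lemma poly_formD (u v : 'rV[R]_d -> 'M[R]_(k, d) -> R) (a : R) :
  poly_form r u -> poly_form r v -> poly_form r (a *: u + v).
Proof.
move=> [ua up] [va vp]; split=> [x|s s_inc]; last first.
  have /poly_leP[f fP fE] := up s s_inc; have /poly_leP[g gP gE] := vp s s_inc.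
  apply/poly_leP; exists (fun y => a * f y + g y) => [|x].
    by apply: PolD => //; apply: PolZ.
  by rewrite -fE -gE.
have := alternating_sub (va x) (alternating_scale (- a) (ua x)).
congr alternating; apply/funext => A.
by rewrite mulNr opprK addrC.
Qed.

Lemma PLambda_lin (a : R) w w' : PLambda r t w -> PLambda r t w' ->
  PLambda r t (a *: w + w').
Proof.
move=> /PLambda_traceP[wp tw] /PLambda_traceP[w'p tw']; apply/PLambda_traceP.
split=> [T|f T T' f0 fT fT' c c_ge0 fc c1 A Af]; first exact: poly_formD.
have E T0 x : (a *: w + w') T0 x A = a * w T0 x A + w' T0 x A by [].
by rewrite !E (tw f T T') // (tw' f T T').
Qed.

Lemma PLambda0 : PLambda r t (0 : pwform).
Proof.
apply/PLambda_traceP; split=> [T|//]; split=> [x|s _].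
  by split=> [*|*]; rewrite ?mulr0 ?addr0.
by apply/poly_leP; exists (fun=> 0); [apply: Pol0|].
Qed.

End Traces.

(** * Lattice points and indices *)

Section LatticeIndices.
Variables (R : realType) (d r : nat) (M : mesh R d).
Local Notation V := 'I_(nvert M).
Implicit Types (e f g T : {set V}) (i : V) (c : V -> R) (a : d.+2.-tuple nat).
Hypothesis r_gt0 : (0 < r)%N.
Hypothesis elems_free :
  forall T, T \in elems M -> #|T| = d.+1 /\ row_free (vmx T).
Hypothesis conforming : forall T T', T \in elems M -> T' \in elems M -> T != T' ->
  (hull T `&` hull T')%classic = classical_sets.set0 \/
  exists f, [/\ f != finset.set0, f \proper T, f \proper T'
              & (hull T `&` hull T')%classic = hull f].
Variable iota : {set V} -> nat.
Hypothesis iota_inj : {in subsimplices M &, injective iota}.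

Lemma subsimplicesP g : reflect (g != finset.set0 /\ is_face g) (g \in subsimplices M).
Proof.
rewrite inE; apply: (iffP andP) => [[g0 /existsP[T /andP[TM gT]]]|[g0 [T TM gT]]].
  by split=> //; exists T.
by split=> //; apply/existsP; exists T; rewrite TM gT.
Qed.

Lemma hull_point f x : hull f x <->
  exists c, [/\ forall i, 0 <= c i, supported f c, \sum_i c i = 1 & x = point c].
Proof.
split=> [[c [c0 c1 ->]]|[c [c0 fc c1 ->]]].
  pose b i := if i \in f then c i else 0.
  have fb : supported f b by move=> i /negbTE fi; rewrite /b fi.
  have bE i : i \in f -> b i = c i by rewrite /b => ->.
  exists b; split=> // [i||]; first by rewrite /b; case: ifP.
    by rewrite (sum_supported fb) -c1; apply: eq_bigr => i /bE.
  rewrite /point (sum_supported (f := f)) => [|i /fb->]; last exact: scale0r.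
  by apply: eq_bigr => i /bE->.
exists c; split=> //; first by rewrite -(sum_supported fc).
by rewrite /point (sum_supported (f := f)) // => i /fc->; exact: scale0r.
Qed.

Lemma point_inj T c c' : is_face T -> supported T c -> supported T c' ->
  \sum_i c i = 1 -> \sum_i c' i = 1 -> point c = point c' -> c = c'.
Proof.
move=> fT Tc Tc' c1 c'1 E; apply/funext => i.
by rewrite -(bary_point elems_free fT Tc c1) E bary_point.
Qed.

Definition positive_on e c := supported e c /\ forall i, i \in e -> 0 < c i.

Lemma positive_on_ge0 e c i : positive_on e c -> 0 <= c i.
Proof.
by move=> [ec cp]; have [/cp/ltW//|/ec->] := boolP (i \in e).
Qed.

Lemma positive_on_sub e f c : positive_on e c -> supported f c -> e \subset f.
Proof.
move=> [_ cp] fc; apply/fintype.subsetP => i /cp; apply: contraTT => /fc->.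
by rewrite ltxx.
Qed.

(* By conformity both c and c' are supported in the common face h of T and T'. *)
Lemma point_relint_inj e g c c' : is_face e -> is_face g ->
    positive_on e c -> positive_on g c' ->
    \sum_i c i = 1 -> \sum_i c' i = 1 -> point c = point c' ->
  e = g.
Proof.
move=> [T TM eT] [T' T'M gT'] ec gc' c1 c'1 E.
have Tc := supported_sub eT ec.1; have T'c' := supported_sub gT' gc'.1.
suff cc' : c = c'.
  apply/eqP; rewrite finset.eqEsubset.
  rewrite (positive_on_sub ec (_ : supported g c)) ?cc'; last exact: gc'.1.
  by rewrite (positive_on_sub gc' (_ : supported e c')) // -cc'; exact: ec.1.
have hT : hull T (point c).
  by apply/hull_point; exists c; split=> // i; apply: positive_on_ge0 ec.
have hT' : hull T' (point c).
  by rewrite E; apply/hull_point; exists c'; split=> // i; apply: positive_on_ge0 gc'.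
have [TT'|TT'] := eqVneq T T'.
  by subst T'; apply: (point_inj (elems_face TM)).
case: (conforming TM T'M TT') => [h0|[h [h0 hpT hpT' hE]]].
  have : (hull T `&` hull T')%classic (point c) by [].
  by rewrite h0.
have : hull h (point c) by rewrite -hE.
move=> /hull_point[b [b_ge0 hb b1 bE]].
have cb : c = b.
  apply: (point_inj (elems_face TM)) => //.
  exact: supported_sub (proper_sub hpT) hb.
have c'b : c' = b.
  apply: (point_inj (elems_face T'M)) => //; last by rewrite -E.
  exact: supported_sub (proper_sub hpT') hb.
by rewrite cb c'b.
Qed.

Lemma card_face_le g : is_face g -> (#|g| <= d.+1)%N.
Proof.
move=> [T TM gT]; have [<- _] := elems_free TM; exact: fintype.subset_leq_card.
Qed.

Lemma sum_enum (W : nmodType) g (F : V -> W) :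
  \sum_(i in g) F i = \sum_(j < #|g|) F (enum_val j).
Proof. exact: big_enum_val. Qed.

Lemma lattice_spec a : lattice r iota a ->
  [/\ fsimp iota a != finset.set0, is_face (fsimp iota a),
      iota (fsimp iota a) = nth 0%N a d.+1 &
      [/\ forall j, (j < #|fsimp iota a|)%N -> (0 < nth 0%N a j)%N,
          (\sum_(j < #|fsimp iota a|) nth 0%N a j)%N = r &
          forall j, (#|fsimp iota a| <= j <= d)%N -> nth 0%N a j = 0%N]].
Proof.
move=> [m [g [[md gD ai] [pos sum zero]]]].
move: gD; rewrite inE => /andP[/eqP gm gT].
have gs : g \in subsimplices M by rewrite inE gT andbT -finset.card_gt0 gm.
have -> : fsimp iota a = g.
  rewrite /fsimp; case: pickP => [g' /andP[g's /eqP e]|/(_ g)] /=.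
    by apply: iota_inj => //; rewrite e.
  by rewrite gs ai eqxx.
have /subsimplicesP[g0 fg] := gs.
split=> //; rewrite gm; split=> [j||j]; first by rewrite ltnS => /pos.
  by rewrite -sum big_mkord.
by move=> /zero.
Qed.

Lemma index_enum_val g (j : 'I_#|g|) : index (enum_val j) (enum g) = j.
Proof.
by rewrite (enum_val_nth (enum_val j)) index_uniq ?enum_uniq // -cardE.
Qed.

Lemma multi_enum_val a (j : 'I_#|fsimp iota a|) :
  multi iota a (enum_val j) = nth 0%N a j.
Proof. by rewrite /multi enum_valP index_enum_val. Qed.

Lemma multi_gt0 a i : lattice r iota a -> (0 < multi iota a i)%N = (i \in fsimp iota a).
Proof.
move=> /lattice_spec[_ _ _ [pos _ _]]; rewrite /multi; case: ifP => // ia.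
by rewrite pos // cardE index_mem mem_enum.
Qed.

Lemma multi0 a i : i \notin fsimp iota a -> multi iota a i = 0%N.
Proof. by rewrite /multi => /negbTE->. Qed.

Lemma multi_sum_in a (f : {pred V}) : lattice r iota a ->
  {subset fsimp iota a <= f} -> (\sum_(i in f) multi iota a i)%N = r.
Proof.
move=> al sf; have [_ _ _ [_ <- _]] := lattice_spec al.
rewrite (bigID (mem (fsimp iota a))) /= [X in (_ + X)%N]big1 ?addn0; last first.
  by move=> i /andP[_ /multi0].
rewrite (eq_bigl (mem (fsimp iota a))) => [|i]; last first.
  by rewrite /= andbC; case: (boolP (i \in fsimp iota a)) => //= /(sf i)->.
by rewrite sum_enum; apply: eq_bigr => j _; rewrite multi_enum_val.
Qed.

Lemma multi_sum a : lattice r iota a -> (\sum_i multi iota a i)%N = r.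
Proof. by move=> al; rewrite -[RHS](multi_sum_in (f := predT) al). Qed.

(** The support of [multi] is [fsimp], which fixes the last entry through [iota] and the position of
    the zero padding. *)
Lemma lattice_inj a a' : lattice r iota a -> lattice r iota a' ->
  multi iota a =1 multi iota a' -> a = a'.
Proof.
move=> al a'l E.
have fE : fsimp iota a = fsimp iota a'.
  by apply/finset.setP => i; rewrite -multi_gt0 // E multi_gt0.
have [_ _ ai [_ _ az]] := lattice_spec al; have [_ fa' a'i [_ _ a'z]] := lattice_spec a'l.
apply/val_inj/(@eq_from_nth _ 0%N); rewrite !size_tuple // => j jd.
have [jg|gj] := ltnP j #|fsimp iota a|.
  have jg' : (j < #|fsimp iota a'|)%N by rewrite -fE.
  have := multi_enum_val (Ordinal jg') => /= <-; rewrite -E.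
  by rewrite /multi fE enum_valP index_enum_val.
move: jd; rewrite ltnS leq_eqVlt => /predU1P[->|jd]; first by rewrite -ai fE a'i.
by rewrite az ?a'z // ?gj -?fE ?gj -ltnS jd.
Qed.

Definition xpoint_coord a (i : V) : R := (multi iota a i)%:R / r%:R.

Lemma xpoint_coord_sum a : lattice r iota a -> \sum_i xpoint_coord a i = 1.
Proof.
move=> al; rewrite /xpoint_coord -mulr_suml -natr_sum multi_sum // divff //.
by rewrite pnatr_eq0 -lt0n.
Qed.

Lemma xpoint_coord_positive a : lattice r iota a ->
  positive_on (fsimp iota a) (xpoint_coord a).
Proof.
move=> al; split=> i; first by move=> ia; rewrite /xpoint_coord multi0 // mul0r.
by rewrite -multi_gt0 // => mi; rewrite /xpoint_coord divr_gt0 ?ltr0n.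
Qed.

Lemma xpoint_coordE a : xpoint r iota a = point (xpoint_coord a) :> 'rV[R]_d.
Proof.
rewrite /xpoint /point scaler_sumr; apply: eq_bigr => i _.
by rewrite scalerA mulrC.
Qed.

(** Conformity enters here: a point lies in the relative interior of only one face, so [e] must be
    the support of [a]. *)
Lemma relint_fsimp e a : is_face e -> lattice r iota a ->
  relint e (xpoint r iota a) -> e = fsimp iota a.
Proof.
move=> fe al [c [c0 c1]]; rewrite xpoint_coordE => E.
pose b i := if i \in e then c i else 0.
have bE i : i \in e -> b i = c i by rewrite /b => ->.
have be : positive_on e b.
  by split=> i; [move=> /negbTE ie; rewrite /b ie | move=> ie; rewrite bE].
have b1 : \sum_i b i = 1 by rewrite (sum_supported be.1) -c1; apply: eq_bigr => i /bE.
have bpt : point (xpoint_coord a) = point b.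
  rewrite E /point [RHS](sum_supported (f := e)) => [|i /be.1->]; last exact: scale0r.
  by apply: eq_bigr => i /bE->.
have [_ fa _ _] := lattice_spec al.
apply: (point_relint_inj fe fa be (xpoint_coord_positive al)) => //; exact: xpoint_coord_sum.
Qed.

Lemma fsimp_relint a : lattice r iota a -> relint (fsimp iota a) (xpoint r iota a).
Proof.
move=> al; have [lz lp] := xpoint_coord_positive al.
have lE : \sum_(i in fsimp iota a) xpoint_coord a i = 1.
  by rewrite -(sum_supported lz) xpoint_coord_sum.
exists (fun i => if i \in fsimp iota a then xpoint_coord a i else 1); split.
- by move=> i; case: ifP => // /lp.
- by rewrite -[RHS]lE; apply: eq_bigr => i ->.
rewrite xpoint_coordE /point (sum_supported (f := fsimp iota a)) => [|i /lz->];
  last exact: scale0r.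
by apply: eq_bigr => i ->.
Qed.

Lemma lattice_exists T (g : {ffun V -> 'I_r.+1}) : T \in elems M ->
    g \in multi_indices r T ->
  exists a, [/\ lattice r iota a, fsimp iota a \subset T & forall i, multi iota a i = g i].
Proof.
move=> TM /multi_indicesP[gs gz].
pose e := [set i | g i != ord0]%SET.
have ge i : (i \in e) = (0 < g i)%N by rewrite inE lt0n.
have eT : e \subset T.
  by apply/fintype.subsetP => i; rewrite inE; apply: contraR => /gz->.
have fe : is_face e by exists T.
have e0 : e != finset.set0.
  apply: contraTneq r_gt0 => e0; rewrite -gs big1 // => i _; apply/eqP.
  by rewrite -leqn0 leqNgt -ge e0 finset.in_set0.
have [v0 v0e] := finset.set0Pn _ e0.
(* The values on the support in the order of its enumeration, then zeros, then the number of the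
   support. *)
pose F j := if j == d.+1 then iota e else
  if (j < #|e|)%N then g (nth v0 (enum e) j) : nat else 0%N.
pose a : d.+2.-tuple nat := [tuple of mkseq F d.+2].
have aE j : (j < d.+2)%N -> nth 0%N a j = F j by move=> jd; rewrite nth_mkseq.
have cd := card_face_le fe.
have Fe (j : 'I_#|e|) : nth 0%N a j = g (enum_val j).
  have jd : (j < d.+1)%N by apply: leq_trans (ltn_ord j) cd.
  transitivity (F j); first exact: aE (ltnW jd).
  by rewrite /F (ltn_eqF jd) ltn_ord (enum_val_nth v0).
have eE : (\sum_(j < #|e|) nth 0%N a j)%N = r.
  rewrite -gs [RHS](bigID (mem e)) /= [X in (_ + X)%N]big1 ?addn0.
    by rewrite [RHS]big_enum_val; apply: eq_bigr => j _; rewrite Fe.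
  by move=> i; rewrite ge lt0n negbK => /eqP.
have al : lattice r iota a.
  exists #|e|.-1, e; rewrite prednK ?finset.card_gt0 //; split; split.
  - by rewrite -ltnS prednK ?finset.card_gt0.
  - rewrite inE prednK ?finset.card_gt0 // eqxx; apply/existsP; exists T.
    by rewrite TM eT.
  - by rewrite aE // /F eqxx.
  - move=> j; rewrite -ltnS prednK ?finset.card_gt0 // => je.
    by rewrite (Fe (Ordinal je)) -ge enum_valP.
  - by rewrite big_mkord.
  - move=> j /andP[ej jd]; rewrite aE ?ltnS ?(leq_trans jd) // /F ltn_eqF ?ltnS //.
    by rewrite ltnNge ej.
have fa : fsimp iota a = e.
  have [a0 fa ia _] := lattice_spec al.
  apply: iota_inj; [exact/subsimplicesP|exact/subsimplicesP|].
  by rewrite ia aE // /F eqxx.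
exists a; split=> // [|i]; first by rewrite fa.
have [ie|ie] := boolP (i \in e); last first.
  by rewrite multi0 ?fa //; move: ie; rewrite ge lt0n negbK => /eqP.
have := Fe (enum_rank_in ie i); rewrite enum_rankK_in // => <-.
by rewrite /multi fa ie -{1}(enum_rankK_in ie ie) index_enum_val.
Qed.

(** The products are extended to all mesh vertices, so the right-hand side is free of [T]: Lagrange
    functions agree on common faces. *)
Lemma lagrange_at a T c : lattice r iota a -> T \in elems M ->
    fsimp iota a \subset T -> supported T c -> \sum_i c i = 1 ->
  lagrange_basis r iota a T (point c) =
  (\prod_i (multi iota a i)`!%:R)^-1 *
    \prod_i \prod_(0 <= j < multi iota a i) (r%:R * c i - j%:R).
Proof.
move=> al TM aT Tc c1; rewrite /lagrange_basis aT.
have aT' i : i \notin T -> multi iota a i = 0%N.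
  by move=> iT; apply: multi0; apply: contra iT; apply: fintype.subsetP.
congr (_^-1 * _).
  rewrite natr_prod [RHS](bigID (mem T)) /= [X in _ = _ * X]big1 ?mulr1 //.
  by move=> i /aT'->.
rewrite [RHS](bigID (mem T)) /= [X in _ = _ * X]big1 ?mulr1 => [|i /aT'->]; last first.
  by rewrite big_nil.
apply: eq_bigr => i _; apply: eq_bigr => j _.
by rewrite (bary_point elems_free (elems_face TM) Tc c1).
Qed.

Lemma lagrange_neq0 a T : lattice r iota a -> T \in elems M ->
  fsimp iota a \subset T -> lagrange_basis r iota a T (xpoint r iota a) != 0 :> R.
Proof.
move=> al TM aT; have [lz _] := xpoint_coord_positive al.
rewrite xpoint_coordE lagrange_at ?xpoint_coord_sum //; last exact: supported_sub lz.
have r0 : r%:R != 0 :> R by rewrite pnatr_eq0 -lt0n.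
rewrite mulf_neq0 ?invr_eq0 //.
  by apply/prodf_neq0 => i _; rewrite pnatr_eq0 -lt0n fact_gt0.
apply/prodf_neq0 => i _; rewrite /xpoint_coord mulrCA divff // mulr1 prod_ffact.
by rewrite ffactnn pnatr_eq0 -lt0n fact_gt0.
Qed.

Lemma lagrange_eq0 a a' T : lattice r iota a -> lattice r iota a' ->
  T \in elems M -> fsimp iota a' \subset T -> a <> a' ->
  lagrange_basis r iota a T (xpoint r iota a') = 0 :> R.
Proof.
move=> al a'l TM a'T ne.
have [aT|aT] := boolP (fsimp iota a \subset T); last first.
  by rewrite /lagrange_basis (negbTE aT).
have [lz _] := xpoint_coord_positive a'l.
rewrite xpoint_coordE lagrange_at ?xpoint_coord_sum //; last exact: supported_sub lz.
have r0 : r%:R != 0 :> R by rewrite pnatr_eq0 -lt0n.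
rewrite [X in _ * X](_ : _ = 0) ?mulr0 //.
transitivity (\prod_(i in predT) (multi iota a' i ^_ multi iota a i)%:R : R).
  by apply: eq_bigr => i _; rewrite /xpoint_coord mulrCA divff // mulr1 prod_ffact.
have sumE b : lattice r iota b -> (\sum_(i in predT) multi iota b i)%N = r.
  by move=> bl; apply: multi_sum_in.
apply: prod_ffact_eq0; first exact: etrans (sumE _ a'l) (esym (sumE _ al)).
apply: contrapT => H; apply: ne; apply: lattice_inj => // i.
by apply: contrapT => nei; apply: H; exists i => // /esym.
Qed.

(** The factor [j = 0] at the vertex [i] is a multiple of the weight [c i], which is 0. *)
Lemma lagrange_outside a T f c i : lattice r iota a -> T \in elems M ->
    f \subset T -> supported f c -> \sum_i c i = 1 ->
    i \in fsimp iota a -> i \notin f ->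
  lagrange_basis r iota a T (point c) = 0.
Proof.
move=> al TM fT fc c1 ia iF.
have [aT|aT] := boolP (fsimp iota a \subset T); last first.
  by rewrite /lagrange_basis (negbTE aT).
rewrite lagrange_at //; last exact: supported_sub fc.
rewrite [X in _ * X](bigD1 i) //= fc //; move: ia; rewrite -multi_gt0 // => ia.
by rewrite (big_ltn ia) mulr0 subrr !mul0r mulr0.
Qed.

Lemma lagrange_poly_le a T : lattice r iota a -> T \in elems M ->
  poly_le r%:Z (lagrange_basis r iota a T : 'rV[R]_d -> R).
Proof.
move=> al TM; rewrite /lagrange_basis.
have [aT|aT] := boolP (fsimp iota a \subset T); last first.
  by apply/poly_leP; exists (fun=> 0); [apply: Pol0|].
apply: poly_leZ; apply/poly_leP.
exists (fun y => \prod_(i in T) \prod_(0 <= j < multi iota a i)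
    (r%:R * bary T i (\row_l y l) - j%:R)) => [|x]; last first.
  apply: eq_bigr => i _; apply: eq_bigr => j _; congr (_ * bary T i _ - _).
  by apply/rowP => l; rewrite mxE.
rewrite -[X in leq^~ X](multi_sum_in (f := T) al (fintype.subsetP aT)).
apply: (Pol_prod (D := fun n => leq^~ n)) => [//|m n h h'|i _]; first exact: leq_add.
have E : (\sum_(0 <= j < multi iota a i) 1)%N = multi iota a i.
  by rewrite sum_nat_const_nat subn0 muln1.
rewrite -[X in leq^~ X]E; apply: (Pol_prod (D := fun n => leq^~ n)) => [//|m n h h'|j _].
  exact: leq_add.
by apply: PolB; [apply: PolZ; apply: Pol_bary | apply: Pol_const].
Qed.

(** * The index set of the degrees of freedom *)

Section DofIndices.
Variable k : nat.
Implicit Type x : dof_index M k.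

(** The position of the interpolation point becomes [fsimp = ie], and the ranges of the two
    dimensions become the degree equation of [test_label]. *)
Lemma dof_indicesP x : dof_indices r iota x <->
  [/\ is_face (iface x), ie x \subset iface x, ie x != finset.set0,
      lattice r iota (ialpha x) & fsimp iota (ialpha x) = ie x] /\
  (sdeg k (ie x) (iface x) + #|(iface x :\: ie x)%SET|)%N = k /\
  increasing (isigma x).
Proof.
case: x => a e f s /=; split.
  move=> [l [m [/= [kl fl ms es] [al [xe _] s_inc]]]].
  move: fl; rewrite inE => /andP[/eqP fl /existsP[T /andP[TM fT]]].
  move: es; rewrite inE => /andP[/eqP em ef].
  have e0 : e != finset.set0 by rewrite -finset.card_gt0 em.
  have ff : is_face f by exists T.
  split; first by split=> //; rewrite -(relint_fsimp (is_face_sub ef ff) al xe).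
  split=> //; apply: test_degree => //.
  by rewrite /sdim fl em /=; move/andP: ms => [].
move=> [[ff ef e0 al fa] [E s_inc]].
have [kf fe] := test_range E ef e0 s_inc.
have f0 : f != finset.set0.
  by apply: contraNneq e0 => f0; rewrite -finset.subset0 -f0.
exists (sdim f), (sdim e); split; split=> //=.
- by rewrite kf -ltnS -sdim_card // card_face_le.
- have [T TM fT] := ff; rewrite inE sdim_card // eqxx; apply/existsP; exists T.
  by rewrite TM fT.
- by rewrite fe sdimS.
- by rewrite inE sdim_card // eqxx.
- by split; [rewrite -fa; exact: fsimp_relint | exists a].
Qed.

(** Finiteness, needed to expand an arbitrary form. The entries of a lattice index are at most [r],
    except the last, which is a value of [iota]; [B] bounds both. *)
Lemma dof_indices_seq : exists2 s : seq (dof_index M k), uniq s &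
  forall x, (x \in s) <-> dof_indices r iota x.
Proof.
pose B := (r + \max_g iota g)%N.
pose all_idx : seq (dof_index M k) :=
  flatten [seq flatten [seq flatten [seq
    [seq DofIndex (map_tuple val b) s | s <- enum {: {ffun 'I_(sdeg k e f) -> 'I_(sdim e)}}]
    | f <- enum {: {set V}}] | e <- enum {: {set V}}]
    | b <- enum {: d.+2.-tuple 'I_B.+1}].
exists (undup [seq x <- all_idx | `[< dof_indices r iota x >]]); first exact: undup_uniq.
move=> x; rewrite mem_undup mem_filter; split=> [/andP[/asboolP]//|xI].
apply/andP; split; first exact/asboolP.
have [[_ _ _ al _] _] := (dof_indicesP x).1 xI.
have [_ _ ai [_ asum az]] := lattice_spec al.
case: x xI al ai asum az => a e f s /= xI al ai asum az.
have aB j : (nth 0%N a j < B.+1)%N.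
  rewrite ltnS /B; have [jg|gj] := ltnP j #|fsimp iota a|.
    apply: leq_trans (leq_addr _ _).
    by rewrite -[X in (_ <= X)%N]asum (bigD1 (Ordinal jg)) //= leq_addr.
  have [jd|] := leqP j d; first by rewrite az ?gj.
  rewrite leq_eqVlt => /predU1P[<-|jd].
    by rewrite -ai; apply: leq_trans (leq_addl _ _); apply: leq_bigmax.
  by rewrite nth_default // size_tuple.
apply/flatten_mapP; exists (map_tuple inord a); first by rewrite mem_enum.
apply/flatten_mapP; exists e; first by rewrite mem_enum.
apply/flatten_mapP; exists f; first by rewrite mem_enum.
apply/mapP; exists s; first by rewrite mem_enum.
suff -> : map_tuple val (map_tuple (@inord B) a) = a by [].
by apply: eq_from_tnth => j; rewrite !tnth_map (tnth_nth 0%N); apply: inordK.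
Qed.

End DofIndices.

End LatticeIndices.

(** * Unisolvence and duality *)

Section Basis.
Variables (R : realType) (d r k : nat) (M : mesh R d).
Local Notation V := 'I_(nvert M).
Implicit Types (e f g : {set V}) (i j : V) (c : V -> R).
Hypothesis r_gt0 : (0 < r)%N.
Hypothesis elems_free :
  forall T, T \in elems M -> #|T| = d.+1 /\ row_free (vmx T).
Hypothesis conforming : forall T T', T \in elems M -> T' \in elems M -> T != T' ->
  (hull T `&` hull T')%classic = classical_sets.set0 \/
  exists f, [/\ f != finset.set0, f \proper T, f \proper T'
              & (hull T `&` hull T')%classic = hull f].
Variable t : forall e : {set V}, 'M[R]_(sdim e, d).
Hypothesis t_orth : forall e, is_face e -> e != finset.set0 ->
  t e *m (t e)^T = 1%:M.
Hypothesis t_tan : forall e, is_face e -> e != finset.set0 ->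
  (t e :=: tangent e)%MS.
Hypothesis gram : forall e, is_face e -> e != finset.set0 ->
  0 < \det (edges e *m (edges e)^T).
Variable iota : {set V} -> nat.
Hypothesis iota_inj : {in subsimplices M &, injective iota}.
Notation pwform := (element M -> 'rV[R]_d -> 'M[R]_(k, d) -> R).
Implicit Types (w : pwform) (T : element M) (x y : dof_index M k).

Let indexP x := dof_indicesP r_gt0 elems_free conforming iota_inj x.
Let traceP w := PLambda_traceP r_gt0 elems_free t_orth t_tan gram w.

Lemma single_valued_dof : single_valued r k t iota.
Proof.
move=> w x /traceP[wp wt] /indexP[[ff ef e0 al fa] [E s_inc]] T T' fT fT'.
have f0 : iface x != finset.set0.
  by apply: contraNneq e0 => f0; rewrite -finset.subset0 -f0.
have [c c0 cE] := ip_test_label t E.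
rewrite /dof_on !cE; [|by have [+ _] := wp T'; apply|by have [+ _] := wp T; apply].
have lp := xpoint_coord_positive r_gt0 iota_inj al.
congr (_ * _); rewrite xpoint_coordE; apply: (wt (iface x)) => //.
- by move=> i; apply: positive_on_ge0 lp.
- by apply: supported_sub ef _; rewrite -fa; have [] := lp.
- exact: (xpoint_coord_sum r_gt0 iota_inj).
- exact: (test_label_tangent t_tan).
Qed.

Lemma dofE w x T : PLambda r t w -> dof_indices r iota x -> iface x \subset val T ->
  dof r t iota x w = dof_on r t iota x (w T).
Proof.
move=> wP xI fT; rewrite /dof; case: pickP => [T' fT'|/(_ T)]; last by rewrite fT.
exact: single_valued_dof.
Qed.

Lemma element_neq0 T : val T != finset.set0.
Proof.
have [Td _] := elems_free (valP T).
by rewrite -finset.card_gt0 (eqP (introT eqP Td)).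
Qed.

Lemma tangent_element T (A : 'M[R]_(k, d)) : (A <= tangent (val T))%MS.
Proof.
have fT := elems_face (valP T); have T0 := element_neq0 T.
rewrite -t_tan //; apply: submx_full.
have : row_free (t (val T)) by apply/row_freeP; exists (t (val T))^T; exact: t_orth.
rewrite /row_free /row_full => /eqP->.
have [Td _] := elems_free (valP T).
by rewrite /sdim (eqP (introT eqP Td)).
Qed.

Lemma bary_supported f z : supported f (fun i => bary f i z).
Proof.
move=> i fi; rewrite /bary big1 // => l /eqP il.
by move: fi; rewrite -il enum_valP.
Qed.

Lemma bary_element T z :
  \sum_i bary (val T) i z = 1 /\ point (fun i => bary (val T) i z) = z.
Proof.
have [Td Tfree] := elems_free (valP T); set S := val T in Td Tfree *.
have Sfull : row_full (vmx S).
  by move: Tfree; rewrite /row_free /row_full => /eqP->; rewrite addn1; apply/eqP.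
set u := row_mx z (1%:M : 'M[R]_1) *m pinvmx (vmx S).
have uE : u *m vmx S = row_mx z 1%:M by rewrite mulmxKpV // submx_full.
have bE (l : 'I_#|S|) : bary S (enum_val l) z = u 0 l.
  rewrite /bary (bigD1 l) //= big1 ?addr0 // => l' /andP[/eqP/enum_val_inj->].
  by rewrite eqxx.
move: uE; rewrite mul_vmx => /eq_row_mx[uz u1]; split.
  rewrite (sum_supported (@bary_supported S z)) [LHS]big_enum_val.
  move: u1 => /matrixP/(_ 0 0); rewrite !mxE !mulr1n => <-.
  by apply: eq_bigr => l _; rewrite bE.
rewrite /point (sum_supported (f := S)) => [|i /bary_supported->]; last exact: scale0r.
by rewrite -[RHS]uz [LHS]big_enum_val; apply: eq_bigr => l _; rewrite bE.
Qed.

Lemma unisolvent_dof : unisolvent r k t iota.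
Proof.
move=> w w' wP w'P ww'; have [wp _] := (traceP w).1 wP; have [w'p _] := (traceP w').1 w'P.
have w_alt T z : alternating (w T z) by have [+ _] := wp T; apply.
have w'_alt T z : alternating (w' T z) by have [+ _] := w'p T; apply.
apply/funext => T; have TM := valP T.
have lat (g : {ffun V -> 'I_r.+1}) : g \in multi_indices r (val T) -> forall A,
    w T (point (lattice_pt R g)) A - w' T (point (lattice_pt R g)) A = 0.
  move=> /(lattice_exists r_gt0 elems_free iota_inj TM)[a [al aT ag]] A.
  have [e0 fe _ _] := lattice_spec iota_inj al; set e := fsimp iota a in aT e0 fe *.
  have gE : point (lattice_pt R g) = xpoint r iota a.
    rewrite xpoint_coordE; congr point; apply/funext => i.
    by rewrite /lattice_pt /xpoint_coord ag.
  rewrite gE; have := tangent_element T A; move: A.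
  (* With the whole element as the larger face, every face between [e] and the element supplies a
     degree of freedom at this point. *)
  apply: (alt_vanish_tangent elems_free t_orth t_tan
    (alternating_sub (w_alt T _) (w'_alt T _)) aT (elems_face TM) e0).
  move=> f s E ef fT s_inc; pose x : dof_index M k := DofIndex a s.
  have xI : dof_indices r iota x.
    by apply/indexP; split=> //; split=> //; exists (val T).
  have [c c0 cE] := ip_test_label t E.
  have := ww' x xI; rewrite !(dofE (T := T)) // /dof_on !cE //=.
  by move/(mulfI c0)->; rewrite subrr.
apply/funext => z; apply/funext => A.
apply/eqP; rewrite -subr_eq0; apply/eqP.
have pP : poly_le r%:Z (fun z => w T z A - w' T z A).
  by apply: poly_leB; apply: poly_form_eval.
have [F FP FE] := poly_le_point M pP.
(* Every [z], inside the element or not, has barycentric coordinates of sum 1, so the polynomial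
   extensions agree on the whole space. *)
have [b1 bz] := bary_element T z.
rewrite -bz FE //; apply: (hom_lattice_vanish r_gt0 FP _ (@bary_supported (val T) z)).
move=> g gT; rewrite -FE ?lat //.
have [gs _] := multi_indicesP _ _ gT.
by rewrite /lattice_pt -mulr_suml -natr_sum gs divff // pnatr_eq0 -lt0n.
Qed.

Lemma dual_formE x : (sdeg k (ie x) (iface x) + #|(iface x :\: ie x)%SET|)%N = k ->
  exists (E : (sdeg k (ie x) (iface x) + #|(iface x :\: ie x)%SET|)%N = k) (c : R),
  c != 0 /\ forall T z, iface x \subset val T ->
  dual_form r t iota x T z = fun A => lagrange_basis r iota (ialpha x) (val T) z *
    (c * \det (A *m (tag_rows (@frame_vec R d M t (bary_lin (val T)) (ie x))
                       (test_label (isigma x) E))^T)).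
Proof.
move=> E; have [c c0 cE] := wedge_test_label t E; exists E, c; split=> // T z fT.
apply/funext => A; rewrite /dual_form fT -(congr1 (fun h => h A) (cE _ _)).
congr (_ * as_degree (wedge _ (wedges _)) A); apply/funext => l.
by rewrite grad_bary trmx1 !mulmx1.
Qed.

Lemma dual_form_alt x T z : dof_indices r iota x -> alternating (dual_form r t iota x T z).
Proof.
move=> /indexP[_ [/dual_formE[E [c [c0 cE]]] _]].
have [fT|fT] := boolP (iface x \subset val T); last first.
  by rewrite /dual_form (negbTE fT); split=> *; rewrite ?mulr0 ?addr0.
rewrite cE //; apply: alternating_scale; apply: alternating_scale.
exact: alternating_det.
Qed.

(** A vertex of [iface x] is missing from [f]. If it lies in [ie x], the Lagrange function vanishes
    on [f]; otherwise its barycentric gradient vanishes on the tangent space of [f] and the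
    determinant has a zero column. *)
Lemma dual_form_trace x f T c A : dof_indices r iota x ->
    f \subset val T -> supported f c -> \sum_i c i = 1 ->
    (A <= tangent f)%MS -> ~~ (iface x \subset f) ->
  dual_form r t iota x T (point c) A = 0.
Proof.
move=> xI fT fc c1 Af xf.
have /indexP[[ff ef e0 al fa] [/dual_formE[E [b [b0 bE]]] s_inc]] := xI.
have [xT|xT] := boolP (iface x \subset val T); last by rewrite /dual_form (negbTE xT).
have /fintype.subsetPn[v vx vf] := xf; rewrite bE //.
have [ve|ve] := boolP (v \in ie x).
  by rewrite (lagrange_outside elems_free iota_inj al (valP T) fT fc c1 (i := v)) ?mul0r ?fa.
have vxe : v \in (iface x :\: ie x)%SET by rewrite finset.in_setD ve.
pose l := cast_ord E (rshift _ (enum_rank_in vxe v)).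
rewrite (expand_det_col _ l) big1 ?mulr0 // => y _.
rewrite mulmx_trE rowK /test_label /l cast_ordK (unsplitK (inr _ _)) /=.
rewrite enum_rankK_in //.
have fT' := elems_face (valP T); have ffT := is_face_sub fT fT'.
rewrite (_ : dot _ _ = 0) ?mul0r //.
have yf := submx_trans (row_sub y A) Af.
apply: (tangent_dot yf) => p q pf qf.
rewrite (dot_bary_lin elems_free) //; [|exact: (fintype.subsetP fT)..].
have -> : (v == p) = false by apply: contraNF vf => /eqP->.
have -> : (v == q) = false by apply: contraNF vf => /eqP->.
exact: subrr.
Qed.

(** If [iface x] lies in [f], the Lagrange factor and the products of the gradients with tangent
    vectors of [f] depend on [f] alone. Otherwise both traces are 0, also when [iface x] lies in
    just one of the two elements. *)
Lemma dual_form_PLambda x : dof_indices r iota x -> PLambda r t (dual_form r t iota x).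
Proof.
move=> xI; have /indexP[[ff ef e0 al fa] [EE s_inc]] := xI.
have [E [b [b0 bE]]] := dual_formE EE.
apply/traceP; split=> [T|f T T' f0 fT fT' c c_ge0 fc c1 A Af].
  split=> [z|s _]; first exact: dual_form_alt.
  have [fT|fT] := boolP (iface x \subset val T); last first.
    rewrite /dual_form (negbTE fT).
    by apply/poly_leP; exists (fun=> 0); [apply: Pol0|].
  set D := b * \det (rowsub s 1%:M *m (tag_rows (@frame_vec R d M t
    (bary_lin (val T)) (ie x)) (test_label (isigma x) E))^T).
  have -> : (fun z => dual_form r t iota x T z (rowsub s 1%:M)) =
      fun z => D * lagrange_basis r iota (ialpha x) (val T) z.
    by apply/funext => z; rewrite bE // mulrC.
  by apply: poly_leZ; apply: lagrange_poly_le => //; apply: valP.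
have [xf|xf] := boolP (iface x \subset f); last by rewrite !(dual_form_trace (f := f)).
have xT := fintype.subset_trans xf fT; have xT' := fintype.subset_trans xf fT'.
rewrite !bE //=; congr (_ * _); last congr (_ * \det _).
  rewrite !(lagrange_at elems_free al) ?(valP T) ?(valP T') ?fa //.
  - exact: fintype.subset_trans ef xT'.
  - exact: supported_sub fT' fc.
  - exact: fintype.subset_trans ef xT.
  - exact: supported_sub fT fc.
apply/matrixP => p q; rewrite !mulmx_trE !rowK /test_label.
case: split_ordP => l _ //=.
have fe := elems_face (valP T); have fe' := elems_face (valP T').
have fff := is_face_sub fT fe.
have pf := submx_trans (row_sub p A) Af.
by rewrite !(tangent_dot_bary elems_free (g := f)).
Qed.

Lemma test_label_inr e f (s : {ffun 'I_(sdeg k e f) -> 'I_(sdim e)}) E j :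
  (exists p, test_label s E p = inr j) <-> j \in (f :\: e)%SET.
Proof.
split=> [[p]|jf].
  by rewrite /test_label; case: split_ordP => q _ // [<-]; apply: enum_valP.
exists (cast_ord E (rshift _ (enum_rank_in jf j))).
by rewrite /test_label cast_ordK (unsplitK (inr _ _)) enum_rankK_in.
Qed.

Lemma test_label_inl e f (s : {ffun 'I_(sdeg k e f) -> 'I_(sdim e)}) E (i : 'I_(sdim e)) :
  (exists p, test_label s E p = inl i) <-> exists z, s z = i.
Proof.
split=> [[p]|[z <-]].
  by rewrite /test_label; case: split_ordP => q _ // [<-]; exists q.
by exists (cast_ord E (lshift _ z)); rewrite /test_label cast_ordK (unsplitK (inl _ _)).
Qed.

Lemma DofIndex_inj a e f : injective (@DofIndex R d M k a e f).
Proof.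
move=> s s' /(congr1 (@dof_index_encode R d M k))/eqP.
by rewrite -tag_eqE /tag_eq /= eqxx tagged_asE => /eqP.
Qed.

(** An entry vanishes exactly when its two labels differ. A label of [sx] not occurring for [sy]
    gives a zero row. If the label sets agree, so do the faces and the increasing maps, and the
    matrix is diagonal with nonzero entries. The index [a] is arbitrary: it packs face and map into
    one comparison, as the type of the map depends on the face. *)
Lemma pairing_det e fx fy T a
    (sx : {ffun 'I_(sdeg k e fx) -> 'I_(sdim e)})
    (sy : {ffun 'I_(sdeg k e fy) -> 'I_(sdim e)}) Ex Ey :
    e != finset.set0 -> e \subset fx -> e \subset fy ->
    fx \subset val T -> fy \subset val T -> increasing sx -> increasing sy ->
  (\det (tag_rows (@frame_vec R d M t (normal t e) e) (test_label sx Ex) *m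
     (tag_rows (@frame_vec R d M t (bary_lin (val T)) e) (test_label sy Ey))^T) == 0)
  = (DofIndex a sx != DofIndex a sy).
Proof.
move=> e0 ex ey xT yT incx incy; have fT := elems_face (valP T).
pose lx := test_label sx Ex; pose ly := test_label sy Ey.
have lab f (s : {ffun 'I_(sdeg k e f) -> 'I_(sdim e)}) E p j :
    f \subset val T -> test_label s E p = inr j -> j \in (val T :\: e)%SET.
  move=> fT' lp; have /(fintype.subsetP (finset.setSD e fT')) // : j \in (f :\: e)%SET.
  by apply/(test_label_inr s E); exists p.
have entry p q : (dot (frame_vec t (normal t e) (lx p))
    (frame_vec t (bary_lin (val T)) (ly q)) == 0) = (lx p != ly q).
  apply: (label_pairing elems_free t_orth t_tan) => //.
  - exact: fintype.subset_trans ex xT.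
  - by move=> j; apply: lab.
  - by move=> j; apply: lab.
have lx_inj : injective lx by apply: test_label_inj.
have [same|diff] := pselect (forall p, exists q, lx p = ly q); last first.
  have [p pP] : exists p, forall q, lx p != ly q.
    apply: contrapT => H; apply: diff => p; apply: contrapT => H'; apply: H.
    by exists p => q; apply/eqP => E; apply: H'; exists q.
  rewrite (expand_det_row _ p) big1 ?eqxx => [|q _]; last first.
    rewrite mulmx_trE !rowK; have := entry p q; rewrite pP => /eqP->.
    by rewrite mul0r.
  apply/esym; apply: contraT; rewrite negbK => /eqP Exy; case: diff => q.
  have fxy : fx = fy := congr1 (@iface R d M k) Exy.
  subst fy; move/DofIndex_inj in Exy; subst sy.
  by exists q; rewrite /lx /ly (eq_irrelevance Ex Ey).
have [s lxy] := tuple_perm lx_inj same.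
have lyx q : ly q = lx (s^-1%g q) by rewrite lxy /= permKV.
have fxy : fx = fy.
  apply/finset.setP => j; have [je|je] := boolP (j \in e).
    by rewrite (fintype.subsetP ex) ?(fintype.subsetP ey).
  have E f : (j \in f) = (j \in (f :\: e)%SET) by rewrite finset.in_setD je.
  rewrite (E fx) (E fy); apply/idP/idP.
    move=> /(test_label_inr sx Ex)[p lp]; apply/(test_label_inr sy Ey).
    by exists (s p); rewrite -lp; exact/esym/lxy.
  move=> /(test_label_inr sy Ey)[p lp]; apply/(test_label_inr sx Ex).
  by exists (s^-1%g p); rewrite -lp; exact/esym/lyx.
subst fy; have sxy : sx = sy.
  apply: increasing_eq => // z.
  have [|q lq] := (test_label_inl sx Ex (sx z)).2; first by exists z.
  have [|z' sz'] := (test_label_inl sy Ey (sx z)).1; last by exists z'.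
  by exists (s q); rewrite -lq; exact/esym/lxy.
subst sy; rewrite eqxx /=; apply/negbTE.
set N := (_ *m _); have NE p q : N p q = if p == q then N p p else 0.
  case: eqVneq => [->//|pq]; rewrite /N mulmx_trE !rowK.
  apply/eqP; have := entry p q; rewrite /ly (eq_irrelevance Ey Ex) => ->.
  by rewrite -/lx (inj_eq lx_inj).
have -> : N = diag_mx (\row_p N p p).
  by apply/matrixP => p q; rewrite [LHS]NE !mxE; case: eqP.
rewrite det_diag; apply/prodf_neq0 => p _; rewrite mxE /N mulmx_trE !rowK.
have := entry p p; rewrite /ly (eq_irrelevance Ey Ex) => ->.
by rewrite -/lx eqxx.
Qed.

Lemma dof_dual_form_pairing x y T : dof_indices r iota x -> dof_indices r iota y ->
    iface x \subset val T -> iface y \subset val T ->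
  (dof_on r t iota x (dual_form r t iota y T) == 0) = (x != y).
Proof.
move=> xI yI xT yT.
have /indexP[[ffx efx e0x alx fax] [Ex s_incx]] := xI.
have /indexP[[ffy efy e0y aly fay] [Ey s_incy]] := yI.
have [b [b0 bE]] := ip_test_label t Ex.
have {Ey}[Ey [a [a0 aE]]] := dual_formE Ey.
rewrite /dof_on bE; last exact: dual_form_alt.
rewrite aE // !mulf_eq0 (negbTE b0) (negbTE a0) /=.
have exT := fintype.subset_trans efx xT.
have [axy|axy] := eqVneq (ialpha x) (ialpha y); last first.
  rewrite (lagrange_eq0 r_gt0 elems_free iota_inj aly alx (valP T)) ?fax //; last first.
    by move=> E; rewrite E eqxx in axy.
  by rewrite eqxx; apply/esym; apply: contra_neq axy => ->.
rewrite axy (negbTE (lagrange_neq0 r_gt0 elems_free iota_inj aly (valP T) _)) /=; last first.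
  by rewrite -axy fax.
(* The subface is the support of the lattice index, so equal lattice indices reduce the pairing to a
   determinant with a common [e]. *)
have exy : ie x = ie y by rewrite -fax axy.
clear xI yI ffx alx fax ffy e0y aly fay bE aE exT.
move: axy exy Ex s_incx efx e0x xT.
case: x => ax e fx sx; case: y Ey s_incy efy yT => ay e' fy sy /=.
move=> Ey s_incy efy yT axy exy; subst ay e' => Ex s_incx efx e0 xT.
exact: pairing_det.
Qed.

Lemma dof_dual_form x y : dof_indices r iota x -> dof_indices r iota y ->
  dof r t iota x (dual_form r t iota y) =
  dof r t iota x (dual_form r t iota x) * (x == y)%:R.
Proof.
move=> xI yI; have [->|xy] := eqVneq x y; first by rewrite mulr1.
rewrite mulr0 /dof; case: pickP => // T xT.
have [yT|yT] := boolP (iface y \subset val T).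
  by apply/eqP; rewrite dof_dual_form_pairing.
rewrite /dof_on (_ : dual_form _ _ _ _ _ _ = 0); last by rewrite /dual_form (negbTE yT).
by rewrite /ip big1 // => s _; apply: mul0r.
Qed.

Lemma dof_dual_form_neq0 x : dof_indices r iota x ->
  dof r t iota x (dual_form r t iota x) != 0.
Proof.
move=> xI; have /indexP[[[S SM xS] _ _ _ _] _] := xI.
rewrite /dof; case: pickP => [T xT|/(_ (exist _ S SM))]; last by rewrite xS.
by rewrite dof_dual_form_pairing // eqxx.
Qed.

Lemma dof_lin x (a : R) w w' :
  dof r t iota x (a *: w + w') = a * dof r t iota x w + dof r t iota x w'.
Proof.
rewrite /dof; case: pickP => [T _|_]; last by rewrite mulr0 addr0.
rewrite /dof_on /ip mulr_sumr -big_split; apply: eq_bigr => s _ /=.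
by rewrite mulrA -mulrDl.
Qed.

Lemma dof0 x : dof r t iota x (0 : pwform) = 0.
Proof.
rewrite /dof; case: pickP => // T _.
by rewrite /dof_on /ip big1 // => s _; apply: mul0r.
Qed.

Lemma dof_sum x (s : seq (dof_index M k)) (c : dof_index M k -> R) :
    uniq s -> {in s, forall y, dof_indices r iota y} -> dof_indices r iota x ->
  dof r t iota x (\sum_(y <- s) c y *: dual_form r t iota y) =
  if x \in s then c x * dof r t iota x (dual_form r t iota x) else 0.
Proof.
move=> s_uniq sI xI.
transitivity (\sum_(y <- s) c y * dof r t iota x (dual_form r t iota y)).
  elim: s {s_uniq sI} => [|y s IHs]; first by rewrite !big_nil dof0.
  by rewrite !big_cons dof_lin IHs.
transitivity (\sum_(y <- s | y == x) c y * dof r t iota x (dual_form r t iota x)).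
  rewrite [RHS]big_mkcond [LHS]big_seq [RHS]big_seq; apply: eq_bigr => y ys.
  rewrite dof_dual_form //; last exact: sI.
  by rewrite eq_sym; case: eqP => [->|_]; rewrite ?mulr1 ?mulr0.
case: ifP => xs; last first.
  by rewrite big_seq_cond big1 // => y /andP[ys /eqP yx]; rewrite -yx ys in xs.
by rewrite (big_rem x) //= eqxx big_seq_cond big1 ?addr0 // => y /andP[];
  rewrite mem_rem_uniq // inE => /andP[/negbTE->].
Qed.

(** Duality gives independence. Spanning comes from unisolvence: a form and its candidate expansion
    have the same degrees of freedom. *)
Lemma dual_basis : scaled_dual_basis (PLambda r t) (dof_indices r iota)
  (dual_form (k := k) r t iota) (dof r t iota).
Proof.
split; last first.
  exists (fun x => dof r t iota x (dual_form r t iota x)); split.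
    exact: dof_dual_form_neq0.
  exact: dof_dual_form.
split=> [x|s c s_uniq sI sum0 x xs|w wP]; first exact: dual_form_PLambda.
  have xI := sI x xs; have := dof_sum c s_uniq sI xI.
  rewrite sum0 dof0 xs => /esym/eqP; rewrite mulf_eq0.
  by rewrite (negbTE (dof_dual_form_neq0 xI)) orbF => /eqP.
have [s s_uniq sP] := dof_indices_seq r_gt0 elems_free conforming iota_inj k.
have sI : {in s, forall x, dof_indices r iota x} by move=> x /sP.
pose c x := dof r t iota x w / dof r t iota x (dual_form r t iota x).
exists s, c; split=> //; apply: unisolvent_dof => //.
  suff PL s' : {subset s' <= s} ->
    PLambda r t (\sum_(x <- s') c x *: dual_form r t iota x) by exact: PL.
  elim: s' => [_|x s' IHs ss].
    have P0 := @PLambda0 R d r k M r_gt0 elems_free t t_orth t_tan gram.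
    rewrite big_nil; exact: P0.
  rewrite big_cons; apply: (PLambda_lin r_gt0 elems_free t_orth t_tan gram).
    by apply: dual_form_PLambda; apply: sI; apply: ss; rewrite mem_head.
  by apply: IHs => y ys; apply: ss; rewrite inE ys orbT.
move=> x xI; rewrite dof_sum // (sP x).2 // /c divfK //.
exact: dof_dual_form_neq0.
Qed.

End Basis.

Theorem theorem5p14 (R : realType) (d r k : nat)
    (hd : (2 <= d)%N) (hr : (1 <= r)%N) (hk : (0 <= k <= d)%N)
    (Omega : set 'rV[R]_d) (hOmega : bounded_Lipschitz_polyhedral_domain Omega)
    (M : mesh R d) (hM : simplicial_partition M Omega)
    (orient : {set 'I_(nvert M)} -> bool)
    (t : forall e : {set 'I_(nvert M)}, 'M[R]_(sdim e, d))
    (ht : oriented_orthonormal_frames orient t)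
    (iota : {set 'I_(nvert M)} -> nat)
    (hiota : {in subsimplices M &, injective iota}) :
  [/\ single_valued r k t iota,
      unisolvent r k t iota
    & scaled_dual_basis (PLambda r t) (dof_indices r iota)
        (dual_form (k := k) r t iota) (dof r t iota)].
Proof.
have [elems_free conforming _] := hM.
have frames e : is_face e -> e != finset.set0 -> e \in subsimplices M.
  by move=> fe e0; apply/subsimplicesP.
have t_orth e : is_face e -> e != finset.set0 -> t e *m (t e)^T = 1%:M.
  by move=> fe e0; have [] := ht e (frames e fe e0).
have t_tan e : is_face e -> e != finset.set0 -> (t e :=: tangent e)%MS.
  by move=> fe e0; have [] := ht e (frames e fe e0).
have gram (e : {set 'I_(nvert M)}) : is_face e -> e != finset.set0 ->
    0 < \det (edges e *m (edges e)^T).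
  move=> fe e0; apply: (gram_gt0 e0 (t_orth e fe e0) (t_tan e fe e0)) => s0.
  have [_ _ /(_ s0)] := ht e (frames e fe e0).
  by apply: contraTneq => ->; rewrite mulr0 ltxx.
split.
- exact: single_valued_dof.
- exact: unisolvent_dof.
- exact: dual_basis.
Qed.
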